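(* Let $G=SL_n$, let $p$ be a partition of $n$, $\mathcal{O}=\mathcal{O}_p$, $k$ the gcd of the parts of $p$, and $j\in\{0,\dots,k-1\}$. Given a Levi subgroup $L'$ (a Levi factor of a Richardson parabolic for $\mathcal{O}$) and a weight $\nu$ that defines a character $e^\nu$ of $L'$, the following three conditions are equivalent: (1) The pair $(L',\nu)$ is conjugate to $(L,\mu_j)$. (2) The weight $\nu$ is a $j$-equally distributed weight of $L'$. (3) The character $e^\nu$ is a minimal lift of the character $\chi_j$ of $A(\mathcal{O})$ to $L'$.
   Context: Everything is over $\mathbb{C}$. $G=SL_n$ with diagonal torus $H$, Lie algebra $\mathfrak{h}$, Weyl group $W$, $B$ the lower triangular Borel; $\mathfrak{h}^*=\mathbb{C}^n/\mathbb{C}(1,\dots,1)$. $p=(p_1\ge\dots\ge p_t)$, $k=\gcd(p_i)$, $p'=(p'_1\ge\dots\ge p'_{p_1})$ the transpose partition. $\mathcal{O}=\mathcal{O}_p$ is the orbit of nilpotent matrices of Jordan type $p$; $A(\mathcal{O})=G^e/G^e_0$ for $e\in\mathcal{O}$ (abelian, canonically independent of $e$). A parabolic $P_1=L_1U_1$ is Richardson for $\mathcal{O}$ if $\mathcal{O}\cap\mathfrak{u}_1$ is dense in $\mathfrak{u}_1=\operatorname{Lie}U_1$; then $G^{e_1}=P_1^{e_1}$ for $e_1\in\mathcal{O}\cap\mathfrak{u}_1$. All Levi subgroups considered are Levi factors of Richardson parabolics for $\mathcal{O}$ (these are the conjugates of $L$ below). A Levi subgroup is standard if it contains $H$ and is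 a Levi factor of a parabolic containing $B$. $L$ is the group of block diagonal matrices $(A_1,\dots,A_{p_1})$ in $G$ with $A_i$ of size $p'_i\times p'_i$. Let $e\in\mathcal{O}$ be the matrix whose only nonzero blocks are the blocks $B_i$ (size $p'_{i+1}\times p'_i$) immediately below the diagonal blocks, $(B_i)_{rs}=\delta_{rs}$; $L^e/L^e_0\cong A(\mathcal{O})$. Let $T$ be the diagonal torus of $SL_k$ (positive root spaces upper triangular), $\bar\lambda_j$ its fundamental weights ($\bar\lambda_0=0$), $\bar\mu_j$ the unique weight in the coset of $\bar\lambda_j$ modulo the root lattice whose coefficients $c$ in terms of simple roots satisfy $0\le c<1$; $\rho:L\to T$ sends $(A_i)$ to the diagonal matrix with $r$-th entry $\prod_{i\equiv r\,(k)}\det A_i$; $e^{\mu_j}=\rho^*e^{\bar\mu_j}$. It is trivial on $L^e_0$, and $\chi_j$ is the induced character of $A(\mathcal{O})$. Conjugacy: if $L_2=gL_1g^{-1}$ and $e^{\nu_2}=e^{\nu_1}\circ C_{g^{-1}}$, where $C_{g^{-1}}$ is conjugation by $g^{-1}$, then $(L_2,\nu_2)$ is conjugate by $g$ to $(L_1,\nu_1)$. Equal distribution: a subset $S\subset\{1,\dots,p_1\}$ is $j$-equally distributed if for every distinct part $a$ of $p'$, with multiplicity $n_a$, there are $\frac{jn_a}{k}$ elements $i\in S$ with $p'_i=a$. A weight $\nu$ of $L$ is $j$-equally distributed if it defines a character with $e^\nu(A)=\prod_{i\in S}\det A_i$ for some $j$-equally distributed $S$. For $L'$ conjugate to $L$,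 $\nu$ is a $j$-equally distributed weight of $L'$ if $(L',\nu)$ is conjugate to a pair $(L,\nu_0)$ with $\nu_0$ $j$-equally distributed. Lifting: a character $e^\nu$ of $L_1$ lifts the character $\chi$ of $A(\mathcal{O})$ (is a lift of $\chi$ to $L_1$) if there is a Richardson parabolic $P_1=L_1U_1$ for $\mathcal{O}$ such that, for some $e_1\in\mathcal{O}\cap\mathfrak{u}_1$, the extension of $e^\nu$ to $P_1$ (trivial on $U_1$) is trivial on $(P_1^{e_1})_0$ and induces $\chi$ on $P_1^{e_1}/(P_1^{e_1})_0\cong A(\mathcal{O})$. For $L'$ standard, a lift $e^\nu$ of $\chi$ to $L'$ is minimal if the length of $\nu$ (for a $W$-invariant inner product on the real span of the weights of $G$) is minimal among lifts of $\chi$ to $L'$; for general $L'$, the lift is minimal if $(L',\nu)$ is conjugate to a pair whose Levi subgroup is standard and whose lift is minimal. *)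

(* Defs.v *)
From HB Require Import structures.
From mathcomp Require Import all_boot all_order all_algebra all_fingroup.
From mathcomp Require Import complex.
From mathcomp Require Import boolp classical_sets reals topology.
From mathcomp Require Import mpoly.

Set Implicit Arguments.
Unset Strict Implicit.
Unset Printing Implicit Defensive.

Import Order.TTheory GRing.Theory Num.Theory.
Local Open Scope classical_set_scope.
Local Open Scope ring_scope.

Section Zariski.
Context (F : fieldType) (n : nat).
Implicit Types (A X : 'M[F]_n) (f : {mpoly F[n * n]}).

Definition mxeval f A : F := f.@[mxvec A 0].

Definition zero_locus (S : set ({mpoly F[n * n]})) : set 'M[F]_n :=
  [set A | forall f, S f -> mxeval f A = 0].

Definition zariski_closed (Z : set 'M[F]_n) := exists S, Z = zero_locus S.

(* An alias of the type of matrices, carrying the Zariski topology; ['M[F]_n]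
   itself has a norm topology in the library when F is a numeric field. *)
Definition zariski : Type := 'M[F]_n.

HB.instance Definition _ := Choice.on zariski.

Definition zariski_open (U : set zariski) := zariski_closed (~` U).

Lemma zariski_openT : zariski_open setT.
Proof.
exists [set 1]; apply/seteqP; split=> [A []//|A /= /(_ 1 erefl)] /eqP.
by rewrite /mxeval rmorph1 oner_eq0.
Qed.

Lemma zariski_openI : setI_closed zariski_open.
Proof.
move=> U V [S dU] [T dV].
exists [set h | exists f g, [/\ S f, T g & h = f * g]].
rewrite setCI dU dV; apply/seteqP; split=> [A|A VA].
  move=> + h [f [g [Sf Tg ->]]]; rewrite /mxeval rmorphM /=.
  by case=> [/(_ f Sf) | /(_ g Tg)]; rewrite /mxeval => ->; rewrite ?mul0r ?mulr0.
apply: contrapT => /not_orP[] /existsNP[f /not_implyP[Sf fA]].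
move=> /existsNP[g /not_implyP[Tg gA]].
have /eqP := VA (f * g) (ex_intro _ f (ex_intro _ g (And3 Sf Tg erefl))).
by rewrite /mxeval rmorphM /= mulf_eq0 => /orP[] /eqP.
Qed.

Lemma zariski_open_bigU (I : Type) (U : I -> set zariski) :
  (forall i, zariski_open (U i)) -> zariski_open (\bigcup_i U i).
Proof.
move=> oU; exists [set f | exists2 i, True &
  forall A, ~ U i A -> mxeval f A = 0].
rewrite setC_bigcup; apply/seteqP; split=> [A nUA f [i _]|A VA i _ UA].
  by apply; apply: nUA.
have [S dU] := oU i.
have : (~` U i) A; last by [].
rewrite dU => f Sf; apply: VA; exists i => // B nUB.
by have : (~` U i) B by []; rewrite dU; apply.
Qed.

HB.instance Definition _ := isOpenTopological.Build zariski
  zariski_openT zariski_openI zariski_open_bigU.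

End Zariski.

Section SLn.
Context (F : fieldType) (n : nat).
Implicit Types (a g l u A X : 'M[F]_n) (S P L U V : set 'M[F]_n).

Definition SLn : set 'M[F]_n := [set A | \det A = 1].

(* [is_trig_mx] is lower triangularity *)
Definition borel : set 'M[F]_n := [set A | SLn A /\ is_trig_mx A].

Definition torus : set 'M[F]_n := [set A | SLn A /\ is_diag_mx A].

Definition mxconj g A := g *m A *m invmx g.

Definition closed_subgroup S :=
  [/\ S `<=` SLn, closed (S : set (zariski F n)), S 1%:M,
      forall A B, S A -> S B -> S (A *m B) & forall A, S A -> S (invmx A)].

Definition identity_component S : set 'M[F]_n :=
  connected_component (S : set (zariski F n)) (1%:M : zariski F n).

Definition centralizer S X : set 'M[F]_n := [set a | S a /\ a *m X = X *m a].

(* The tangent space at the identity: the common kernel of the differentials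
   at [1%:M] of the polynomials vanishing on [S]. *)
Definition lie_algebra S : set 'M[F]_n :=
  [set X | forall f : {mpoly F[n * n]}, (forall A, S A -> mxeval f A = 0) ->
     \sum_(q < n * n) mxeval f^`M(q) 1%:M * mxvec X 0 q = 0].

(* Every Borel subgroup is conjugate to [borel]. *)
Definition parabolic P :=
  closed_subgroup P /\ exists2 g, SLn g & mxconj g @` borel `<=` P.

Definition unipotent A := exists m, (A - 1%:M) ^+ m = 0.

Definition connected_normal_unipotent P V :=
  [/\ closed_subgroup V, connected (V : set (zariski F n)), V `<=` P,
      forall a, P a -> mxconj a @` V `<=` V & V `<=` unipotent].

Definition unipotent_radical P U :=
  connected_normal_unipotent P U /\
  forall V, connected_normal_unipotent P V -> V `<=` U.

Definition levi_decomposition P L U :=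
  [/\ unipotent_radical P U, closed_subgroup L, L `&` U = [set 1%:M]
    & P = [set l *m u | l in L & u in U]].

Definition standard_levi L :=
  torus `<=` L /\
  exists P U, [/\ parabolic P, borel `<=` P & levi_decomposition P L U].

(* Characters are regular functions; as [\det A = 1] on [SLn], regular functions
   on a closed subgroup are restrictions of polynomials in the entries. *)
Definition rational_character L (chi : 'M[F]_n -> F) :=
  [/\ exists f, forall A, L A -> chi A = mxeval f A,
      forall A, L A -> chi A != 0
    & forall A B, L A -> L B -> chi (A *m B) = chi A * chi B].

Definition conjugate_pair L2 (nu2 : 'M[F]_n -> F) L1 (nu1 : 'M[F]_n -> F) :=
  exists g, [/\ SLn g, L2 = mxconj g @` L1
    & forall A, L2 A -> nu2 A = nu1 (mxconj (invmx g) A)].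

(* The function on [L U] with value [nu l] at [l *m u]; meaningful when [nu] is
   a character of [L] trivial on [L `&` U]. *)
Definition extend L U (nu : 'M[F]_n -> F) A : F :=
  nu (xget 1%:M [set l | L l /\ U (invmx l *m A)]).

(* [e^v] at the diagonal matrix [t], for a weight [v] of the torus given by a
   representative in Z^n, defined modulo (1, ..., 1). *)
Definition weight_char (v : 'rV[int]_n) (t : 'M[F]_n) : F :=
  \prod_(r < n) t r r ^ v 0 r.

End SLn.

Definition is_partition (n : nat) (p : seq nat) :=
  [&& sorted geq p, 0%N \notin p & sumn p == n].

Definition gcd_parts (p : seq nat) : nat := \big[gcdn/0%N]_(a <- p) a.

Definition transpose_part (p : seq nat) : seq nat :=
  mkseq (fun i => count (fun a => i < a)%N p) (head 0%N p).

Section Weights.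
Context (k : nat).

(* eps_i - eps_(i+1), with coordinates numbered from 0 *)
Definition simple_root (K : pzRingType) (i : nat) : 'rV[K]_k :=
  \row_r ((r == i :> nat)%:R - (r == i.+1 :> nat)%:R).

Definition fundamental_weight (j : nat) : 'rV[int]_k := \row_r (r < j)%N%:R.

(* Weights of the diagonal torus of SL_k are taken modulo (1, ..., 1), whence
   the terms [const_mx z]. *)
Definition is_mubar (j : nat) (m : 'rV[int]_k) :=
  (exists (b : 'I_k.-1 -> int) (z : int),
     m = fundamental_weight j
         + \sum_i b i *: simple_root int i + const_mx z) /\
  (exists (c : 'I_k.-1 -> rat) (z : rat),
     map_mx intr m = \sum_i c i *: simple_root rat i + const_mx z /\
     forall i, 0 <= c i < 1).

Definition mubar (j : nat) : 'rV[int]_k := xget 0 (is_mubar j).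

End Weights.

Section Orbit.
Context (F : fieldType) (n : nat) (p : seq nat).
Local Notation p' := (transpose_part p).
Local Notation k := (gcd_parts p).
Implicit Types (A X : 'M[F]_n).

Definition jordan_nilpotent : 'M[F]_n :=
  \matrix_(i, j)
    ((reshape_index p i == reshape_index p j) && (j == i.+1 :> nat))%:R.

Definition nilpotent_orbit : set 'M[F]_n :=
  [set X | exists2 g, g \in unitmx & X = mxconj g jordan_nilpotent].

Definition block_levi : set 'M[F]_n :=
  [set A : 'M[F]_n | SLn A /\
     forall i j : 'I_n, reshape_index p' i != reshape_index p' j -> A i j = 0].

Definition block (i : nat) : {set 'I_n} :=
  [set r : 'I_n | reshape_index p' r == i]%SET.

Definition block_det (i : nat) A : F :=
  \det (mxsub (@enum_val _ (block i)) (@enum_val _ (block i)) A).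

Definition base_nilpotent : 'M[F]_n :=
  \matrix_(r, s) ((reshape_index p' r == (reshape_index p' s).+1) &&
                  (reshape_offset p' r == reshape_offset p' s))%:R.

Local Notation e := base_nilpotent.

Definition rho A : 'M[F]_k :=
  diag_mx (\row_(r < k) \prod_(i < size p' | (i %% k)%N == r) block_det i A).

Definition emu (j : nat) A : F := weight_char (mubar k j) (rho A).

(* A character of A(O) is represented by its inflation to the centralizer of
   [base_nilpotent]; [chi j] is the character of that centralizer trivial on
   the identity component and equal to [emu j] on the centralizer in L. *)
Definition chi (j : nat) : 'M[F]_n -> F :=
  extend (centralizer block_levi e)
         (identity_component (centralizer (SLn (n := n)) e)) (emu j).

Definition equally_distributed (j : nat) (S : {set 'I_(size p')}) :=
  forall a, a \in p' ->
    (k * #|[set i in S | nth 0%N p' i == a]%SET| = j * count_mem a p')%N.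

Definition equally_distributed_weight (j : nat) L' nu :=
  exists nu0 : 'M[F]_n -> F,
    conjugate_pair L' nu block_levi nu0 /\
    exists2 S, equally_distributed j S
      & forall A, block_levi A -> nu0 A = \prod_(i in S) block_det i A.

Definition richardson P L U :=
  [/\ parabolic P, levi_decomposition P L U
    & lie_algebra U `<=`
      closure (nilpotent_orbit `&` lie_algebra U : set (zariski F n))].

Definition richardson_levi L := exists P U, richardson P L U.

(* The centralizer of [e1] in [P] is identified with that of [e] in [SLn] by
   any [g] taking [e] to [e1]: A(O) being abelian, the choice is immaterial. *)
Definition lifts (theta : 'M[F]_n -> F) L nu :=
  rational_character L nu /\
  exists P U e1,
    [/\ richardson P L U, nilpotent_orbit e1, lie_algebra U e1,
        forall A, identity_component (centralizer P e1) A ->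
          extend L U nu A = 1
      & exists g, [/\ SLn g, e1 = mxconj g e
          & forall A, centralizer P e1 A ->
              extend L U nu A = theta (mxconj (invmx g) A)]].

End Orbit.

(* An inner product on the real span R^n / R(1, ..., 1) of the weights, pulled
   back to R^n, and invariant under the Weyl group. *)
Record weyl_inner_product (R : realType) (n : nat)
    (ip : 'rV[R]_n -> 'rV[R]_n -> R) : Prop := {
  ip_linear : forall a u v w, ip (a *: u + v) w = a * ip u w + ip v w;
  ip_sym : forall u v, ip u v = ip v u;
  ip_const : forall a v, ip (const_mx a) v = 0;
  ip_pos : forall v, (forall a, v != const_mx a) -> 0 < ip v v;
  ip_weyl : forall (s : 'S_n) u v, ip (col_perm s u) (col_perm s v) = ip u v }.

Section MinimalLift.
Context (R : realType) (n : nat) (ip : 'rV[R]_n -> 'rV[R]_n -> R).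
Context (p : seq nat) (theta : 'M[R[i]]_n -> R[i]).

Definition weight_length (v : 'rV[int]_n) : R :=
  Num.sqrt (ip (map_mx intr v) (map_mx intr v)).

Definition has_weight (nu : 'M[R[i]]_n -> R[i]) (v : 'rV[int]_n) :=
  forall t, torus t -> nu t = weight_char v t.

Definition standard_minimal_lift L nu :=
  [/\ standard_levi L, lifts p theta L nu
    & exists2 v, has_weight nu v &
        forall xi w, lifts p theta L xi -> has_weight xi w ->
          weight_length v <= weight_length w].

Definition minimal_lift L nu :=
  lifts p theta L nu /\
  (standard_minimal_lift L nu \/
   ~ standard_levi L /\
   exists L1 nu1, conjugate_pair L nu L1 nu1 /\ standard_minimal_lift L1 nu1).

End MinimalLift.

(* Main.v *)
Require Import Defs.
From mathcomp Require Import all_boot all_order all_algebra all_fingroup.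
From mathcomp Require Import cyclic separable cyclotomic.
From mathcomp Require Import complex boolp classical_sets reals topology.
From mathcomp Require Import mpoly.
From mathcomp Require Import ring lra zify.

Set Implicit Arguments.
Unset Strict Implicit.
Unset Printing Implicit Defensive.

Import Order.TTheory GRing.Theory Num.Theory.
Local Open Scope classical_set_scope.
Local Open Scope ring_scope.

(** Up to conjugation, a Richardson parabolic for the orbit is a block triangular
    subgroup whose Levi factor is [block_levi p] and whose nilradical contains
    [base_nilpotent].  Characters of [block_levi p] are monomials in the block
    determinants, modulo the product of all of them.  The centralizer of
    [base_nilpotent] is connected modulo its intersection with [block_levi p],
    where blocks of equal size have equal determinants; hence a monomial lifts
    [chi j] if and only if, after a common shift of the exponents, their sum over
    the blocks of each size [a] is the one of [emu j], namely j n_a / k.  The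
    squared length of a weight with prescribed sums is, up to constants, the sum of
    the squares m^2 of its coordinates on the torus.  As m <= m^2 for an integer m,
    with equality only for 0 and 1, the minimal lifts are those whose exponents are
    0 or 1, that is, the equally distributed ones, and these are permuted
    transitively by the permutations of blocks of equal size. *)

(** * Elimination over an incidence relation *)

Section Incidence.
Context (F : fieldType) (n : nat).
Implicit Types (R : rel 'I_n) (A B g h : 'M[F]_n).

(** The definition of a lift allows every Richardson parabolic with the given Levi factor, so the
    diagonal blocks may occur in any order. The order is carried by an injective relabelling [tau]
    of the blocks, and [base_nilpotent] is then replaced by a conjugate, obtained by reordering each
    of its chains, that lies in the nilradical for that order. The obstacle is to compare this
    element with an arbitrary orbit element of the nilradical: a conjugator between them must lie in
    the parabolic. This follows from linear algebra on flags: kernels of powers are bounded below by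
    sums of gaps, and a flag for which the bounds are attained can be recovered from its top term.
    The same fact puts the centralizer of [base_nilpotent] in its parabolic. The exponents of a lift
    are then read off from its values at diagonal matrices that are constant along the chains.
    Connectedness and density are checked along lines of matrices, by means of polynomials in one
    variable. *)

Lemma invmx_closed (Q : 'M[F]_n -> Prop) :
  (forall c, Q c%:M) -> (forall A B, Q A -> Q B -> Q (A + B)) ->
  (forall A B, Q A -> Q B -> Q (A *m B)) ->
  forall A, A \in unitmx -> Q A -> Q (invmx A).
Proof.
case: n Q => [|m] Q Qc QD QM A uA QA.
  by rewrite (flatmx0 (invmx A)) -(flatmx0 0%:M).
have Qh p : Q (horner_mx A p).
  elim/poly_ind: p => [|p c IH]; first by rewrite rmorph0 -(scale0r 1%:M) scalemx1.
  by rewrite rmorphD rmorphM /= horner_mx_X horner_mx_C; apply: QD => //; apply: QM.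
have := Cayley_Hamilton A; have := char_poly_det A.
(* The constant coefficient is the determinant up to sign, so Cayley-Hamilton writes the inverse of
   [A] as a polynomial in [A]. *)
elim/poly_ind: (char_poly A) => [|p c _].
  by rewrite coef0 => /esym/eqP; rewrite mulf_eq0 signr_eq0 /= -[_ == 0]negbK -unitfE -unitmxE uA.
rewrite -mulrC coefD coefXM coefC eqxx add0r => dc.
have c0 : c != 0.
  by rewrite dc mulf_neq0 ?signr_eq0 // -unitfE -unitmxE.
rewrite rmorphD rmorphM /= horner_mx_X horner_mx_C => /eqP.
rewrite addr_eq0 => /eqP AE.
have -> : invmx A = (- c^-1)%:M *m horner_mx A p.
  rewrite -[RHS](mulKmx uA) [A *m (_ *m _)]mulmxA scalar_mxC -mulmxA.
  by rewrite [A *m _]AE mulmxN -scalar_mxM mulNr mulVf // -scalemx1 scaleN1r opprK mulmx1.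
exact: QM.
Qed.

Definition supported R A := forall i j, ~~ R i j -> A i j = 0.

Lemma supportedD R A B : supported R A -> supported R B -> supported R (A + B).
Proof. by move=> sA sB i j nR; rewrite mxE sA // sB // addr0. Qed.

Lemma supported_scalar R c : reflexive R -> supported R (c%:M : 'M[F]_n).
Proof.
by move=> rR i j; rewrite mxE; case: eqP => // ->; rewrite rR.
Qed.

Lemma supported_diag R A : reflexive R -> is_diag_mx A -> supported R A.
Proof.
move=> rR /is_diag_mxP dA i j nR; apply: dA; apply: contraNneq nR => /val_inj ->.
exact: rR.
Qed.

Lemma supportedM R A B :
  transitive R -> supported R A -> supported R B -> supported R (A *m B).
Proof.
move=> tR sA sB i j nR; rewrite mxE big1 // => k _.
have [Rik|/sA ->] := boolP (R i k); last by rewrite mul0r.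
by rewrite sB ?mulr0 //; apply: contra nR; apply: tR.
Qed.

Lemma supportedV R A : reflexive R -> transitive R ->
  A \in unitmx -> supported R A -> supported R (invmx A).
Proof.
move=> rR tR; apply: invmx_closed => [c|B C|B C].
- exact: supported_scalar.
- exact: supportedD.
- exact: supportedM.
Qed.

Definition elem_mx (c d : 'I_n) (x : F) : 'M[F]_n := 1%:M + x *: delta_mx c d.

Lemma elem_mxE c d x i j :
  elem_mx c d x i j = (i == j)%:R + x * ((i == c) && (j == d))%:R.
Proof. by rewrite !mxE. Qed.

Lemma elem_mxM c d x y : c != d -> elem_mx c d x *m elem_mx c d y = elem_mx c d (x + y).
Proof.
move=> cd; rewrite /elem_mx mulmxDl !mulmxDr !mul1mx mulmx1 -scalemxAl -scalemxAr.
by rewrite mul_delta_mx_0 1?eq_sym // !scaler0 addr0 scalerDl -addrA [y *: _ + _]addrC.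
Qed.

Lemma elem_mx0 c d : elem_mx c d 0 = 1%:M.
Proof. by rewrite /elem_mx scale0r addr0. Qed.

Lemma det_elem_mx c d x : c != d -> \det (elem_mx c d x) = 1.
Proof.
move=> cd.
have H (a b : 'I_n) : (b < a)%N -> \det (elem_mx a b x) = 1.
  move=> ba; rewrite det_trig; last first.
    apply/is_trig_mxP => i j ij; rewrite elem_mxE (negbTE (_ : i != j)) ?add0r; last first.
      by apply: contraTneq ij => ->; rewrite ltnn.
    case: eqP => [ia|]; case: eqP => [jb|] //=; rewrite ?mulr0 //.
    by subst; move: (ltn_trans ij ba); rewrite ltnn.
  rewrite big1 // => i _; rewrite elem_mxE eqxx; case: eqP => [->|] /=; rewrite ?mulr0 ?addr0 //.
  by rewrite (_ : a == b = false) ?mulr0 ?addr0 //; apply: contraTF ba => /eqP ->; rewrite ltnn.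
have [dc|dc|/val_inj e] := ltngtP d c; [exact: H| |by rewrite e eqxx in cd].
rewrite -det_tr -(H _ _ dc); congr (\det _).
apply/matrixP => i j; rewrite mxE !elem_mxE [j == i]eq_sym; congr (_ + _ * _%:R).
by rewrite andbC.
Qed.

Lemma elem_mx_supp R c d x : reflexive R -> R c d -> supported R (elem_mx c d x).
Proof.
move=> rR Rcd i j nR; rewrite elem_mxE; case: (i =P j) nR => [->|_ nR]; first by rewrite rR.
by case: eqP nR => [->|]; case: eqP => [->|]; rewrite ?Rcd //= mulr0 addr0.
Qed.

Lemma det_neq0_perm A : \det A != 0 -> exists s : 'S_n, forall i, A i (s i) != 0.
Proof.
move=> dA; apply: contrapT => nP; move/eqP: dA; apply.
rewrite /determinant big1 // => s _.
suff [i /eqP Ai0] : exists i, A i (s i) == 0 by rewrite (bigD1 i) //= Ai0 mul0r mulr0.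
apply: contrapT => nE; apply: nP; exists s => i.
by apply/negP => Ai; apply: nE; exists i.
Qed.

(** The inverse of [s] is a power of [s], so transitivity carries the relation all the way around
    each cycle. *)
Lemma perm_cycle R (s : 'S_n) : reflexive R -> transitive R ->
  (forall i, R i (s i)) -> forall i, R (s i) i.
Proof.
move=> rR tR Rs i.
have Rk k j : R j ((s ^+ k)%g j).
  elim: k => [|k IH]; first by rewrite expg0 perm1.
  by rewrite expgSr permM; apply: tR IH (Rs _).
have := Rk #[s]%g.-1 (s i).
by rewrite -permM -expgS prednK ?order_gt0 // expg_order perm1.
Qed.

(** Gaussian elimination that never leaves the incidence group of a preorder. It serves twice: to
    recover a parabolic from its root subgroups, and to compare two characters on the torus only. *)
Lemma elimination R (G : 'M[F]_n -> Prop) : reflexive R -> transitive R ->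
  (forall A B, G A -> G B -> G (A *m B)) ->
  (forall A, torus A -> G A) ->
  (forall c d x, c != d -> R c d -> G (elem_mx c d x)) ->
  forall A, SLn A -> supported R A -> G A.
Proof.
move=> rR tR GM GT GE.
(* Rows and columns of index below [m] are already diagonal; the induction is on the number [d] of
   remaining ones. *)
pose clean m A := forall i j : 'I_n, (minn i j < m)%N -> i != j -> A i j = 0.
pose H A := G A /\ \det A = 1.
have HM A B : H A -> H B -> H (A *m B).
  by move=> [? dA] [? dB]; split; [exact: GM|rewrite det_mulmx dA dB mulr1].
have H1 : H 1%:M.
  by split; rewrite ?det1 //; apply: GT; split; [exact: det1|exact: scalar_mx_is_diag].
have HE c d x : c != d -> R c d -> H (elem_mx c d x).
  by move=> cd Rcd; split; [exact: GE|exact: det_elem_mx].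
have Hcol (k : 'I_n) (c : 'I_n -> F) (s : seq 'I_n) :
    (forall i, i \in s -> i != k /\ R i k) ->
    H (1%:M + \sum_(i <- s) c i *: delta_mx i k).
  elim: s => [|i s IH] hs; first by rewrite big_nil addr0.
  have [ik Rik] := hs i (mem_head _ _).
  have /IH Hs : forall i, i \in s -> i != k /\ R i k.
    by move=> l ls; apply: hs; rewrite inE ls orbT.
  have -> : 1%:M + \sum_(l <- i :: s) c l *: delta_mx l k =
            (1%:M + \sum_(l <- s) c l *: delta_mx l k) *m elem_mx i k (c i).
    have Z : (\sum_(l <- s) c l *: delta_mx l k) *m delta_mx i k = 0 :> 'M[F]_n.
      rewrite mulmx_suml big1 // => l _.
      by rewrite -scalemxAl mul_delta_mx_0 ?scaler0 // eq_sym.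
    by rewrite big_cons /elem_mx mulmxDr mulmx1 -scalemxAr mulmxDl mul1mx Z addr0 -addrA [c i *:
      _ + _]addrC.
  by apply: HM => //; apply: HE.
have Hrow (k : 'I_n) (c : 'I_n -> F) (s : seq 'I_n) :
    (forall i, i \in s -> i != k /\ R k i) ->
    H (1%:M + \sum_(i <- s) c i *: delta_mx k i).
  elim: s => [|i s IH] hs; first by rewrite big_nil addr0.
  have [ik Rik] := hs i (mem_head _ _).
  have /IH Hs : forall i, i \in s -> i != k /\ R k i.
    by move=> l ls; apply: hs; rewrite inE ls orbT.
  have -> : 1%:M + \sum_(l <- i :: s) c l *: delta_mx k l =
            elem_mx k i (c i) *m (1%:M + \sum_(l <- s) c l *: delta_mx k l).
    have Z : delta_mx k i *m (\sum_(l <- s) c l *: delta_mx k l) = 0 :> 'M[F]_n.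
      rewrite mulmx_sumr big1 // => l _.
      by rewrite -scalemxAr mul_delta_mx_0 ?scaler0.
    by rewrite big_cons /elem_mx mulmxDl mul1mx -scalemxAl mulmxDr mulmx1 Z addr0 -addrA [c i *:
      _ + _]addrC.
  by apply: HM => //; apply: HE => //; rewrite eq_sym.
have HV A B : H A -> SLn (B *m A) -> SLn B by move=> [_ dA]; rewrite /SLn /= det_mulmx dA mulr1.
suff main d m A : (m + d = n)%N -> SLn A -> supported R A -> clean m A -> H A.
  by move=> A sA rA; have [|] := main n 0%N A erefl sA rA; first move=> i j; rewrite ?ltn0.
elim: d m A => [|d IH] m A; first rewrite addn0 => mn dA rA cA.
    split=> //; apply: GT; split=> //; apply/is_diag_mxP => i j ij; apply: cA.
      by rewrite mn gtn_min ltn_ord.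
    by apply: contra_neq ij => ->.
  move=> mdn dA rA cA.
  have mn : (m < n)%N by rewrite -mdn -addSnnS leq_addr.
  pose k := Ordinal mn.
  (* A zero pivot is repaired by adding column [s k] to column [k], where [s] is a permutation
     inside the support of [A]. Going around the cycle of [s] gives [R (s k) k], so this operation
     is admissible. *)
  suff piv A1 : SLn A1 -> supported R A1 -> clean m A1 -> A1 k k != 0 -> H A1.
    have [Akk|] := eqVneq (A k k) 0; last exact: piv.
    have [s hs] : exists s : 'S_n, forall i, A i (s i) != 0.
      by apply: det_neq0_perm; rewrite dA oner_neq0.
    have Rs i : R i (s i) by apply: contraNT (hs i) => /rA ->.
    have sk : s k != k by apply: contraTneq (hs k) => ->; rewrite Akk eqxx.
    have Rsk := perm_cycle rR tR Rs k.
    have ms : (m <= s k)%N.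
      rewrite leqNgt; apply: contraNN (hs k) => ski; apply/eqP/cA; last by rewrite eq_sym.
      by rewrite gtn_min ski orbT.
    have -> : A = (A *m elem_mx (s k) k 1) *m elem_mx (s k) k (-1).
      by rewrite -mulmxA elem_mxM // subrr elem_mx0 mulmx1.
    have A1E i j : (A *m elem_mx (s k) k 1) i j = A i j + (j == k)%:R * A i (s k).
      rewrite /elem_mx scale1r mulmxDr mulmx1 mxE; congr (_ + _).
      rewrite mxE (bigD1 (s k)) //= big1 ?addr0; last first.
        by move=> l lk; rewrite mxE (negbTE lk) mulr0.
      by rewrite mxE eqxx /= mulrC.
    apply: HM; last exact: HE.
    apply: piv.
    - by rewrite /SLn /= det_mulmx det_elem_mx // dA mulr1.
    - by apply: supportedM => //; apply: elem_mx_supp.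
    - move=> i j mij ij; rewrite A1E cA // add0r.
      case: eqP => [jk|_]; last by rewrite mul0r.
      rewrite mul1r; subst j; rewrite gtn_min ltnn orbF in mij.
      apply: cA; first by rewrite gtn_min mij.
      by apply: contraTneq mij => ->; rewrite -leqNgt.
    - by rewrite A1E eqxx mul1r Akk add0r.
  move=> {dA rA cA A} dA rA cA Akk.
  (* [C 1] clears column [k] and [Q 1] clears row [k]; the parameter -1 gives their inverses. The
     lists keep only nonzero entries, so that every elementary factor is allowed by [R]. *)
  pose c i := - (A1 i k / A1 k k); pose r j := - (A1 k j / A1 k k).
  pose sc := [seq i <- enum 'I_n | (i != k) && (A1 i k != 0)].
  pose sr := [seq i <- enum 'I_n | (i != k) && (A1 k i != 0)].
  pose C x := 1%:M + \sum_(i <- sc) (x * c i) *: delta_mx i k : 'M[F]_n.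
  pose Q x := 1%:M + \sum_(i <- sr) (x * r i) *: delta_mx k i : 'M[F]_n.
  have hC x : H (C x).
    apply: Hcol => i; rewrite mem_filter mem_enum andbT => /andP[-> Ai]; split=> //.
    by apply: contraNT Ai => /rA ->.
  have hQ x : H (Q x).
    apply: Hrow => i; rewrite mem_filter mem_enum andbT => /andP[-> Ai]; split=> //.
    by apply: contraNT Ai => /rA ->.
  have sumC x i j : (C x) i j = (i == j)%:R + x * c i * (i != k)%:R * (j == k)%:R.
    rewrite mxE summxE mxE; congr (_ + _); rewrite big_filter big_enum_cond /=.
    rewrite (eq_bigr (fun l => x * c l * ((i == l) && (j == k))%:R)); last by move=> l _;
      rewrite !mxE.
    have [Pi|Pi] := boolP ((i != k) && (A1 i k != 0)).
      rewrite (bigD1 i) //= big1 ?addr0; last first.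
        by move=> l /andP[_ li]; rewrite eq_sym (negbTE li) mulr0.
      by case/andP: Pi => -> _; rewrite eqxx mulr1.
    rewrite big1 => [|l Pl]; last first.
      by case: eqP => [il|]; rewrite ?mulr0 //; subst l; rewrite Pl in Pi.
    have [ik|ik] := eqVneq i k; first by rewrite mulr0 mul0r.
    by rewrite ik /= negbK in Pi; rewrite /c (eqP Pi) mul0r oppr0 mulr0 !mul0r.
  have sumQ x i j : (Q x) i j = (i == j)%:R + x * r j * (j != k)%:R * (i == k)%:R.
    rewrite mxE summxE mxE; congr (_ + _); rewrite big_filter big_enum_cond /=.
    rewrite (eq_bigr (fun l => x * r l * ((j == l) && (i == k))%:R)); last first.
      by move=> l _; rewrite !mxE andbC.
    have [Pi|Pi] := boolP ((j != k) && (A1 k j != 0)).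
      rewrite (bigD1 j) //= big1 ?addr0; last first.
        by move=> l /andP[_ li]; rewrite eq_sym (negbTE li) mulr0.
      by case/andP: Pi => -> _; rewrite eqxx mulr1.
    rewrite big1 => [|l Pl]; last first.
      by case: eqP => [il|]; rewrite ?mulr0 //; subst l; rewrite Pl in Pi.
    have [ik|ik] := eqVneq j k; first by rewrite mulr0 mul0r.
    by rewrite ik /= negbK in Pi; rewrite /r (eqP Pi) mul0r oppr0 mulr0 !mul0r.
  have CM x B i j : (C x *m B) i j = B i j + x * c i * (i != k)%:R * B k j.
    rewrite mxE (eq_bigr (fun l => (i == l)%:R * B l j +
        x * c i * (i != k)%:R * ((l == k)%:R * B l j))); last first.
      by move=> l _; rewrite sumC mulrDl !mulrA.
    rewrite big_split /= -mulr_sumr; congr (_ + _ * _).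
      rewrite (bigD1 i) //= eqxx mul1r big1 ?addr0 // => l li.
      by rewrite eq_sym (negbTE li) mul0r.
    rewrite (bigD1 k) //= eqxx mul1r big1 ?addr0 // => l li.
    by rewrite (negbTE li) mul0r.
  have MQ x B i j : (B *m Q x) i j = B i j + B i k * (x * r j * (j != k)%:R).
    rewrite mxE (eq_bigr (fun l => B i l * (l == j)%:R +
        B i l * (l == k)%:R * (x * r j * (j != k)%:R))); last first.
      by move=> l _; rewrite sumQ mulrDr; ring.
    rewrite big_split /= -mulr_suml; congr (_ + _ * _).
      rewrite (bigD1 j) //= eqxx mulr1 big1 ?addr0 // => l li.
      by rewrite (negbTE li) mulr0.
    rewrite (bigD1 k) //= eqxx mulr1 big1 ?addr0 // => l li.
    by rewrite (negbTE li) mulr0.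
  have CV : C (-1) *m C 1 = 1%:M.
    by apply/matrixP => i j; rewrite CM !sumC [RHS]mxE eqxx /= [k == j]eq_sym; ring.
  have QV : Q 1 *m Q (-1) = 1%:M.
    by apply/matrixP => i j; rewrite MQ !sumQ [RHS]mxE eqxx /=; ring.
  have AE i j : (C 1 *m A1 *m Q 1) i j =
      A1 i j + c i * (i != k)%:R * A1 k j
      + (A1 i k + c i * (i != k)%:R * A1 k k) * (r j * (j != k)%:R).
    by rewrite MQ !CM; ring.
  have -> : A1 = C (-1) *m (C 1 *m A1 *m Q 1) *m Q (-1).
    by rewrite !mulmxA CV mul1mx -mulmxA QV mulmx1.
  apply: (HM _ _) => //; apply: (HM _ _) => //; apply: (IH m.+1 _).
  - by rewrite addSnnS.
  - by rewrite /SLn /= !det_mulmx dA !(proj2 (hC _), proj2 (hQ _)) !mulr1.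
  - apply: supportedM => //; first apply: supportedM => //.
      move=> i j nR; rewrite sumC.
      have [ij|ij] := eqVneq i j; first by rewrite ij rR in nR.
      case: (j =P k) nR => [->|_ _]; rewrite ?mulr0 ?addr0 //= => /rA.
      by rewrite /c => ->; rewrite mul0r oppr0 mulr0 !mul0r addr0.
    move=> i j nR; rewrite sumQ.
    have [ij|ij] := eqVneq i j; first by rewrite ij rR in nR.
    case: (i =P k) nR => [->|_ _]; rewrite ?mulr0 ?addr0 //= => /rA.
    by rewrite /r => ->; rewrite mul0r oppr0 mulr0 !mul0r addr0.
  - move=> i j; rewrite ltnS leq_eqVlt => /orP[/eqP mij|mij] ij; last first.
      rewrite AE (cA _ _ mij ij) add0r.
      have [im|im] := ltnP i m.
        have e : A1 i k = 0.
          by apply: cA; rewrite ?gtn_min ?im //; apply: contraTneq im => ->; rewrite ltnn.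
        by rewrite /c e !(mul0r, oppr0, addr0).
      have jm : (j < m)%N by move: mij; rewrite gtn_min ltnNge im.
      have e : A1 k j = 0.
        by apply: cA; rewrite ?gtn_min ?jm ?orbT // eq_sym; apply: contraTneq jm => ->;
          rewrite ltnn.
      by rewrite /r e !(mul0r, oppr0, addr0, mulr0).
    have [ik|ik] := eqVneq i k.
      rewrite AE ik eqxx /= !(mulr0, mul0r, addr0) -ik eq_sym ij mulr1 ik /r.
      by rewrite mulrN mulrC divfK // subrr.
    have jk : j = k.
      apply: val_inj; move: mij; rewrite /minn; case: ltnP => // _ e; case/eqP: ik.
      by apply: val_inj.
    by rewrite AE jk ik eqxx !(mulr1, mulr0) addr0 /c mulNr divfK // subrr.
Qed.

End Incidence.

(** * Regular functions and the Zariski topology *)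

Lemma mpoly_alg_ind (F : fieldType) (m : nat) (P : {mpoly F[m]} -> Prop) :
  (forall c, P c%:MP) -> (forall i, P 'X_i) ->
  (forall f g, P f -> P g -> P (f + g)) -> (forall f g, P f -> P g -> P (f * g)) ->
  forall f, P f.
Proof.
move=> Pc PX PD PM; apply: mpolyind => [|c u p _ _ Pp]; first by rewrite -(mpolyC0 m F).
apply/PD => //; rewrite -mul_mpolyC; apply/PM => //; rewrite mpolyXE_id.
apply: (big_ind P) => [|f g Pf Pg|i _]; [by rewrite -mpolyC1|exact/PM|].
elim: (u i) => [|k IH]; first by rewrite expr0 -mpolyC1.
by rewrite exprS; apply/PM.
Qed.

Section FunctionAlgebras.
Context (F : fieldType) (T : Type) (C : (T -> F) -> Prop).

(** One interface for regular functions of a matrix, polynomial functions of a parameter and Laurent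
    functions on nonzero scalars: determinants, adjugates and matrix powers are treated once for all
    three. *)
Record funalg : Prop := {
  fa_const : forall c, C (fun=> c);
  fa_add : forall f g, C f -> C g -> C (fun x => f x + g x);
  fa_mul : forall f g, C f -> C g -> C (fun x => f x * g x) }.

Hypothesis CA : funalg.

Lemma fa_ext f g : f =1 g -> C f -> C g.
Proof. by move=> /funext ->. Qed.

Lemma fa_sum (I : Type) (r : seq I) (P : pred I) (f : I -> T -> F) :
  (forall i, P i -> C (f i)) -> C (fun x => \sum_(i <- r | P i) f i x).
Proof.
move=> Cf; elim: r => [|i r IH].
  by apply: fa_ext (fa_const CA 0) => x; rewrite big_nil.
have [Pi|Pi] := boolP (P i).
  by apply: fa_ext (fa_add CA (Cf i Pi) IH) => x; rewrite big_cons Pi.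
by apply: fa_ext IH => x; rewrite big_cons (negbTE Pi).
Qed.

Lemma fa_prod (I : Type) (r : seq I) (P : pred I) (f : I -> T -> F) :
  (forall i, P i -> C (f i)) -> C (fun x => \prod_(i <- r | P i) f i x).
Proof.
move=> Cf; elim: r => [|i r IH].
  by apply: fa_ext (fa_const CA 1) => x; rewrite big_nil.
have [Pi|Pi] := boolP (P i).
  by apply: fa_ext (fa_mul CA (Cf i Pi) IH) => x; rewrite big_cons Pi.
by apply: fa_ext IH => x; rewrite big_cons (negbTE Pi).
Qed.

Lemma fa_exp f k : C f -> C (fun x => f x ^+ k).
Proof.
move=> Cf; elim: k => [|k IH]; first exact: fa_const.
by apply: fa_ext (fa_mul CA Cf IH) => x; rewrite exprS.
Qed.

Definition fa_mx m k (M : T -> 'M[F]_(m, k)) := forall i j, C (fun x => M x i j).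

Lemma fa_cst m k (A : 'M[F]_(m, k)) : fa_mx (fun=> A).
Proof. by move=> i j; apply: fa_const. Qed.

Lemma fa_addmx m k (A B : T -> 'M[F]_(m, k)) :
  fa_mx A -> fa_mx B -> fa_mx (fun x => A x + B x).
Proof. by move=> CM CB i j; apply: fa_ext (fa_add CA (CM i j) (CB i j)) => x; rewrite mxE. Qed.

Lemma fa_scalemx m k (f : T -> F) (B : T -> 'M[F]_(m, k)) :
  C f -> fa_mx B -> fa_mx (fun x => f x *: B x).
Proof. by move=> Cf CB i j; apply: fa_ext (fa_mul CA Cf (CB i j)) => x; rewrite mxE. Qed.

Lemma fa_mulmx m k l (A : T -> 'M[F]_(m, k)) (B : T -> 'M[F]_(k, l)) :
  fa_mx A -> fa_mx B -> fa_mx (fun x => A x *m B x).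
Proof.
move=> CM CB i j.
apply: (@fa_ext (fun x => \sum_l A x i l * B x l j)) => [x|]; first by rewrite mxE.
by apply: fa_sum => l' _; apply: fa_mul.
Qed.

Lemma fa_expmx m (A : T -> 'M[F]_m) k : fa_mx A -> fa_mx (fun x => A x ^+ k).
Proof.
move=> CM; elim: k => [|k IH]; first exact: fa_cst.
have -> : (fun x => A x ^+ k.+1) = (fun x => A x *m A x ^+ k).
  by apply/funext => x; rewrite exprS.
exact: fa_mulmx.
Qed.

Lemma fa_det m (A : T -> 'M[F]_m) : fa_mx A -> C (fun x => \det (A x)).
Proof.
move=> CM; apply: (@fa_ext (fun x => \sum_(s : 'S_m) (-1) ^+ s * \prod_i A x i (s i))) => //.
apply: fa_sum => s _; apply: (fa_mul CA) => //; first exact: fa_const.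
by apply: fa_prod.
Qed.

Lemma fa_adj m (A : T -> 'M[F]_m) : fa_mx A -> fa_mx (fun x => \adj (A x)).
Proof.
move=> CM i j; apply: (@fa_ext (fun x => cofactor (A x) j i)) => [x|]; first by rewrite mxE.
apply: (fa_mul CA) => //; first exact: fa_const.
apply: fa_det => k l; apply: fa_ext (CM (lift j k) (lift i l)) => x.
by rewrite !mxE.
Qed.

Lemma fa_meval m (f : {mpoly F[m]}) (v : T -> 'I_m -> F) :
  (forall i, C (fun x => v x i)) -> C (fun x => f.@[v x]).
Proof.
move=> Cv; elim/mpoly_alg_ind: f => [c|i|f g IHf IHg|f g IHf IHg].
- by apply: fa_ext (fa_const CA c) => x; rewrite mevalC.
- by apply: fa_ext (Cv i) => x; rewrite mevalXU.
- by apply: fa_ext (fa_add CA IHf IHg) => x; rewrite mevalD.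
- by apply: fa_ext (fa_mul CA IHf IHg) => x; rewrite mevalM.
Qed.

End FunctionAlgebras.

Section Regular.
Context (F : fieldType) (n : nat).
Implicit Types (A B X g h : 'M[F]_n) (f : {mpoly F[n * n]}).

Definition regular (phi : 'M[F]_n -> F) := exists f, forall A, phi A = mxeval f A.

Definition polyfun (g : F -> F) := exists G : {poly F}, forall t, g t = G.[t].

Lemma regular_alg : funalg regular.
Proof.
split=> [c|f g [f' fE] [g' gE]|f g [f' fE] [g' gE]].
- by exists c%:MP => A; rewrite /mxeval mevalC.
- by exists (f' + g') => A; rewrite /mxeval mevalD fE gE.
- by exists (f' * g') => A; rewrite /mxeval mevalM fE gE.
Qed.

Lemma regular_coord i j : regular (fun A => A i j).
Proof. by exists 'X_(mxvec_index i j) => A; rewrite /mxeval mevalXU mxvecE. Qed.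

Lemma regular_mxeval f : regular (mxeval f).
Proof. by exists f. Qed.

Lemma polyfun_alg : funalg polyfun.
Proof.
split=> [c|f g [f' fE] [g' gE]|f g [f' fE] [g' gE]].
- by exists c%:P => t; rewrite hornerC.
- by exists (f' + g') => t; rewrite hornerD fE gE.
- by exists (f' * g') => t; rewrite hornerM fE gE.
Qed.

Lemma polyfun_id : polyfun id.
Proof. by exists 'X => t; rewrite hornerX. Qed.

Lemma fa_mxeval (T : Type) (C : (T -> F) -> Prop) (CA : funalg C) f (M : T -> 'M[F]_n) :
  fa_mx C M -> C (fun x => mxeval f (M x)).
Proof.
move=> CM; apply: fa_meval => // q; case/mxvec_indexP: q => i j.
by apply: fa_ext (CM i j) => x; rewrite mxvecE.
Qed.

Lemma polyfun_line f A X : polyfun (fun t => mxeval f (A + t *: X)).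
Proof.
apply: (fa_mxeval polyfun_alg); apply: (fa_addmx polyfun_alg).
  exact: (fa_cst polyfun_alg).
apply: (fa_scalemx polyfun_alg); first exact: polyfun_id.
exact: (fa_cst polyfun_alg).
Qed.

(** Both expressions obey the Leibniz rule, so induction on [f] reduces to coordinates. Tangency
    thus becomes a statement on polynomials in one variable. *)
Lemma mxeval_derivE f A X : exists G : {poly F},
  (forall t, mxeval f (A + t *: X) = G.[t]) /\
  \sum_(q < n * n) mxeval f^`M(q) A * mxvec X 0 q = (G^`()).[0].
Proof.
elim/mpoly_alg_ind: f => [c|i|f g [f' [fE dfE]] [g' [gE dgE]]|f g [f' [fE dfE]] [g' [gE dgE]]].
- exists c%:P; split=> [t|]; first by rewrite /mxeval mevalC hornerC.
  by rewrite derivC horner0 big1 // => q _; rewrite mderivC /mxeval meval0 mul0r.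
- exists ((mxvec A 0 i)%:P + (mxvec X 0 i)%:P * 'X); split=> [t|].
    by rewrite /mxeval mevalXU !hornerE linearD linearZ /= !mxE mulrC.
  rewrite derivD derivC add0r derivM derivC mul0r add0r derivX !hornerE.
  rewrite (bigD1 i) //= big1 => [|q qi]; rewrite mderivX mnmE.
    have -> : (U_(i) - U_(i))%MM = 0%MM by apply/mnmP => k; rewrite mnmBE subnn mnm0E.
    by rewrite eqxx scale1r /mxeval mpolyX0 meval1 mul1r addr0.
  by rewrite eq_sym (negbTE qi) scale0r /mxeval meval0 mul0r.
- exists (f' + g'); split=> [t|]; first by rewrite /mxeval mevalD hornerD -fE -gE.
  rewrite derivD hornerD -dfE -dgE -big_split /=; apply: eq_bigr => q _.
  by rewrite mderivD /mxeval mevalD mulrDl.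
- exists (f' * g'); split=> [t|]; first by rewrite /mxeval mevalM hornerM -fE -gE.
  have f0 : f'.[0] = mxeval f A by rewrite -fE scale0r addr0.
  have g0 : g'.[0] = mxeval g A by rewrite -gE scale0r addr0.
  rewrite derivM hornerD !hornerM -dfE -dgE f0 g0 mulr_suml mulr_sumr -big_split /=.
  apply: eq_bigr => q _; rewrite mderivM /mxeval mevalD !mevalM.
  by ring.
Qed.

End Regular.

Section Conjugation.
Context (F : fieldType) (n : nat).
Implicit Types (A B X g h : 'M[F]_n) (S : set 'M[F]_n).

Lemma mxconj1 A : mxconj 1%:M A = A.
Proof. by rewrite /mxconj invmx1 mulmx1 mul1mx. Qed.

Lemma mxconj_id g : g \in unitmx -> mxconj g 1%:M = 1%:M.
Proof. by move=> ug; rewrite /mxconj mulmx1 mulmxV. Qed.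

Lemma mxconjM g A B : g \in unitmx -> mxconj g (A *m B) = mxconj g A *m mxconj g B.
Proof. by move=> ug; rewrite /mxconj !mulmxA mulmxKV. Qed.

Lemma invmxM g h : g \in unitmx -> h \in unitmx ->
  invmx (g *m h) = invmx h *m invmx g.
Proof.
move=> ug uh; apply: (canRL (mulKmx uh)); rewrite -[RHS]mulmx1.
by apply: (canRL (mulKmx ug)); rewrite mulmxA mulmxV // unitmx_mul ug.
Qed.

Lemma mxconj_comp g h A : g \in unitmx -> h \in unitmx ->
  mxconj g (mxconj h A) = mxconj (g *m h) A.
Proof. by move=> ug uh; rewrite /mxconj invmxM // !mulmxA. Qed.

Lemma mxconjK g : g \in unitmx -> cancel (mxconj g) (mxconj (invmx g)).
Proof.
by move=> ug A; rewrite mxconj_comp ?unitmx_inv // mulVmx // mxconj1.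
Qed.

Lemma mxconjVK g : g \in unitmx -> cancel (mxconj (invmx g)) (mxconj g).
Proof.
by move=> ug A; rewrite mxconj_comp ?unitmx_inv // mulmxV // mxconj1.
Qed.

Lemma mxconjD g A B : mxconj g (A + B) = mxconj g A + mxconj g B.
Proof. by rewrite /mxconj mulmxDr mulmxDl. Qed.

Lemma mxconjB g A B : mxconj g (A - B) = mxconj g A - mxconj g B.
Proof. by rewrite /mxconj mulmxBr mulmxBl. Qed.

Lemma mxconjZ g c A : mxconj g (c *: A) = c *: mxconj g A.
Proof. by rewrite /mxconj -scalemxAr -scalemxAl. Qed.

Lemma mxconj_exp g A k : g \in unitmx -> mxconj g (A ^+ k) = mxconj g A ^+ k.
Proof.
move=> ug; elim: k => [|k IH]; first by rewrite !expr0 mxconj_id.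
by rewrite !exprS -IH; exact: mxconjM.
Qed.

Lemma det_mxconj g A : g \in unitmx -> \det (mxconj g A) = \det A.
Proof.
move=> ug; rewrite /mxconj !det_mulmx det_inv mulrAC mulfV ?mul1r //.
by rewrite -unitfE -unitmxE.
Qed.

Lemma mxconj_unit g A : g \in unitmx -> (mxconj g A \in unitmx) = (A \in unitmx).
Proof. by move=> ug; rewrite !unitmxE det_mxconj. Qed.

Lemma mxconjV g A : g \in unitmx -> A \in unitmx ->
  mxconj g (invmx A) = invmx (mxconj g A).
Proof.
move=> ug uA; have uc : mxconj g A \in unitmx by rewrite mxconj_unit.
by rewrite -[RHS]mulmx1; apply: (canRL (mulKmx uc)); rewrite -mxconjM // mulmxV // mxconj_id.
Qed.

Lemma mxconj_eq g A X : g \in unitmx -> (mxconj g A = X) <-> g *m A = X *m g.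
Proof.
move=> ug; rewrite /mxconj; split=> [<-|->]; first by rewrite mulmxKV.
by rewrite mulmxK.
Qed.

Lemma image_mxconj g S : g \in unitmx ->
  mxconj g @` S = [set A | S (mxconj (invmx g) A)].
Proof.
move=> ug; apply/seteqP; split=> [_ [A SA <-]|A SA] /=; first by rewrite mxconjK.
by exists (mxconj (invmx g) A) => //; rewrite mxconjVK.
Qed.

Lemma image_mxconj_comp g h S : g \in unitmx -> h \in unitmx ->
  mxconj g @` (mxconj h @` S) = mxconj (g *m h) @` S.
Proof.
move=> ug uh; rewrite image_comp; congr (_ @` _); apply/funext => A /=.
exact: mxconj_comp.
Qed.

Lemma image_mxconjK g S : g \in unitmx -> mxconj (invmx g) @` (mxconj g @` S) = S.
Proof.
move=> ug; rewrite image_mxconj_comp ?unitmx_inv // mulVmx //.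
by apply/seteqP; split=> [_ [A SA <-]|A SA]; rewrite ?mxconj1 //; exists A; rewrite ?mxconj1.
Qed.

Lemma SLn_unit A : SLn A -> A \in unitmx.
Proof. by rewrite /SLn /= unitmxE => ->; rewrite unitr1. Qed.

Lemma SLn1 : SLn (1%:M : 'M[F]_n).
Proof. exact: det1. Qed.

Lemma SLnM A B : SLn A -> SLn B -> SLn (A *m B).
Proof. by rewrite /SLn /= det_mulmx => -> ->; rewrite mulr1. Qed.

Lemma SLnV A : SLn A -> SLn (invmx A).
Proof. by rewrite /SLn /= det_inv => ->; rewrite invr1. Qed.

Lemma SLn_conj g A : g \in unitmx -> SLn A -> SLn (mxconj g A).
Proof. by move=> ug; rewrite /SLn /= det_mxconj. Qed.

End Conjugation.

(** * Closures, connectedness and identity components in the Zariski topology *)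

Section ZariskiTopology.
Context (F : numFieldType) (n : nat).
Implicit Types (A B X g h : 'M[F]_n) (S U : set 'M[F]_n) (f : {mpoly F[n * n]}).

Lemma poly_neq0_eval (p : {poly F}) : p != 0 -> exists t, p.[t] != 0.
Proof.
move=> p0; apply: contrapT => nP.
have : (size [seq i%:R : F | i <- iota 0 (size p)] < size p)%N.
  apply: max_poly_roots p0 _ _.
    by apply/allP => t _; apply/negPn/negP => pt; apply: nP; exists t.
  by rewrite map_inj_uniq ?iota_uniq // => i j /eqP; rewrite eqr_nat => /eqP.
by rewrite size_map size_iota ltnn.
Qed.

(** Irreducibility of the line: the product of two nonzero polynomials in one variable is
    nonzero. *)
Lemma polyfun_nz (f g : F -> F) (a b : F) : polyfun f -> polyfun g ->
  f a != 0 -> g b != 0 -> exists t, f t != 0 /\ g t != 0.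
Proof.
move=> [p pE] [q qE] fa gb.
have pq : p * q != 0.
  rewrite mulf_neq0 //; first by apply: contraNneq fa => p0; rewrite pE p0 horner0.
  by apply: contraNneq gb => p0; rewrite qE p0 horner0.
have [t] := poly_neq0_eval pq.
by rewrite hornerM mulf_eq0 negb_or -pE -qE => /andP[]; exists t.
Qed.

Lemma zclosedE S : closed (S : set (zariski F n)) = zariski_closed S.
Proof. by rewrite -openC /= -[LHS]/(zariski_closed (~` ~` S)) setCK. Qed.

Lemma zariski_closed_regular (I : Type) (D : set I) (phi : I -> 'M[F]_n -> F) :
  (forall i, D i -> regular (phi i)) ->
  closed ([set A | forall i, D i -> phi i A = 0] : set (zariski F n)).
Proof.
move=> rphi; rewrite zclosedE.
exists [set f | exists2 i, D i & forall A, phi i A = mxeval f A].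
apply/seteqP; split=> [A SA f [i Di <-]|A SA i Di]; first exact: SA.
by have [f fE] := rphi i Di; rewrite fE; apply: SA; exists i.
Qed.

Lemma zclosureP S X :
  closure (S : set (zariski F n)) X <->
  (forall f, (forall A, S A -> mxeval f A = 0) -> mxeval f X = 0).
Proof.
split=> [clX f fS|H].
  have /closure_id cf : closed ([set A | forall i : unit, True -> mxeval f A = 0] : set (zariski
    F n)).
    by apply: zariski_closed_regular => _ _; exact: regular_mxeval.
  have : closure ([set A | forall i : unit, True -> mxeval f A = 0] : set (zariski F n)) X.
    by apply: closureS clX => A SA _ _; apply: fS.
  by rewrite -cf /= => /(_ tt I).
have := @closed_closure (zariski F n) S; rewrite zclosedE => -[T TE].
rewrite TE => f Tf; apply: H => A SA.
have : closure (S : set (zariski F n)) A by apply: subset_closure.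
by rewrite TE => /(_ _ Tf).
Qed.

Definition mxline A X : set 'M[F]_n := [set A + t *: X | t in setT].

(** If a nonempty clopen part [B] missed a point [x], one polynomial would vanish on [B] but not at
    [x], and another off [B] but not at a point of [B]. Restricted to the line, the two have a
    common nonzero value, which belongs neither to [B] nor to its complement. *)
Lemma connected_mxline A X : connected (mxline A X : set (zariski F n)).
Proof.
move=> B [b Bb] [O oO BO] [C cC BC]; apply/seteqP; split=> [x|x lx].
  by rewrite BC => -[].
apply: contrapT => nBx.
have nCx : ~ C x by move=> Cx; apply: nBx; rewrite BC.
have [lb Ob] : mxline A X b /\ O b by move: Bb; rewrite BO.
have [S CE] : zariski_closed C by rewrite -zclosedE.
have [S' OE] : zariski_closed (~` O) by rewrite -zclosedE closedC.
have [f Sf fx] : exists2 f, S f & mxeval f x != 0.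
  apply: contrapT => nE; apply: nCx; rewrite CE => f Sf; apply/eqP/negPn/negP => fx.
  by apply: nE; exists f.
have [g Sg gb] : exists2 g, S' g & mxeval g b != 0.
  apply: contrapT => nE.
  suff : (~` O) b by apply.
  rewrite OE => f' Sf'; apply/eqP/negPn/negP => fx'.
  by apply: nE; exists f'.
case: lx lb => s _ sE [t _ tE]; subst x b.
have [r [fr gr]] := polyfun_nz (polyfun_line f A X) (polyfun_line g A X) fx gb.
have : B (A + r *: X).
  rewrite BO; split; first by exists r.
  apply: contrapT => /= nO; have : (~` O) (A + r *: X) by [].
  by rewrite OE => /(_ _ Sg) /eqP; rewrite (negbTE gr).
by rewrite BC CE => -[_ /(_ _ Sf) /eqP]; rewrite (negbTE fr).
Qed.

Lemma identity_component_line S N : (forall t, S (1%:M + t *: N)) ->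
  identity_component S (1%:M + N).
Proof.
move=> SN; exists (mxline 1%:M N); last by exists 1; rewrite ?scale1r.
split; [by exists 0; rewrite ?scale0r ?addr0| |exact: connected_mxline].
by move=> _ [t _ <-].
Qed.

Lemma identity_component_sub S A : identity_component S A -> S A.
Proof. by case=> B [_ BS _] /BS. Qed.

(* The closed sets [psi = 1] and [1 + psi + ... + psi^(k-1) = 0] are disjoint and
   cover S. *)
Lemma identity_component_torsion S k (psi : 'M[F]_n -> F) : (0 < k)%N ->
  regular psi -> psi 1%:M = 1 -> (forall A, S A -> psi A ^+ k = 1) ->
  forall A, identity_component S A -> psi A = 1.
Proof.
move=> k0 rpsi psi1 psik A [B [B1 BS cB] BA].
pose g (z : F) := \sum_(i < k) z ^+ i.
have gE z : z ^+ k = 1 -> (z - 1) * g z = 0 by move=> zk; rewrite -subrX1 zk subrr.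
have g1 : g 1 != 0.
  by rewrite /g (eq_bigr (fun=> 1)) ?sumr_const ?card_ord ?pnatr_eq0 -?lt0n // => i _;
    rewrite expr1n.
pose C := [set X | forall i : unit, True -> psi X - 1 = 0] : set (zariski F n).
pose D := [set X | forall i : unit, True -> g (psi X) = 0] : set (zariski F n).
have cC : closed C.
  apply: zariski_closed_regular => _ _; apply: (fa_add (regular_alg F n)) => //.
  exact: (fa_const (regular_alg F n)).
have cD : closed D.
  apply: zariski_closed_regular => _ _; apply: (fa_sum (regular_alg F n)) => i _.
  exact: (fa_exp (regular_alg F n)).
have /cB BC : (B `&` C) !=set0 by exists 1%:M; split=> // _ _; rewrite psi1 subrr.
suff : (B `&` C) A by move=> [_ /(_ tt I) /eqP]; rewrite subr_eq0 => /eqP.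
rewrite BC //; last by exists C.
exists (~` D); first by rewrite openC.
apply/seteqP; split=> X [BX].
  move=> CX; split=> // DX; move: (CX tt I) (DX tt I) => /eqP; rewrite subr_eq0 => /eqP ->.
  by move/eqP; rewrite (negbTE g1).
move=> nD; split=> // _ _; have /eqP := gE _ (psik X (BS X BX)).
rewrite mulf_eq0 => /orP[/eqP//|/eqP gX]; exfalso; apply: nD => _ _; exact: gX.
Qed.

Lemma regular_comp (phi : 'M[F]_n -> F) (M : 'M[F]_n -> 'M[F]_n) :
  regular phi -> fa_mx (@regular F n) M -> regular (phi \o M).
Proof.
move=> [f fE] rM; apply: fa_ext (fa_mxeval (regular_alg F n) f rM) => A.
by rewrite /= fE.
Qed.

Lemma regular_id : fa_mx (@regular F n) id.
Proof. by move=> i j; apply: regular_coord. Qed.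

Lemma regular_mxconj g : fa_mx (@regular F n) (mxconj g).
Proof.
apply: (fa_mulmx (regular_alg F n)); last exact: (fa_cst (regular_alg F n)).
apply: (fa_mulmx (regular_alg F n)); last exact: regular_id.
exact: (fa_cst (regular_alg F n)).
Qed.

Lemma regular_det : regular (fun A : 'M[F]_n => \det A).
Proof. exact: (fa_det (regular_alg F n) regular_id). Qed.

Lemma continuous_mxconj g :
  continuous (mxconj g : zariski F n -> zariski F n).
Proof.
apply/continuous_closedP => C; rewrite !zclosedE => -[S CE].
rewrite -zclosedE.
suff -> : mxconj g @^-1` C = [set A | forall f, S f -> mxeval f (mxconj g A) = 0].
  apply: zariski_closed_regular => f _.
  exact: (regular_comp (regular_mxeval f) (@regular_mxconj g)).
by apply/seteqP; split=> A /=; rewrite CE.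
Qed.

Lemma connected_mxconj g S : connected (S : set (zariski F n)) ->
  connected (mxconj g @` S : set (zariski F n)).
Proof.
move=> cS; apply: (@connected_continuous_connected (zariski F n) (zariski F n) S (mxconj g)) cS _.
by apply: continuous_subspaceT; exact: continuous_mxconj.
Qed.

Lemma closed_mxconj g S : g \in unitmx -> closed (S : set (zariski F n)) ->
  closed (mxconj g @` S : set (zariski F n)).
Proof.
move=> ug cS; rewrite image_mxconj //.
by have /continuous_closedP := @continuous_mxconj (invmx g); apply.
Qed.

Lemma identity_component_conj g S A : g \in unitmx ->
  identity_component (mxconj g @` S) A -> identity_component S (mxconj (invmx g) A).
Proof.
move=> ug [B [B1 BS cB] BA]; exists (mxconj (invmx g) @` B); last by exists A.
split; last exact: connected_mxconj.
  by exists 1%:M => //; rewrite mxconj_id ?unitmx_inv.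
rewrite -[X in _ `<=` X](image_mxconjK S ug); exact: image_subset.
Qed.

End ZariskiTopology.

(** * Equivariance under conjugation *)

Section Equivariance.
Context (F : numClosedFieldType) (n : nat).
Implicit Types (A B X g h : 'M[F]_n) (S P L U V : set 'M[F]_n).

(** Scalars act trivially by conjugation, so [g] can be rescaled by an n-th root of its inverse
    determinant. Permutation matrices of determinant -1 thereby act as elements of [SLn]. *)
Lemma unit_SLn_conj g : g \in unitmx -> exists2 h, SLn h & mxconj h = mxconj g.
Proof.
move=> ug; case: n g ug => [|m] g ug.
  by exists g => //; rewrite /SLn /= det_mx00.
have dg : \det g != 0 by rewrite -unitfE -unitmxE.
pose c := m.+1.-root (\det g)^-1.
have cn : c ^+ m.+1 = (\det g)^-1 by rewrite rootCK.
have c0 : c != 0.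
  by apply/eqP => c0; move: cn; rewrite c0 expr0n /= => /esym/eqP; rewrite invr_eq0 (negbTE dg).
exists (c *: g); first by rewrite /SLn /= detZ cn mulVf.
apply/funext => A; apply/mxconj_eq; first by rewrite unitmxZ ?unitfE.
rewrite -scalemxAl -scalemxAr; congr (_ *: _).
by apply/mxconj_eq.
Qed.

Lemma poly_ext (p q : {poly F}) : (forall t, p.[t] = q.[t]) -> p = q.
Proof.
move=> pq; apply/eqP; rewrite -subr_eq0; apply/negPn/negP => /poly_neq0_eval[t].
by rewrite hornerD hornerN pq subrr eqxx.
Qed.

Lemma lie_algebraP S X :
  lie_algebra S X <-> (forall f (G : {poly F}), (forall A, S A -> mxeval f A = 0) ->
    (forall t, mxeval f (1%:M + t *: X) = G.[t]) -> (G^`()).[0] = 0).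
Proof.
split=> [LX f G fS GE|H f fS].
  have [G' [G'E dE]] := mxeval_derivE f 1%:M X.
  have -> : G = G' by apply: poly_ext => t; rewrite -GE -G'E.
  by rewrite -dE; apply: LX.
have [G' [G'E ->]] := mxeval_derivE f 1%:M X.
exact: H fS G'E.
Qed.

Lemma lie_algebra_mxconj g S X : g \in unitmx ->
  lie_algebra S X -> lie_algebra (mxconj g @` S) (mxconj g X).
Proof.
move=> ug /lie_algebraP LX; apply/lie_algebraP => f G fS GE.
have [f' f'E] := regular_comp (regular_mxeval f) (@regular_mxconj F n g).
apply: (LX f') => [A SA|t].
  by rewrite -f'E /=; apply: fS; exists A.
by rewrite -f'E -GE /= mxconjD mxconjZ mxconj_id.
Qed.

Lemma lie_algebra_conjE g S : g \in unitmx ->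
  lie_algebra (mxconj g @` S) = mxconj g @` lie_algebra S.
Proof.
move=> ug; apply/seteqP; split=> [X LX|_ [X LX <-]]; last exact: lie_algebra_mxconj.
rewrite image_mxconj //= -(image_mxconjK S ug).
by apply: lie_algebra_mxconj; rewrite ?unitmx_inv.
Qed.

Lemma nilpotent_orbit_conj p g X : g \in unitmx ->
  nilpotent_orbit p X -> nilpotent_orbit p (mxconj g X).
Proof.
move=> ug [h uh ->]; exists (g *m h); first by rewrite unitmx_mul ug.
by rewrite mxconj_comp.
Qed.

Lemma closed_subgroup_conj g S : g \in unitmx ->
  closed_subgroup S -> closed_subgroup (mxconj g @` S).
Proof.
move=> ug [SS cS S1 SM SV]; split.
- by move=> _ [A /SS SA <-]; apply: SLn_conj.
- exact: closed_mxconj.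
- by exists 1%:M; rewrite ?mxconj_id.
- by move=> _ _ [A SA <-] [B SB <-]; exists (A *m B); [exact: SM|rewrite mxconjM].
- move=> _ [A SA <-]; exists (invmx A); first exact: SV.
  by rewrite mxconjV // SLn_unit //; apply: SS.
Qed.

Lemma parabolic_conj g P : SLn g -> parabolic P -> parabolic (mxconj g @` P).
Proof.
move=> sg [cP [h sh hB]]; split; first by apply: closed_subgroup_conj => //; exact: SLn_unit.
exists (g *m h); first exact: SLnM.
by rewrite -image_mxconj_comp ?SLn_unit //; apply: image_subset.
Qed.

Lemma unipotent_conj g A : g \in unitmx -> unipotent A -> unipotent (mxconj g A).
Proof.
move=> ug [m Am]; exists m; rewrite -(mxconj_id ug) -mxconjB -mxconj_exp // Am.
by rewrite /mxconj mulmx0 mul0mx.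
Qed.

Lemma mxconj_mxconj g a v : g \in unitmx -> a \in unitmx ->
  mxconj (mxconj g a) (mxconj g v) = mxconj g (mxconj a v).
Proof.
move=> ug ua; rewrite /mxconj -/(mxconj g a) -mxconjV // /mxconj.
by rewrite !mulmxA !mulmxKV.
Qed.

Lemma connected_normal_unipotent_conj g P V : g \in unitmx -> P `<=` @SLn F n ->
  connected_normal_unipotent P V ->
  connected_normal_unipotent (mxconj g @` P) (mxconj g @` V).
Proof.
move=> ug PS [gV cV VP nV uV]; split.
- exact: closed_subgroup_conj.
- exact: connected_mxconj.
- exact: image_subset.
- move=> _ [a Pa <-] _ [_ [v Vv <-] <-].
  exists (mxconj a v); first by apply: nV Pa _ _; exists v.
  by rewrite mxconj_mxconj // SLn_unit //; apply: PS.
- by move=> _ [v /uV Vv <-]; apply: unipotent_conj.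
Qed.

Lemma unipotent_radical_conj g P U : g \in unitmx -> P `<=` @SLn F n ->
  unipotent_radical P U -> unipotent_radical (mxconj g @` P) (mxconj g @` U).
Proof.
move=> ug PS [nU maxU]; split; first exact: connected_normal_unipotent_conj.
have ug' : invmx g \in unitmx by rewrite unitmx_inv.
move=> V nV v Vv; rewrite image_mxconj //=; apply: (maxU (mxconj (invmx g) @` V));
  last by exists v.
rewrite -(image_mxconjK P ug); apply: connected_normal_unipotent_conj => //.
by move=> _ [A /PS SA <-]; apply: SLn_conj.
Qed.

Lemma levi_decomposition_conj g P L U : g \in unitmx -> P `<=` @SLn F n ->
  levi_decomposition P L U ->
  levi_decomposition (mxconj g @` P) (mxconj g @` L) (mxconj g @` U).
Proof.
move=> ug PS [rU gL LU PE]; split.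
- exact: unipotent_radical_conj.
- exact: closed_subgroup_conj.
- rewrite !image_mxconj //; apply/seteqP; split=> [A [LA UA]|A ->] /=.
    have : (L `&` U) (mxconj (invmx g) A) by split.
    by rewrite LU /= => gA; rewrite -(mxconjVK ug A) gA mxconj_id.
  have : (L `&` U) 1%:M by rewrite LU.
  by rewrite /setI /= mxconj_id ?unitmx_inv.
- rewrite PE; apply/seteqP; split=> [_ [_ [l Ll [u Uu <-]] <-]|].
    exists (mxconj g l); first by exists l.
    by exists (mxconj g u); [exists u|rewrite mxconjM].
  move=> _ [_ [l Ll <-] [_ [u Uu <-] <-]]; exists (l *m u); last by rewrite mxconjM.
  by exists l => //; exists u.
Qed.

Lemma richardson_conj p g P L U : SLn g ->
  richardson p P L U -> richardson p (mxconj g @` P) (mxconj g @` L) (mxconj g @` U).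
Proof.
move=> sg [pP dP dense]; have ug := SLn_unit sg; split.
- exact: parabolic_conj.
- by apply: levi_decomposition_conj => //; case: pP => -[].
rewrite lie_algebra_conjE // => _ [X /dense /zclosureP clX <-].
apply/zclosureP => f fE.
have [f' f'E] := regular_comp (regular_mxeval f) (@regular_mxconj F n g).
rewrite -[mxeval f _]/((mxeval f \o mxconj g) X) f'E; apply: clX => A [OA LA].
rewrite -f'E /=; apply: fE; split; first exact: nilpotent_orbit_conj.
by exists A.
Qed.

End Equivariance.

(** * Block triangular subgroups *)

Section BlockTriangular.
Context (F : numClosedFieldType) (n : nat) (be : 'I_n -> nat).
Implicit Types (A B X g h : 'M[F]_n) (S P L U V : set 'M[F]_n).

Definition lowR : rel 'I_n := fun i j => (be j <= be i)%N.
Definition eqR : rel 'I_n := fun i j => be i == be j.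

Lemma lowR_refl : reflexive lowR. Proof. by move=> i; apply: leqnn. Qed.
Lemma lowR_trans : transitive lowR. Proof. by move=> j i k ij jk; apply: leq_trans jk ij. Qed.
Lemma eqR_refl : reflexive eqR. Proof. by move=> i; apply: eqxx. Qed.
Lemma eqR_trans : transitive eqR. Proof. by move=> j i k /eqP ij /eqP jk; rewrite /eqR ij jk. Qed.
Hint Resolve lowR_refl lowR_trans eqR_refl eqR_trans : core.

Definition blockP : set 'M[F]_n := [set A | SLn A /\ supported lowR A].
Definition blockL : set 'M[F]_n := [set A | SLn A /\ supported eqR A].
Definition blockU : set 'M[F]_n :=
  [set A | forall i j, (be i <= be j)%N -> A i j = (i == j)%:R].
Definition ulie : set 'M[F]_n :=
  [set X | forall i j, (be i <= be j)%N -> X i j = 0].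

(** The projection of the block triangular group onto its Levi factor: a homomorphism on [blockP]
    with kernel [blockU]. *)
Definition bd A : 'M[F]_n := \matrix_(i, j) (if be i == be j then A i j else 0).

Lemma eqR_low A : supported eqR A -> supported lowR A.
Proof.
move=> sA i j; rewrite /lowR -ltnNge => ij; apply: sA.
by rewrite /eqR (ltn_eqF ij).
Qed.

Lemma bd_supp A : supported eqR (bd A).
Proof. by move=> i j; rewrite /eqR mxE => /negbTE ->. Qed.

Lemma bd_low A : supported lowR (bd A).
Proof. exact/eqR_low/bd_supp. Qed.

Lemma bd_id A : supported eqR A -> bd A = A.
Proof.
by move=> sA; apply/matrixP => i j; rewrite mxE; case: ifP => // /negbT/sA.
Qed.

Lemma bd1 : bd 1%:M = 1%:M.
Proof. by apply: bd_id; apply: supported_scalar. Qed.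

Lemma bdM A B : supported lowR A -> supported lowR B -> bd (A *m B) = bd A *m bd B.
Proof.
move=> sA sB; apply/matrixP => i j; rewrite !mxE.
case: eqP => ij; last first.
  rewrite big1 // => k _; rewrite !mxE; case: eqP => [ik|]; last by rewrite mul0r.
  by rewrite -ik; case: eqP => // _; rewrite mulr0.
apply: eq_bigr => k _; rewrite !mxE; case: eqP => [ik|ik].
  by rewrite -ij ik eqxx.
rewrite mul0r; have [ki|ki] := leqP (be k) (be i); last by rewrite sA ?mul0r // /lowR -ltnNge.
rewrite sB ?mulr0 // /lowR -ltnNge -ij ltn_neqAle ki andbT eq_sym.
exact/eqP.
Qed.

Lemma det_bd A : supported lowR A -> \det (bd A) = \det A.
Proof.
move=> sA; apply: eq_bigr => s _; congr (_ * _).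
have [H|] := boolP [forall i, be (s i) == be i].
  by apply: eq_bigr => i _; rewrite mxE eq_sym (eqP (forallP H i)) eqxx.
rewrite negb_forall => /existsP[i si].
rewrite [LHS](bigD1 i) //= mxE eq_sym (negbTE si) mul0r.
(* A permutation preserves the sum of the labels, so one that changes a label must raise some label;
   the corresponding factor lies in the zero part of [A]. *)
suff [j sj] : exists j, (be j < be (s j))%N.
  by rewrite (bigD1 j) //= sA ?mul0r // /lowR -ltnNge.
apply: contrapT => nE.
have le j : (be (s j) <= be j)%N by rewrite leqNgt; apply/negP => sj; apply: nE; exists j.
have : (\sum_j be (s j) < \sum_j be j)%N.
  rewrite (bigD1 i) //= [ltnRHS](bigD1 i) //= -addSn leq_add //.
    by rewrite ltn_neqAle si le.
  by apply: leq_sum => j _; apply: le.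
by rewrite [ltnRHS](reindex_inj (@perm_inj _ s)) /= ltnn.
Qed.

Lemma blockU_bd A : blockU A <-> supported lowR A /\ bd A = 1%:M.
Proof.
split=> [UA|[sA bA] i j].
  split=> [i j|]; first by rewrite /lowR -ltnNge => ij; rewrite UA 1?ltnW //;
    case: eqP ij => // ->; rewrite ltnn.
  apply/matrixP => i j; rewrite !mxE; case: eqP => [ij|].
    by rewrite UA // ij.
  by case: eqP => // ->.
rewrite leq_eqVlt => /orP[ij|ij].
  by move/matrixP: bA => /(_ i j); rewrite !mxE ij.
rewrite sA; last by rewrite /lowR -ltnNge.
by case: eqP ij => // ->; rewrite ltnn.
Qed.

Lemma blockU_SLn : blockU `<=` @SLn F n.
Proof. by move=> A /blockU_bd[sA bA]; rewrite /SLn /= -det_bd // bA det1. Qed.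

Lemma blockU_P : blockU `<=` blockP.
Proof. by move=> A UA; split; [exact: blockU_SLn|case/blockU_bd: UA]. Qed.

Lemma blockL_P : blockL `<=` blockP.
Proof. by move=> A [sA LA]; split=> //; exact: eqR_low. Qed.

Lemma bd_unit A : A \in unitmx -> supported lowR A -> bd A \in unitmx.
Proof. by move=> uA sA; rewrite unitmxE det_bd. Qed.

Lemma bdV A : A \in unitmx -> supported lowR A -> bd (invmx A) = invmx (bd A).
Proof.
move=> uA sA; have ub := bd_unit uA sA.
rewrite -[RHS]mulmx1; apply: (canRL (mulKmx ub)).
by rewrite -bdM ?mulmxV ?bd1 //; apply: supportedV.
Qed.

Lemma blockU_conj A v : A \in unitmx -> supported lowR A -> blockU v -> blockU (mxconj A v).
Proof.
move=> uA sA /blockU_bd[sv bv]; apply/blockU_bd.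
have sV : supported lowR (invmx A) by apply: supportedV.
split; first by do 2 apply: supportedM => //.
rewrite !bdM // ?bv ?mulmx1 ?bdV //; last exact: supportedM.
by rewrite mulmxV // bd_unit.
Qed.

Lemma ulie_low X : ulie X -> supported lowR X.
Proof. by move=> uX i j; rewrite /lowR -ltnNge => /ltnW/uX. Qed.

Lemma ulie_mull A X : supported lowR A -> ulie X -> ulie (A *m X).
Proof.
move=> sA uX i j ij; rewrite mxE big1 // => k _.
have [ki|ki] := leqP (be k) (be i); last by rewrite sA ?mul0r // /lowR -ltnNge.
by rewrite uX ?mulr0 // (leq_trans ki).
Qed.

Lemma ulie_mulr A X : supported lowR A -> ulie X -> ulie (X *m A).
Proof.
move=> sA uX i j ij; rewrite mxE big1 // => k _.
have [ki|ki] := leqP (be j) (be k); last by rewrite sA ?mulr0 // /lowR -ltnNge.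
by rewrite uX ?mul0r // (leq_trans ij).
Qed.

Lemma ulie_exp X k i j : ulie X -> (be i < be j + k)%N -> (X ^+ k) i j = 0.
Proof.
move=> uX; elim: k i => [|k IH] i ij.
  by rewrite expr0 mxE; case: eqP ij => // ->; rewrite addn0 ltnn.
rewrite exprS mxE big1 // => l _.
have [li|li] := leqP (be i) (be l); first by rewrite uX ?mul0r.
by rewrite IH ?mulr0 //; lia.
Qed.

Lemma ulie_nilpotent X : ulie X -> X ^+ (\sum_i be i).+1 = 0.
Proof.
move=> uX; apply/matrixP => i j; rewrite [RHS]mxE ulie_exp //.
by rewrite (bigD1 i) //=; lia.
Qed.

Lemma blockU_ulie v : blockU v <-> ulie (v - 1%:M).
Proof.
split=> H i j ij; first by rewrite !mxE H // subrr.
by move/(_ i j ij)/eqP: H; rewrite !mxE subr_eq0 => /eqP.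
Qed.

Lemma blockU_line X : ulie X -> forall t, blockU (1%:M + t *: X).
Proof.
move=> uX t; apply/blockU_ulie => i j ij.
by rewrite !mxE uX // mulr0 addr0 subrr.
Qed.

Lemma closed_SLn_cond (I : Type) (D : set I) (phi : I -> 'M[F]_n -> F) :
  (forall i, D i -> regular (phi i)) ->
  closed ([set A | SLn A /\ forall i, D i -> phi i A = 0] : set (zariski F n)).
Proof.
move=> rphi.
pose phi' (o : option I) A := if o is Some i then phi i A else \det A - 1.
pose D' (o : option I) := if o is Some i then D i else True.
suff -> : [set A | SLn A /\ forall i, D i -> phi i A = 0] =
          [set A | forall o, D' o -> phi' o A = 0].
  apply: zariski_closed_regular => -[i|] //= Di; first exact: rphi.
  apply: (fa_add (regular_alg F n)); first exact: regular_det.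
  exact: (fa_const (regular_alg F n)).
apply/seteqP; split=> [A [dA HA] [i|] //= Di|A HA]; first exact: HA.
  by rewrite dA subrr.
split; last by move=> i Di; apply: (HA (Some i)).
by rewrite /SLn /=; apply/eqP; rewrite -subr_eq0; apply/eqP/(HA None).
Qed.

Lemma closed_supported (R : rel 'I_n) :
  closed ([set A : 'M[F]_n | SLn A /\ supported R A] : set (zariski F n)).
Proof.
suff -> : [set A : 'M[F]_n | SLn A /\ supported R A] =
  [set A | SLn A /\ forall ij : 'I_n * 'I_n, ~~ R ij.1 ij.2 -> A ij.1 ij.2 = 0].
  by apply: closed_SLn_cond => ij _; exact: regular_coord.
apply/seteqP; split=> A [dA H]; split=> //; first by case=> i j; apply: H.
by move=> i j nR; apply: (H (i, j)).
Qed.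

Lemma closed_subgroup_supported (R : rel 'I_n) : reflexive R -> transitive R ->
  closed_subgroup [set A : 'M[F]_n | SLn A /\ supported R A].
Proof.
move=> rR tR; split; [by move=> A []|exact: closed_supported| | |].
- by split; [exact: SLn1|exact: supported_scalar].
- by move=> A B [? ?] [? ?]; split; [exact: SLnM|exact: supportedM].
- move=> A [sA ?]; split; [exact: SLnV|apply: supportedV => //].
  exact: SLn_unit.
Qed.

Lemma closed_subgroup_P : closed_subgroup blockP.
Proof. exact: closed_subgroup_supported. Qed.

Lemma closed_subgroup_L : closed_subgroup blockL.
Proof. exact: closed_subgroup_supported. Qed.

Lemma closed_subgroup_U : closed_subgroup blockU.
Proof.
split; first exact: blockU_SLn.
- suff -> : blockU = [set A | forall ij : 'I_n * 'I_n, (be ij.1 <= be ij.2)%N ->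
      A ij.1 ij.2 + - (ij.1 == ij.2)%:R = 0].
    apply: zariski_closed_regular => ij _.
    apply: (fa_add (regular_alg F n)); first exact: regular_coord.
    exact: (fa_const (regular_alg F n)).
  apply/seteqP; split=> A H; first by move=> [i j] /= ij; rewrite H // subrr.
  move=> i j ij.
  by apply/eqP; rewrite -subr_eq0; apply/eqP/(H (i, j)).
- by move=> i j _; rewrite mxE.
- move=> A B /blockU_bd[sA bA] /blockU_bd[sB bB]; apply/blockU_bd.
  by split; [exact: supportedM|rewrite bdM // bA bB mulmx1].
- move=> A UA; have uA := SLn_unit (blockU_SLn UA).
  have /blockU_bd[sA bA] := UA; apply/blockU_bd.
  by split; [exact: supportedV|rewrite bdV // bA invmx1].
Qed.

Lemma connected_U : connected (blockU : set (zariski F n)).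
Proof.
have -> : blockU = \bigcup_(X in ulie) mxline 1%:M X.
  apply/seteqP; split=> [v Uv|_ [X uX [t _ <-]]]; last exact: blockU_line.
  exists (v - 1%:M); first exact/blockU_ulie.
  by exists 1 => //; rewrite scale1r addrC subrK.
apply: (@bigcup_connected (zariski F n)) => [|X _]; last exact: connected_mxline.
by exists 1%:M => X _; exists 0 => //; rewrite scale0r addr0.
Qed.

(** The differentials of the equations of [blockU] give one inclusion. For the other, [blockU]
    contains the whole line through the identity in the direction [X], and a polynomial vanishing on
    [blockU] is zero along it. *)
Lemma lie_algebra_U : lie_algebra blockU = ulie.
Proof.
apply/seteqP; split=> X.
  move=> /lie_algebraP LX i j ij.
  have [f fE] : regular (fun A : 'M[F]_n => A i j + - (i == j)%:R).
    apply: (fa_add (regular_alg F n)); first exact: regular_coord.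
    exact: (fa_const (regular_alg F n)).
  have := LX f ((X i j)%:P * 'X); rewrite derivM derivC mul0r add0r derivX mulr1 hornerC.
  apply=> [A UA|t]; first by rewrite -fE UA // subrr.
  by rewrite -fE !mxE !hornerE; ring.
move=> uX; apply/lie_algebraP => f G fU GE.
suff -> : G = 0 by rewrite deriv0 horner0.
by apply: poly_ext => t; rewrite -GE fU ?horner0 //; exact: blockU_line.
Qed.

End BlockTriangular.

(** * Unipotent radical and Levi decomposition of a block triangular group *)

Section UnipotentRadical.
Context (F : numClosedFieldType) (n : nat).
Implicit Types (A B X g h : 'M[F]_n) (S P L U V : set 'M[F]_n).

Lemma nilpotent_trace A m : A ^+ m = 0 -> \tr A = 0.
Proof.
case: n A => [|k] A Am; first by rewrite /mxtrace big_ord0.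
have [rs rsE] := closed_field_poly_normal (char_poly A).
rewrite (monicP (char_poly_monic A)) scale1r in rsE.
have rs0 : all (pred1 0) rs.
  apply/allP => z zrs /=.
  have : root (char_poly A) z by rewrite rsE root_prod_XsubC.
  rewrite -eigenvalue_root_char => /eigenvalueP[v vA v0].
  have vAk l : v *m A ^+ l = z ^+ l *: v.
    elim: l => [|l IH]; first by rewrite !expr0 mulmx1 scale1r.
    by rewrite exprSr mulmxA IH -scalemxAl vA scalerA exprSr.
  have /esym/eqP := vAk m; rewrite Am mulmx0 scaler_eq0 (negbTE v0) orbF expf_eq0.
  by case/andP.
have -> : \tr A = - (char_poly A)`_k.
  by have := char_poly_trace A (ltn0Sn k); rewrite /= => ->; rewrite opprK.
have srs : size rs = k.+1.
  by apply: succn_inj; rewrite -(size_prod_XsubC rs id) -rsE size_char_poly.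
rewrite rsE (all_pred1P _ _ rs0) srs big_nseq subr0 iter_mulr_1 coefXn.
by rewrite (ltn_eqF (ltnSn k)) oppr0.
Qed.

Lemma unipotent_trace A : unipotent A -> \tr A = n%:R.
Proof.
move=> [m Am]; apply/eqP; rewrite -subr_eq0 -(mxtrace_scalar n (1 : F)) -raddfB /=.
by rewrite (nilpotent_trace Am).
Qed.

(* For [g = 1 + E_ab] and [v] unipotent, [tr (v * g v g^-1) = n - v_ba^2]. *)
Lemma normal_unipotent_entry V (a b : 'I_n) v : a != b -> V `<=` @unipotent F n ->
  (forall A B, V A -> V B -> V (A *m B)) ->
  (forall w, V w -> V (mxconj (elem_mx a b 1) w)) -> V v -> v b a = 0.
Proof.
move=> ab uV VM VN Vv; pose E : 'M[F]_n := delta_mx a b.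
have := unipotent_trace (uV _ (VM _ _ Vv (VN _ Vv))).
have -> : mxconj (elem_mx a b 1) v = (1%:M + E) *m v *m (1%:M - E).
  rewrite /mxconj; congr (_ *m _); first by rewrite /elem_mx scale1r.
  have ue : elem_mx a b (1 : F) \in unitmx by apply: SLn_unit; exact: det_elem_mx.
  rewrite -[LHS]mulmx1; apply: (canLR (mulKmx ue)).
  have -> : 1%:M - E = elem_mx a b (-1) by rewrite /elem_mx scaleN1r.
  by rewrite elem_mxM // subrr elem_mx0.
rewrite [_ *m v]mulmxDl mul1mx mulmxBr mulmx1 mulmxDl mulmxBr !mulmxDr.
rewrite raddfB !raddfD /= (unipotent_trace (uV _ (VM _ _ Vv Vv))).
have -> : \tr (v *m (v *m E)) = \tr (v *m (E *m v)).
  by rewrite mulmxA mxtrace_mulC mulmxA mulmxA mxtrace_mulC mulmxA mxtrace_mulC mulmxA.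
have -> : \tr (v *m (E *m v *m E)) = v b a ^+ 2.
  have -> : E = delta_mx a (0 : 'I_1) *m delta_mx (0 : 'I_1) b by rewrite mul_delta_mx.
  rewrite !mulmxA mxtrace_mulC !mulmxA.
  have xE : delta_mx (0 : 'I_1) b *m v *m delta_mx a (0 : 'I_1) = (v b a)%:M.
    by rewrite -rowE -colE; apply/rowP => i; rewrite !mxE !ord1 eqxx mulr1n.
  by rewrite xE -!mulmxA [delta_mx 0 b *m _]mulmxA xE -scalar_mxM mxtrace_scalar expr2.
move=> /eqP; rewrite -subr_eq0 => H; apply/eqP; rewrite -sqrf_eq0 -oppr_eq0.
by apply: etrans H; congr (_ == _); ring.
Qed.

(** For maximality, normality under the root subgroups inside a block kills the off-diagonal entries
    of the diagonal blocks. The block diagonal part of [v] is then a diagonal matrix, and unipotence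
    of [v] makes it the identity. *)
Lemma unipotent_radical_P (be : 'I_n -> nat) :
  unipotent_radical (blockP be : set 'M[F]_n) (blockU be).
Proof.
split.
  split; [exact: closed_subgroup_U|exact: connected_U|exact: blockU_P| |].
    move=> A [sA lA] _ [v Uv <-]; apply: blockU_conj => //; exact: SLn_unit.
  by move=> v /blockU_ulie uv; exists (\sum_i be i).+1; exact: (ulie_nilpotent uv).
move=> V [[_ _ V1 VM _] _ VP VN uV] v Vv.
have [sv lv] := VP v Vv; apply/blockU_bd; split=> //.
have dv a b : a != b -> be a = be b -> v b a = 0.
  move=> ab eab; apply: (normal_unipotent_entry ab uV VM _ Vv) => w Vw.
  apply: (VN (elem_mx a b 1)); last by exists w.
  split; first exact: det_elem_mx.
  by apply: elem_mx_supp; [exact: lowR_refl|rewrite /lowR eab].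
have bdv : bd be v = diag_mx (\row_i v i i).
  apply/matrixP => i j; rewrite !mxE; have [->|ij] := eqVneq i j; first by rewrite eqxx mulr1n.
  by rewrite mulr0n; case: eqP => // eij; rewrite dv // eq_sym.
have [m vm] := uV v Vv.
have sN : supported (lowR be) (v - 1%:M).
  move=> i j nR; rewrite !mxE lv //; case: eqP nR => [->|_ _]; first by rewrite lowR_refl.
  by rewrite subr0.
have bN k : bd be ((v - 1%:M) ^+ k) = diag_mx (\row_i (v i i - 1) ^+ k)
            /\ supported (lowR be) ((v - 1%:M) ^+ k).
  elim: k => [|k [IHb IHs]].
    rewrite expr0; split; last by apply: supported_scalar; exact: lowR_refl.
    by rewrite [bd _ _]bd1; apply/matrixP => i j; rewrite !mxE expr0.
  rewrite exprS; split; last by apply: supportedM => //; exact: lowR_trans.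
  rewrite [bd _ _](bdM sN IHs) IHb.
  have -> : bd be (v - 1%:M) = diag_mx (\row_i (v i i - 1)).
    apply/matrixP => i j; move/matrixP: bdv => /(_ i j); rewrite !mxE.
    have [->|ij] := eqVneq i j; first by rewrite eqxx !mulr1n.
    by rewrite !mulr0n subr0; case: eqP.
  rewrite mulmx_diag; congr diag_mx; apply/rowP => i; rewrite !mxE.
  by rewrite exprS.
rewrite bdv -[RHS]diag_const_mx; congr diag_mx; apply/rowP => i; rewrite !mxE.
have [/matrixP/(_ i i)] := bN m; rewrite vm !mxE !eqxx !mulr1n => /esym/eqP.
by rewrite expf_eq0 subr_eq0 => /andP[_ /eqP].
Qed.

Lemma blockLU (be : 'I_n -> nat) A : blockP be A ->
  blockL be (bd be A) /\ blockU be (invmx (bd be A) *m A).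
Proof.
move=> [sA lA]; have uA := SLn_unit sA; have ub := bd_unit uA lA.
split; first by split; [rewrite /SLn /= det_bd|exact: bd_supp].
have sV : supported (lowR be) (invmx (bd be A)).
  by apply: supportedV => //; [exact: lowR_refl|exact: lowR_trans|exact: bd_low].
apply/blockU_bd; split; first by apply: supportedM => //; exact: lowR_trans.
rewrite bdM // bdV //; last exact: bd_low.
by rewrite (bd_id (@bd_supp _ _ _ _)) mulVmx.
Qed.

Lemma blockLU1 (be : 'I_n -> nat) : blockL be `&` blockU be = [set 1%:M : 'M[F]_n].
Proof.
apply/seteqP; split=> [A [[_ lA] /blockU_bd[_]]|A ->]; first by rewrite bd_id.
split; first by case: (closed_subgroup_L F be).
by case: (closed_subgroup_U F be).
Qed.

Lemma levi_decomposition_P (be : 'I_n -> nat) :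
  levi_decomposition (blockP be : set 'M[F]_n) (blockL be) (blockU be).
Proof.
split; [exact: unipotent_radical_P|exact: closed_subgroup_L|exact: blockLU1|].
apply/seteqP; split=> [A PA|_ [l Ll [u Uu <-]]].
  have [LA UA] := blockLU PA; exists (bd be A) => //.
  eexists; first exact: UA.
  by rewrite mulKVmx // SLn_unit //; case: LA.
have [_ _ _ PM _] := closed_subgroup_P F be.
by apply: PM; [exact: blockL_P|exact: blockU_P].
Qed.

End UnipotentRadical.

(** * Parabolic subgroups containing the Borel subgroup *)

Section Parabolic.
Context (F : numClosedFieldType) (n : nat).
Implicit Types (A B X g h : 'M[F]_n) (S P L U V : set 'M[F]_n).

(** The commutator relation between root subgroups. It makes the relation formed by the root
    subgroups contained in a group transitive. *)
Lemma elem_mx_commutator (c d e : 'I_n) (x : F) : c != d -> d != e -> c != e ->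
  elem_mx c d x *m elem_mx d e 1 *m elem_mx c d (- x) *m elem_mx d e (- 1) =
  elem_mx c e x.
Proof.
move=> cd de ce; rewrite /elem_mx scale1r !scaleNr scale1r.
set E := delta_mx c d; set G := delta_mx d e; set H := delta_mx c e.
have EG : E *m G = H by rewrite mul_delta_mx.
have EE : E *m E = 0 by rewrite mul_delta_mx_0 // eq_sym.
have GG : G *m G = 0 by rewrite mul_delta_mx_0 // eq_sym.
have GE : G *m E = 0 by rewrite mul_delta_mx_0 // eq_sym.
have HE : H *m E = 0 by rewrite mul_delta_mx_0 // eq_sym.
have HG : H *m G = 0 by rewrite mul_delta_mx_0 // eq_sym.
have -> : (1%:M + x *: E) *m (1%:M + G) = 1%:M + x *: E + G + x *: H.
  by rewrite mulmxDr mulmx1 mulmxDl mul1mx -scalemxAl EG addrA.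
have -> : (1%:M + x *: E + G + x *: H) *m (1%:M - x *: E) = 1%:M + G + x *: H.
  rewrite mulmxBr mulmx1 -scalemxAr !mulmxDl mul1mx -!scalemxAl EE GE HE !scaler0 !addr0.
  by clearbody E G H; apply/matrixP => i j; rewrite !mxE; ring.
rewrite mulmxBr mulmx1 !mulmxDl mul1mx -!scalemxAl GG HG scaler0 !addr0.
by clearbody E G H; apply/matrixP => i j; rewrite !mxE; ring.
Qed.

Lemma borel_elem (c d : 'I_n) (x : F) : (d < c)%N -> borel (elem_mx c d x).
Proof.
move=> dc; have cd : c != d by apply: contraTneq dc => ->; rewrite ltnn.
split; first exact: det_elem_mx.
apply/is_trig_mxP => i j ij; rewrite elem_mxE.
have -> : i == j = false by apply: contraTF ij => /eqP ->; rewrite ltnn.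
rewrite add0r; case: eqP => [ic|]; case: eqP => [jd|] //=; rewrite ?mulr0 //.
by subst; move: (ltn_trans ij dc); rewrite ltnn.
Qed.

Lemma borel_unitrig A : is_trig_mx A -> (forall i, A i i = 1) -> borel A.
Proof. by move=> tA A1; split=> //; rewrite /SLn /= det_trig // big1. Qed.

(* A transvection [1 + x v phi] is moved by the Borel subgroup onto a root
   subgroup, read off from the first nonzero entry of [v] and the last one of
   [phi]. *)
Lemma transvection_root P (v : 'cV[F]_n) (phi : 'rV[F]_n) (a b : 'I_n) :
  closed_subgroup P -> @borel F n `<=` P ->
  phi *m v = 0 -> (a < b)%N ->
  v a 0 != 0 -> (forall i : 'I_n, (i < a)%N -> v i 0 = 0) ->
  phi 0 b != 0 -> (forall i : 'I_n, (b < i)%N -> phi 0 i = 0) ->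
  (forall x, P (1%:M + x *: (v *m phi))) -> forall x, P (elem_mx a b x).
Proof.
move=> [PS _ _ PM PV] BP pv0 ab va v0 pb p0 Pvp x.
have ab' : a != b by apply: contraTneq ab => ->; rewrite ltnn.
pose ea : 'cV[F]_n := delta_mx a 0; pose ra : 'rV[F]_n := delta_mx 0 a.
pose eb : 'cV[F]_n := delta_mx b 0; pose rb : 'rV[F]_n := delta_mx 0 b.
have mx11 (w : 'rV[F]_n) (i : 'I_n) : w *m delta_mx i 0 = (w 0 i)%:M.
  by rewrite -colE; apply/matrixP => k l; rewrite !mxE !ord1 eqxx mulr1n.
have mx11' (w : 'cV[F]_n) (i : 'I_n) : delta_mx 0 i *m w = (w i 0)%:M.
  by rewrite -rowE; apply/matrixP => k l; rewrite !mxE !ord1 eqxx mulr1n.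
pose u := (v a 0)^-1 *: v - ea.
have ua : ra *m u = 0.
  by rewrite mulmxBr -scalemxAr !mx11' -scalemx1 scalerA mulVf // !mxE !eqxx scale1r subrr.
pose b1 := 1%:M - u *m ra; pose b1' := 1%:M + u *m ra.
have b11 : b1' *m b1 = 1%:M.
  rewrite mulmxBr mulmx1 mulmxDl mul1mx -mulmxA [ra *m _]mulmxA ua mul0mx mulmx0 addr0.
  by rewrite addrK.
have b1v : b1 *m v = v a 0 *: ea.
  rewrite mulmxBl mul1mx -mulmxA mx11' mul_mx_scalar /u scalerBr scalerA mulfV // scale1r.
  by rewrite opprB addrC subrK.
have [phi1 phi1D] : exists t, t = phi *m b1' by exists (phi *m b1').
have phi1E : phi1 = phi - phi 0 a *: ra.
  rewrite phi1D mulmxDr mulmx1 mulmxA /u mulmxBr -scalemxAr pv0 scaler0 add0r mx11.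
  by rewrite mulNmx mul_scalar_mx.
pose w := (phi 0 b)^-1 *: phi1 - rb.
have phi1a : phi1 0 a = 0 by rewrite phi1E !mxE !eqxx mulr1 subrr.
have phi1b : phi1 0 b = phi 0 b by rewrite phi1E !mxE eq_sym (negbTE ab') mulr0 subr0.
have wa : w *m ea = 0.
  rewrite mx11 !mxE phi1a mulr0 (negbTE ab') subr0.
  by apply/matrixP => i j; rewrite !mxE mul0rn.
have wb : w *m eb = 0.
  rewrite mx11 !mxE phi1b mulVf // !eqxx subrr.
  by apply/matrixP => i j; rewrite !mxE mul0rn.
pose b2 := 1%:M + eb *m w; pose b2' := 1%:M - eb *m w.
have b22 : b2' *m b2 = 1%:M.
  rewrite mulmxDr mulmx1 mulmxBl mul1mx -mulmxA [w *m _]mulmxA wb mul0mx mulmx0 subr0.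
  by rewrite subrK.
have b2e : b2 *m ea = ea by rewrite mulmxDl mul1mx -mulmxA wa mulmx0 addr0.
have phi2 : phi1 *m b2' = phi 0 b *: rb.
  rewrite mulmxBr mulmx1 mulmxA mx11 mul_scalar_mx phi1b /w scalerBr scalerA mulfV // scale1r.
  by rewrite opprB addrC subrK.
have Bb1 : borel b1.
  apply: borel_unitrig => [|i].
    apply/is_trig_mxP => i j ij; rewrite !mxE big_ord1 !mxE eqxx /=.
    have -> : i == j = false by apply: contraTF ij => /eqP ->; rewrite ltnn.
    have [ja|_] := eqVneq j a; last by rewrite mulr0 subr0.
    subst j; rewrite (v0 i ij) mulr0 andbT.
    have -> : i == a = false by apply: contraTF ij => /eqP ->; rewrite ltnn.
    by rewrite subrr mul0r subr0.
  rewrite !mxE big_ord1 !mxE eqxx /=; have [->|_] := eqVneq i a.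
    by rewrite mulVf // subrr mul0r subr0.
  by rewrite mulr0 subr0.
have Bb2 : borel b2.
  apply: borel_unitrig => [|i].
    apply/is_trig_mxP => i j ij; rewrite !mxE big_ord1 /w phi1E !mxE eqxx /= andbT.
    have -> : i == j = false by apply: contraTF ij => /eqP ->; rewrite ltnn.
    have [ib|_] := eqVneq i b; last by rewrite mul0r addr0.
    have bj : (b < j)%N by rewrite -ib.
    have -> : j == b = false by apply: contraTF bj => /eqP ->; rewrite ltnn.
    have -> : j == a = false by apply: contraTF bj => /eqP ->; rewrite -leqNgt ltnW.
    by rewrite (p0 j bj) /= !(mulr0, subr0, mul1r, addr0).
  rewrite !mxE big_ord1 /w !mxE eqxx /= andbT; have [->|_] := eqVneq i b.
    by rewrite phi1b mulVf // subrr mulr0 addr0.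
  by rewrite mul0r addr0.
pose y := x / (v a 0 * phi 0 b).
have -> : elem_mx a b x = (b2 *m b1) *m (1%:M + y *: (v *m phi)) *m (b1' *m b2').
  rewrite mulmxDr mulmx1 mulmxDl.
  have -> : b2 *m b1 *m (b1' *m b2') = 1%:M.
    apply: mulmx1C; rewrite -mulmxA [b2' *m _]mulmxA b22 mul1mx //.
  rewrite -scalemxAr -scalemxAl; congr (_ + _).
  have -> : b2 *m b1 *m (v *m phi) *m (b1' *m b2') = (b2 *m (b1 *m v)) *m (phi *m b1' *m b2').
    by rewrite !mulmxA.
  rewrite b1v -phi1D phi2 -[b2 *m _]scalemxAr b2e -scalemxAl -scalemxAr mul_delta_mx !scalerA.
  by congr (_ *: _); rewrite /y; field; rewrite va pb.
have b1'E : b1' = invmx b1.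
  rewrite -[LHS]mulmx1 -(mulmxV (SLn_unit (proj1 Bb1))) mulmxA b11 mul1mx //.
have b2'E : b2' = invmx b2.
  rewrite -[LHS]mulmx1 -(mulmxV (SLn_unit (proj1 Bb2))) mulmxA b22 mul1mx //.
apply/PM; last by rewrite b1'E b2'E; apply/PM; apply: PV; exact: BP.
by apply/PM => //; apply/PM; exact: BP.
Qed.

Lemma ord_min_nz (v : 'I_n -> F) c : v c != 0 ->
  exists a : 'I_n, [/\ (a <= c)%N, v a != 0 & forall i : 'I_n, (i < a)%N -> v i = 0].
Proof.
move=> vc; have [a va amin] := arg_minnP (P := fun i => v i != 0) (fun i : 'I_n => i : nat) vc.
exists a; split=> //; first exact: amin.
move=> i ia; apply/eqP/negPn/negP => /amin /=; by rewrite leqNgt ia.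
Qed.

Lemma ord_max_nz (v : 'I_n -> F) c : v c != 0 ->
  exists a : 'I_n, [/\ (c <= a)%N, v a != 0 & forall i : 'I_n, (a < i)%N -> v i = 0].
Proof.
move=> vc; have [a va amax] := arg_maxnP (P := fun i => v i != 0) (fun i : 'I_n => i : nat) vc.
exists a; split=> //; first exact: amax.
move=> i ia; apply/eqP/negPn/negP => /amax /=; by rewrite leqNgt ia.
Qed.

(** The labels jump at [i] exactly when all elements of [P] vanish in the corner of rows before [i]
    and columns from [i] on. Where there is no jump, a nonzero corner entry has to be converted into
    a root subgroup of [P] crossing the diagonal at that place. *)
Lemma parabolic_blockP P : closed_subgroup P -> @borel F n `<=` P ->
  exists be : 'I_n -> nat, P = blockP be.
Proof.
move=> gP BP; have [PS _ P1 PM PV] := gP.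
pose brk (i : nat) := `[< forall A (c d : 'I_n), P A -> (c < i)%N -> (i <= d)%N -> A c d = 0 >].
pose be (a : 'I_n) := (\sum_(0 <= i < a.+1) brk i)%N.
exists be.
have be_le (c d : 'I_n) : (c <= d)%N -> (be c <= be d)%N.
  by move=> cd; rewrite /be [leqRHS](@big_cat_nat _ _ _ c.+1) //= leq_addr.
pose E (c d : 'I_n) := c != d -> forall x, P (elem_mx c d x).
have Etrans c d e : E c d -> E d e -> E c e.
  have [->//|cd] := eqVneq c d; have [->//|de] := eqVneq d e.
  move=> /(_ cd) Ecd /(_ de) Ede ce x; rewrite -(elem_mx_commutator x cd de ce).
  by do 3 apply/PM => //.
have Elow (c d : 'I_n) : (d <= c)%N -> E c d.
  rewrite leq_eqVlt => /orP[/eqP/val_inj ->|dc] cd x; first by rewrite eqxx in cd.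
  exact/BP/borel_elem.
have Estep (c d : 'I_n) : d = c.+1 :> nat -> ~~ brk d -> E c d.
  move=> dc /asboolPn nb.
  have [A [c' [d' [PA c'd dd' Ac]]]] : exists A (c' d' : 'I_n),
      [/\ P A, (c' < d)%N, (d <= d')%N & A c' d' != 0].
    apply: contrapT => nE; apply: nb => A c' d' PA c'd dd'.
    by apply/eqP/negPn/negP => Ac; apply: nE; exists A, c', d'.
  have uA := SLn_unit (PS _ PA).
  (* If the inverse of [A] vanished in this corner, it would be block triangular for the splitting
     at [d], and so would [A]. *)
  have [d0 [c0 [d0d dc0 Ac0]]] : exists (d0 c0 : 'I_n),
      [/\ (d0 < d)%N, (d <= c0)%N & invmx A d0 c0 != 0].
    apply: contrapT => nE; move/eqP: Ac; apply.
    pose b' (a : 'I_n) := (d <= a)%N : nat.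
    suff sA : supported (lowR b') A.
      by apply: sA; rewrite /lowR /b' dd' [(d <= c')%N]leqNgt c'd.
    rewrite -[A]invmxK; apply: supportedV; first exact: lowR_refl.
    + exact: lowR_trans.
    + by rewrite unitmx_inv.
    move=> i j; rewrite /lowR /b'; have [id|id] := leqP d i; first by case: (leqP d j).
    have [jd|//] := leqP d j; move=> _; apply/eqP/negPn/negP => Aij.
    by apply: nE; exists i, j.
  have [a [ac' va v0]] := ord_min_nz (v := fun i => A i d') Ac.
  have [b [bc0 pb p0]] := ord_max_nz (v := fun i => invmx A d0 i) Ac0.
  have Eab : E a b.
    move=> _; apply: (@transvection_root P (col d' A) (row d0 (invmx A)) a b) => //.
    - apply/matrixP => i j; rewrite !ord1 [RHS]mxE.
      have : (invmx A *m A) d0 d' = 0.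
        rewrite mulVmx // mxE; case: eqP => // e; move: d0d.
        by rewrite e ltnNge dd'.
      by rewrite !mxE => h; rewrite -[RHS]h; apply: eq_bigr => k _; rewrite !mxE.
    - by apply: leq_ltn_trans ac' _; apply: leq_trans c'd _; apply: leq_trans dc0 bc0.
    - by rewrite mxE.
    - by move=> i ia; rewrite mxE v0.
    - by rewrite mxE.
    - by move=> i ia; rewrite mxE p0.
    move=> x.
    (* The transvection is the conjugate by [A] of the root element at [(d', d0)], which is in the
       Borel subgroup because [d0 < d <= d']. *)
    have -> : 1%:M + x *: (col d' A *m row d0 (invmx A)) = mxconj A (elem_mx d' d0 x).
      rewrite /mxconj mulmxDr mulmx1 mulmxDl mulmxV // -scalemxAr -scalemxAl; congr (_ + _ *: _).
      rewrite colE rowE; have <- : delta_mx d' (0 : 'I_1) *m delta_mx (0 : 'I_1) d0 = delta_mx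
        d' d0 :> 'M[F]_n by rewrite mul_delta_mx.
      by rewrite !mulmxA.
    apply/PM; last exact: PV.
    by apply/PM => //; apply/BP/borel_elem; apply: leq_trans d0d dd'.
  (* The chain goes from [c] to [a], [b] and [d]. As [a <= c] and [d <= b], its two outer links lie
     in the Borel subgroup. *)
  apply: (Etrans _ a); first by apply: Elow; rewrite -ltnS -dc (leq_ltn_trans ac').
  by apply: (Etrans _ b) => //; apply: Elow; apply: leq_trans dc0 bc0.
have Eeq (k : nat) (c d : 'I_n) : d = (c + k)%N :> nat -> be c = be d -> E c d.
  elim: k c d => [|k IH] c d; first by rewrite addn0 => /val_inj -> _; apply: Elow.
  move=> dck bcd.
  have c1n : (c.+1 < n)%N by apply: leq_ltn_trans (ltn_ord d); rewrite dck -addSnnS leq_addr.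
  pose c1 := Ordinal c1n.
  have c1d : (c1 <= d)%N by rewrite dck /= -addSnnS leq_addr.
  have bc1 : be c = be c1.
    by apply/eqP; rewrite eqn_leq be_le //= bcd be_le.
  apply: (Etrans _ c1); last by apply: IH; rewrite -?bc1 //= dck addSnnS.
  apply: Estep => //; apply/negP => br.
  by move: bc1; rewrite /be [RHS]big_nat_recr //= br; lia.
apply/seteqP; split=> [A PA|A [sA lA]].
  split; first exact: PS.
  move=> c d; rewrite /lowR -ltnNge => bcd.
  have cd : (c < d)%N by rewrite ltnNge; apply: contraTN bcd => /be_le; rewrite -leqNgt.
  have [i [ci id /asboolP br]] : exists i, [/\ (c < i)%N, (i <= d)%N & brk i].
    apply: contrapT => nE; move: bcd; rewrite ltnNge => /negP; apply.
    rewrite /be [leqLHS](@big_cat_nat _ _ _ c.+1) //=; last exact: ltnW.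
    suff -> : (\sum_(c.+1 <= i < d.+1) brk i)%N = 0%N by rewrite addn0.
    rewrite big_nat_cond big1 // => i /andP[/andP[ci id] _].
    by case br: (brk i) => //; exfalso; apply: nE; exists i.
  exact: br PA ci id.
apply: (elimination (R := lowR be) _ _ _ _ _ sA lA) => //.
- exact: lowR_refl.
- exact: lowR_trans.
- by move=> t [st dt]; apply: BP; split=> //; apply: is_diag_mx_is_trig.
move=> c d x cd; rewrite /lowR => bdc.
have [dc|dc] := leqP d c; first exact: Elow.
apply: (Eeq (d - c)%N) => //; first by rewrite subnKC // ltnW.
by apply/eqP; rewrite eqn_leq bdc be_le // ltnW.
Qed.

End Parabolic.

(** * Levi factors *)

Section Levi.
Context (F : numClosedFieldType) (n : nat).
Implicit Types (A B X g h : 'M[F]_n) (S P L U V : set 'M[F]_n).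

(* Solves [(1 + N) (D + M) = D (1 + N)] for a diagonal matrix [D] separating
   the blocks; the iteration stabilises because [M] lowers the block index. *)
Lemma blockU_diagonalize (be : 'I_n -> nat) (d : 'I_n -> F) M :
  (forall i j, be i != be j -> d i != d j) -> ulie be M ->
  exists2 v, blockU be v & v *m (diag_mx (\row_i d i) + M) = diag_mx (\row_i d i) *m v.
Proof.
move=> dinj uM.
pose T X : 'M[F]_n := \matrix_(i, j) (if be i == be j then 0 else X i j / (d i - d j)).
pose fix N k : 'M[F]_n := if k is k'.+1 then T (M + N k' *m M) else 0.
have uT X : ulie be X -> ulie be (T X).
  by move=> uX i j ij; rewrite mxE uX ?mul0r ?if_same.
have uN k : ulie be (N k).
  elim: k => [|k IH]; first by move=> i j _; rewrite mxE.
  apply: uT => i j ij; rewrite mxE uM // add0r.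
  by apply: (ulie_mulr (ulie_low uM) IH).
have dN k i j : (be i < be j + k.+1)%N -> N k.+1 i j = N k i j.
  elim: k i j => [|k IH] i j ij; first by rewrite !uN //; lia.
  rewrite [LHS]mxE [RHS]mxE; case: ifP => // _; congr (_ / _).
  rewrite [LHS]mxE [RHS]mxE; congr (_ + _).
  rewrite [LHS]mxE [RHS]mxE; apply: eq_bigr => l _.
  have [lj|lj] := leqP (be l) (be j); first by rewrite uM // !mulr0.
  by rewrite IH //; lia.
pose K := (\sum_i be i)%N.+1.
have NK : N K.+1 = N K.
  apply/matrixP => i j; apply: dN.
  by rewrite /K (bigD1 i) //=; lia.
exists (1%:M + N K).
  by apply/blockU_ulie; rewrite addrC addKr.
apply/matrixP => i j.
have -> : (1%:M + N K) *m (diag_mx (\row_i d i) + M) =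
    diag_mx (\row_i d i) + N K *m diag_mx (\row_i d i) + (M + N K *m M).
  by rewrite mulmxDr !mulmxDl !mul1mx addrACA.
rewrite mulmxDr mulmx1 mul_mx_diag mul_diag_mx.
set Y := M + N K *m M.
have -> : N K = T Y by rewrite -[LHS]NK.
have uY : ulie be Y.
  by move=> i' j' ij; rewrite mxE uM // add0r (ulie_mulr (ulie_low uM) (uN K)).
clearbody Y; rewrite !mxE; move: (_ *+ (i == j)) => t; case: (be i =P be j) => [ij|/eqP/dinj dij].
  by rewrite uY ?ij // mulr0 mul0r !addr0.
rewrite -subr_eq0 in dij.
by field.
Qed.

Lemma blockU_ulie_bd (be : 'I_n -> nat) A : supported (lowR be) A ->
  ulie be (A - bd be A).
Proof.
move=> sA i j ij; rewrite !mxE; case: eqP => [_|/eqP e]; first by rewrite subrr.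
by rewrite subr0 sA // /lowR -ltnNge ltn_neqAle e.
Qed.

(** The exponents are [n] times the labels so that their total is a multiple of [n]; the common
    denominator can then bring the determinant to 1 without extracting roots. *)
Lemma block_separating (be : 'I_n -> nat) : exists d : 'I_n -> F,
  [/\ \prod_i d i = 1, forall i j, be i = be j -> d i = d j
    & forall i j, be i != be j -> d i != d j].
Proof.
pose s := (\sum_i be i)%N.
exists (fun i => 2%:R ^+ (n * be i) / 2%:R ^+ s); split.
- rewrite big_split /= prodr_const card_ord prodrXr -big_distrr /= -/s.
  by rewrite exprVn -exprM mulnC mulfV // expf_neq0 // pnatr_eq0.
- by move=> i j ->.
move=> i j; apply: contra => /eqP /mulIf.
rewrite invr_eq0 expf_neq0 ?pnatr_eq0 // => /(_ isT).
have two : (1 : F) < 2%:R by rewrite ltr1n.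
move/(ieexprIn (lt_trans ltr01 two)); rewrite gt_eqF // => /(_ isT) /eqP.
by rewrite eqn_pmul2l ?(leq_ltn_trans _ (ltn_ord i)).
Qed.

(** [D] is scalar on each block with distinct scalars, so that a block unitriangular matrix
    commuting with it is trivial. Once a conjugate of [L] contains [D], it has to be block
    diagonal. *)
Lemma levi_conj_blockL (be : 'I_n -> nat) L : closed_subgroup L ->
  L `&` blockU be = [set 1%:M] ->
  blockP be = [set l *m u | l in L & u in blockU be] ->
  exists2 v, blockU be v & mxconj v @` L = blockL be.
Proof.
move=> [LS _ L1 LM LV] LU PE.
have [PS _ P1 PM PV] := closed_subgroup_P F be.
have [US _ U1 UM UV] := closed_subgroup_U F be.
have [d [d1 deq dneq]] := block_separating be.
pose D : 'M[F]_n := diag_mx (\row_i d i).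
have LD : blockL be D.
  split; last by apply: supported_diag; [exact: eqR_refl|exact: diag_mx_is_diag].
  by rewrite /SLn /= det_diag -[RHS]d1; apply: eq_bigr => i _; rewrite mxE.
have Dcomm A : supported (eqR be) A -> D *m A = A *m D.
  move=> sA; rewrite mul_mx_diag mul_diag_mx; apply/matrixP => i j; rewrite !mxE.
  have [/eqP/deq ->|/sA ->] := boolP (eqR be i j); first by rewrite mulrC.
  by rewrite mulr0 mul0r.
have : blockP be D by apply: blockL_P.
rewrite {1}PE => -[l Ll [u Uu luD]].
have LP : L `<=` blockP be.
  by move=> a La; rewrite PE; exists a => //; exists 1%:M; rewrite ?mulmx1.
have bl : bd be l = D.
  have [_ sl] := LP _ Ll; have /blockU_bd[su bu] := Uu.
  by rewrite -(bd_id (proj2 LD)) -luD bdM // bu mulmx1.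
have [v Uv vl] : exists2 v, blockU be v & v *m (D + (l - D)) = D *m v.
  apply: blockU_diagonalize => //; rewrite -bl; apply: blockU_ulie_bd.
  by case: (LP _ Ll).
rewrite addrC subrK in vl.
have uv := SLn_unit (US _ Uv).
exists v => //.
have L1D : (mxconj v @` L) D by exists l => //; apply/mxconj_eq.
have L1LM A B : (mxconj v @` L) A -> (mxconj v @` L) B -> (mxconj v @` L) (A *m B).
  by move=> [A' LA <-] [B' LB <-]; exists (A' *m B'); [exact: LM|rewrite mxconjM].
have L1V A : (mxconj v @` L) A -> (mxconj v @` L) (invmx A).
  move=> [A' LA <-]; exists (invmx A'); first exact: LV.
  by rewrite mxconjV // SLn_unit //; exact: LS.
have L1P A : (mxconj v @` L) A -> blockP be A.
  move=> [A' LA <-]; apply: (PM); last by apply/PV/blockU_P.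
  by apply: (PM); [exact: blockU_P|exact: LP].
have L1U A : (mxconj v @` L) A -> blockU be A -> A = 1%:M.
  move=> [A' LA <-] UA; have : (L `&` blockU be) A'.
    split=> //; rewrite -(mxconjK uv A'); apply: blockU_conj => //.
      by rewrite unitmx_inv.
    by apply: supportedV => //; [exact: lowR_refl|exact: lowR_trans|case: (blockU_P Uv)].
  by rewrite LU => ->; rewrite mxconj_id.
have sub : mxconj v @` L `<=` blockL be.
  move=> a La; have Pa := L1P _ La; have [Lb Ub] := blockLU Pa.
  set u' := invmx (bd be a) *m a in Ub.
  have ubd := SLn_unit (proj1 Lb).
  have ua := SLn_unit (PS _ Pa).
  have aE : a = bd be a *m u' by rewrite mulKVmx.
  have uu' := SLn_unit (US _ Ub).
  have uD := SLn_unit (proj1 LD).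
  (* This commutator lies in the conjugate of [L]. The block diagonal part of [a] cancels from it,
     so it also lies in [blockU] and is trivial; hence [u'] commutes with [D]. *)
  have H : invmx a *m D *m a *m invmx D = invmx u' *m mxconj D u'.
    rewrite {1 2}aE invmxM // /mxconj !mulmxA.
    rewrite -[_ *m D *m bd be a]mulmxA Dcomm; last exact: bd_supp.
    by rewrite !mulmxA mulmxKV.
  have : invmx u' *m mxconj D u' = 1%:M.
    apply: L1U; first by rewrite -H; apply/L1LM; [apply/L1LM => //; apply/L1LM => //|]; exact/L1V.
    apply/UM; first exact: UV.
    by apply: blockU_conj => //; apply/eqR_low; case: LD.
  move/(congr1 (mulmx u')); rewrite mulKVmx // mulmx1 => /(mxconj_eq _ _ uD).
  rewrite mul_diag_mx mul_mx_diag => /matrixP Du.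
  suff -> : a = bd be a by [].
  rewrite [LHS]aE; suff -> : u' = 1%:M by rewrite mulmx1.
  apply/matrixP => i j; rewrite [RHS]mxE.
  have [bij|bij] := eqVneq (be i) (be j); first by rewrite Ub // bij.
  have -> : i == j = false by apply: contraNF bij => /eqP ->.
  apply/eqP; move: (Du i j) => /eqP; rewrite !mxE mulrC -subr_eq0 -mulrBr mulf_eq0 => /orP[//|].
  by rewrite subr_eq0 => e; move: (dneq _ _ bij); rewrite e.
apply/seteqP; split=> // A LA.
have PA : blockP be A by apply: blockL_P.
have : blockP be (mxconj (invmx v) A).
  apply: (PM); last by rewrite invmxK; apply: blockU_P.
  by apply: (PM) => //; apply/PV/blockU_P.
rewrite {1}PE => -[l' Ll' [u' Uu' E]].
exists l' => //.
have AE : A = mxconj v l' *m mxconj v u' by rewrite -mxconjM // E mxconjVK.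
have Ll1 : blockL be (mxconj v l') by apply: sub; exists l'.
have Uu1 : blockU be (mxconj v u').
  by apply: blockU_conj => //; case: (blockU_P Uv).
suff e1 : mxconj v u' = 1%:M by rewrite AE e1 mulmx1.
have : (blockL be `&` blockU be) (mxconj v u').
  split=> //; have [_ _ _ LbM LbV] := closed_subgroup_L F be.
  have -> : mxconj v u' = invmx (mxconj v l') *m A.
    by rewrite AE mulKmx // SLn_unit //; case: Ll1.
  by apply/LbM => //; exact: LbV.
by rewrite blockLU1.
Qed.

Lemma richardson_form p P L U : richardson p P L U ->
  exists (be : 'I_n -> nat) g, [/\ SLn g, P = mxconj g @` blockP be,
    L = mxconj g @` blockL be & U = mxconj g @` blockU be].
Proof.
move=> [[gP [g sg gB]] dP _]; have ug := SLn_unit sg.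
have ugV : invmx g \in unitmx by rewrite unitmx_inv.
have PS : P `<=` @SLn F n by case: gP.
have [be PE] : exists be : 'I_n -> nat, mxconj (invmx g) @` P = blockP be.
  apply: parabolic_blockP; first exact: closed_subgroup_conj.
  by rewrite -(image_mxconjK (@borel F n) ug); exact: image_subset.
have := levi_decomposition_conj ugV PS dP; rewrite PE => -[[nU maxU] gL LU PLU].
have [nU' maxU'] := unipotent_radical_P F be.
have UE : mxconj (invmx g) @` U = blockU be.
  by apply/seteqP; split; [exact: maxU'|exact: maxU].
rewrite UE in LU PLU.
have [v Uv vL] := levi_conj_blockL gL LU PLU.
have sv := blockU_SLn Uv; have uv := SLn_unit sv; have [_ lv] := blockU_P Uv.
have uvV : invmx v \in unitmx by rewrite unitmx_inv.
have back S : S = mxconj g @` (mxconj (invmx g) @` S).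
  by have := image_mxconjK S ugV; rewrite invmxK.
have backv S : S = mxconj (invmx v) @` (mxconj v @` S) by rewrite image_mxconjK.
have [_ _ _ PM PV] := closed_subgroup_P F be.
exists be, (g *m invmx v); split.
- by apply: SLnM => //; exact: SLnV.
- rewrite -image_mxconj_comp // {1}[P]back PE; congr image.
  rewrite {1}[blockP be]backv; congr image; apply/seteqP; split.
    move=> _ [A PA <-]; apply: (PM); last by apply/PV/blockU_P.
    by apply: (PM) => //; exact: blockU_P.
  move=> A PA; exists (mxconj (invmx v) A); last by rewrite mxconjVK.
  apply: (PM); last by rewrite invmxK; exact: blockU_P.
  by apply: (PM) => //; apply/PV/blockU_P.
- by rewrite -image_mxconj_comp // {1}[L]back {1}[mxconj (invmx g) @` L]backv vL.
rewrite -image_mxconj_comp // {1}[U]back UE; congr image.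
rewrite {1}[blockU be]backv; congr image; apply/seteqP; split.
  by move=> _ [A UA <-]; apply: blockU_conj.
move=> A UA; exists (mxconj (invmx v) A); last by rewrite mxconjVK.
apply: blockU_conj => //; apply: supportedV => //; [exact: lowR_refl|exact: lowR_trans].
Qed.

End Levi.

(** * Partitions and chains *)

Section Partitions.
Local Open Scope nat_scope.
Implicit Types (p : seq nat).

(** Both sides express that the box [(i, r)] belongs to the diagram; for a sorted [p] the parts
    larger than [i] come first. *)
Lemma count_gt_nth p i r : sorted geq p ->
  (r < count (fun a => i < a) p) = (i < nth 0 p r).
Proof.
elim: p r => [|a p IH] r; first by rewrite nth_nil !ltn0.
move=> sp /=; have sp' := path_sorted sp.
have [ia|ai] := ltnP i a; first by case: r => [|r] //=; rewrite add1n ltnS IH.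
have -> : count (fun b => i < b) p = 0.
  apply/eqP; rewrite -leqn0 leqNgt -has_count; apply/hasPn => b bp.
  rewrite -leqNgt (leq_trans _ ai) //.
  by move: sp; rewrite /= path_sortedE; [case/andP => /allP/(_ b bp)|move=> x y z /= h1 h2;
    apply: leq_trans h2 h1].
case: r => [|r] /=; first by rewrite [RHS]ltnNge ai.
rewrite ltn0; apply/esym/negbTE; rewrite -leqNgt.
have [rp|rp] := ltnP r (size p); last by rewrite nth_default.
apply: leq_trans ai; move: sp; rewrite /= path_sortedE; last by move=> x y z /= h1 h2;
  apply: leq_trans h2 h1.
by case/andP => /allP/(_ _ (mem_nth 0 rp)).
Qed.

Lemma nth_transpose p i : sorted geq p ->
  nth 0 (transpose_part p) i = count (fun a => i < a) p.
Proof.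
move=> sp; have [ih|hi] := ltnP i (head 0 p); first by rewrite nth_mkseq.
rewrite nth_default ?size_mkseq //; apply/esym/eqP.
by rewrite -leqn0 leqNgt count_gt_nth // nth0 -leqNgt.
Qed.

Lemma transpose_gt p i r : sorted geq p ->
  (r < nth 0 (transpose_part p) i) = (i < nth 0 p r).
Proof. by move=> sp; rewrite nth_transpose // count_gt_nth. Qed.

Lemma sumn_nth p : sumn p = \sum_(0 <= i < size p) nth 0 p i.
Proof. by rewrite sumnE (big_nth 0). Qed.

Lemma sorted_head p i : sorted geq p -> nth 0 p i <= head 0 p.
Proof.
move=> sp; rewrite -nth0; have [ip|ip] := ltnP i (size p); last by rewrite nth_default.
have := @sorted_leq_nth _ geq _ _ 0 p sp; apply=> //.
- by move=> x y z /= h1 h2; apply: leq_trans h2 h1.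
- by move=> x /=.
by rewrite inE (leq_ltn_trans _ ip).
Qed.

Lemma sumn_transpose p : sorted geq p -> sumn (transpose_part p) = sumn p.
Proof.
move=> sp; rewrite sumn_nth size_mkseq.
rewrite (eq_big_nat _ _ (F2 := fun i => \sum_(0 <= r < size p) (i < nth 0 p r))); last first.
  by move=> i _; rewrite nth_transpose // -sum1_count (big_nth 0) big_mkcond.
rewrite exchange_big /= sumn_nth; apply: eq_big_nat => r rp.
rewrite (@big_cat_nat _ _ _ (nth 0 p r)) //=; last exact: sorted_head.
rewrite (eq_big_nat _ _ (F2 := fun=> 1)); last by move=> i /andP[_ ->].
rewrite sum_nat_const_nat subn0 muln1 [X in _ + X]big_nat_cond big1 ?addn0 //.
by move=> i /andP[/andP[pi _] _]; rewrite ltnNge pi.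
Qed.

Lemma transpose_sorted p : sorted geq (transpose_part p).
Proof.
rewrite sorted_map; apply: (@sub_sorted _ ltn); last exact: iota_ltn_sorted.
move=> i j ij /=; apply: sub_count => a ja; exact: ltn_trans ij ja.
Qed.

Lemma transpose_notin0 p : sorted geq p -> 0 \notin transpose_part p.
Proof.
move=> sp; apply/negP => /(nthP 0) [j]; rewrite size_mkseq => ih /eqP.
by rewrite -leqn0 leqNgt transpose_gt // nth0 ih.
Qed.

End Partitions.

(** An identification of ['I_n] with the boxes of the diagram of [lam]: [row] is the index of a
    diagonal block and [off] a position inside it. The chains of the nilpotent matrix run through
    the blocks at a fixed [off]. *)
Record coords n (lam : nat -> nat) (row off : 'I_n -> nat) : Prop := {
  coords_inj : forall a b, row a = row b -> off a = off b -> a = b;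
  coords_lt : forall a, (off a < lam (row a))%N;
  coords_surj : forall i r, (r < lam i)%N -> exists2 a, row a = i & off a = r }.

Lemma coords_reshape n (sh : seq nat) : sumn sh = n ->
  @coords n (nth 0%N sh) (fun a => reshape_index sh a) (fun a => reshape_offset sh a).
Proof.
move=> sn; split=> [a b ri ro|a|i r ri].
- by apply: val_inj; rewrite /= -(reshape_indexK sh a) -(reshape_indexK sh b) ri ro.
- by apply: reshape_offsetP; rewrite sn.
have h : (flatten_index sh i r < n)%N by rewrite -sn; apply: flatten_indexP.
by exists (Ordinal h); [exact: flatten_indexKl|exact: flatten_indexKr].
Qed.

Section CoordinateMatrix.
Context (F : fieldType) (n : nat).
Implicit Types (P : pred 'I_n).

Definition cmx P : 'M[F]_n := diag_mx (\row_a (P a)%:R).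

Lemma cmxE P i j : cmx P i j = (P i && (i == j))%:R.
Proof. by rewrite !mxE; case: eqP => [->|_]; rewrite ?mulr1n ?mulr0n ?andbT ?andbF. Qed.

Lemma cmx_rank P : \rank (cmx P) = #|P|.
Proof.
have le Q : (\rank (cmx Q) <= #|Q|)%N.
  have -> : cmx Q = \sum_(a in Q) delta_mx a a.
    apply/matrixP => i j; rewrite cmxE summxE.
    rewrite (eq_bigr (fun a => ((i == a) && (j == a))%:R)); last by move=> a _; rewrite mxE.
    rewrite -natr_sum; congr (_%:R).
    have [Qi|Qi] := boolP (Q i).
      rewrite (bigD1 i) //= big1 ?addn0 => [|a /andP[_ ai]]; first by rewrite eqxx eq_sym.
      by rewrite eq_sym (negbTE ai).
    rewrite big1 // => a Qa; case: eqP => //= ia; subst a.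
    by rewrite -topredE /= in Qa; rewrite Qa in Qi.
  apply: (@leq_trans (\sum_(a in Q) 1)%N); last by rewrite sum1_card.
  elim/big_rec2: _ => [|a s A _ IH]; first by rewrite mxrank0.
  by apply: leq_trans (mxrank_add _ _) _; rewrite mxrank_delta leq_add2l.
(* Complementary projectors add up to the identity, so subadditivity of the rank forces equality in
   both upper bounds. *)
apply/eqP; rewrite eqn_leq le /= -(leq_add2r #|[predC P]|) cardC card_ord.
apply: leq_trans (leq_add (leqnn _) (le _)).
apply: leq_trans (mxrank_add _ _).
suff -> : cmx P + cmx [predC P] = 1%:M by rewrite mxrank1.
apply/matrixP => i j; rewrite [LHS]mxE !cmxE [RHS]mxE /=.
have -> : (i \notin P) = ~~ P i by []; case: (P i) => /=; by rewrite ?add0r ?addr0.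
Qed.

End CoordinateMatrix.
Arguments cmx {F n} P.

Section ChainNilpotent.
Context (F : numClosedFieldType) (n : nat).

Definition chain_mx (row off : 'I_n -> nat) : 'M[F]_n :=
  \matrix_(a, b) ((row a == (row b).+1) && (off a == off b))%:R.

Context (lam : nat -> nat) (row off : 'I_n -> nat).
Hypothesis C : coords lam row off.
Hypothesis lam_noninc : forall i j, (i <= j)%N -> (lam j <= lam i)%N.
Local Notation e := (chain_mx row off).

Lemma chain_mx_ulie : ulie row e.
Proof. by move=> a b ab; rewrite mxE; case: eqP => // ra; move: ab; rewrite ra ltnn. Qed.

(** As rows do not get longer, a position present in one row is present in all earlier ones, so
    chains have no holes. *)
Lemma coords_up a k : (k <= row a)%N -> exists2 b, row a = (row b + k)%N & off b = off a.
Proof.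
move=> ka; have [|b rb ob] := @coords_surj _ _ _ _ C (row a - k) (off a).
  by apply: leq_trans (coords_lt C a) (lam_noninc (leq_subr _ _)).
by exists b => //; rewrite rb subnK.
Qed.

Lemma chain_mx_exp k a b :
  (e ^+ k) a b = ((row a == row b + k)%N && (off a == off b))%:R.
Proof.
elim: k a b => [|k IH] a b.
  rewrite expr0 mxE addn0; congr (_%:R); congr nat_of_bool.
  apply/eqP/andP => [->|[/eqP ? /eqP ?]]; first by rewrite !eqxx.
  exact: (coords_inj C).
rewrite exprSr mxE.
rewrite (eq_bigr (fun c => (((row a == row c + k) && (off a == off c)) &&
    ((row c == (row b).+1) && (off c == off b)))%N%:R)); last first.
  by move=> c _; rewrite IH mxE -natrM mulnb.
have [/andP[/eqP ra /eqP oa]|nab] := boolP (_ && _).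
  have [c ra' oc] : exists2 c, row a = (row c + k)%N & off c = off a.
    by apply: coords_up; rewrite ra; lia.
  have rc : row c = (row b).+1 by lia.
  rewrite (bigD1 c) //= ra' rc oc oa !eqxx big1 ?addr0 // => d dc.
  case: eqP => //= _; case: eqP => //= od; case: eqP => //= rd.
  by case/eqP: dc; apply: (coords_inj C); [rewrite rc rd|rewrite oc oa od].
rewrite big1 // => c _; case: eqP => //= ra; case: eqP => //= oa.
case: eqP => //= rc; case: eqP => //= oc.
by case/negP: nab; rewrite ra rc oa oc eqxx andbT; apply/eqP; lia.
Qed.

(** Powers of this matrix are partial permutation matrices, whose product with their transpose is a
    coordinate projector. This yields the ranks, and later an explicit nonvanishing determinant. *)
Lemma chain_mx_expT k : e ^+ k *m (e ^+ k)^T = cmx (fun a => k <= row a)%N.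
Proof.
apply/matrixP => a b; rewrite mxE cmxE.
rewrite (eq_bigr (fun c => (((row a == row c + k) && (off a == off c)) &&
    ((row b == row c + k) && (off b == off c)))%N%:R)); last first.
  by move=> c _; rewrite mxE !chain_mx_exp -natrM mulnb.
have [ka|ka] /= := leqP k (row a); last first.
  by rewrite big1 // => c _; case: eqP => //= ra; move: ka; rewrite ra; lia.
have [c ra oc] := coords_up ka.
have [<-|ab] := eqVneq a b.
  rewrite (bigD1 c) //= ra oc !eqxx big1 ?addr0 // => d dc.
  case: eqP => //= rd; case: eqP => //= od.
  by case/eqP: dc; apply: (coords_inj C); lia.
rewrite big1 // => d _; case: eqP => //= rd; case: eqP => //= od.
case: eqP => //= rd'; case: eqP => //= od'.
by case/eqP: ab; apply: (coords_inj C); lia.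
Qed.

Lemma chain_mx_exp_cmx k : cmx (fun a => k <= row a)%N *m e ^+ k = e ^+ k.
Proof.
rewrite mul_diag_mx; apply/matrixP => a b;
  rewrite mxE [(\row_ _ _) _ _]mxE chain_mx_exp -natrM mulnb.
by congr (_%:R); congr nat_of_bool; case: eqP => [->|]; rewrite ?leq_addl ?andbF.
Qed.

Lemma chain_mx_rank k : \rank (e ^+ k) = #|[pred a | (k <= row a)%N]|.
Proof.
rewrite -(cmx_rank F); apply/eqP; rewrite eqn_leq; apply/andP; split.
  by rewrite -[X in (\rank X <= _)%N]chain_mx_exp_cmx mxrankM_maxl.
by rewrite -chain_mx_expT mxrankM_maxl.
Qed.

End ChainNilpotent.

(** * Flags lowered by a nilpotent matrix *)

Section Flags.
Context (F : fieldType) (n : nat) (e : 'M[F]_n).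
Implicit Types (G : nat -> 'M[F]_n) (I : nat -> bool) (s : nat).

(** Subspaces are row spaces and [e] acts on the right. These are the filtrations whose terms are
    each carried by [e] into the preceding one. *)
Definition flag s G := \rank (G 0%N) = 0%N /\
  forall i, (i < s)%N -> (G i <= G i.+1)%MS /\ (G i.+1 *m e <= G i)%MS.

Definition gap G i := (\rank (G i.+1) - \rank (G i))%N.

Definition isize s I := (\sum_(i < s) I i)%N.
Definition isum s I (d : nat -> nat) := (\sum_(i < s) I i * d i)%N.

Definition top_set s I (d : nat -> nat) := forall i j, (i < s)%N -> (j < s)%N ->
  I i -> ~~ I j -> (d j <= d i)%N.

Lemma top_set_max s I J (d : nat -> nat) : top_set s I d -> (isize s J <= isize s I)%N ->
  (isum s J d <= isum s I d)%N.
Proof.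
move=> topI sIJ.
(* The threshold [v] is the largest value outside [I]. After subtracting it, the elements of [I]
   count nonnegatively and the others not at all. *)
have [v [v1 v2]] : exists v, (forall i, (i < s)%N -> I i -> (v <= d i)%N) /\
                            (forall i, (i < s)%N -> ~~ I i -> (d i <= v)%N).
  exists (\max_(i < s | ~~ I i) d i); split=> i ilts Ii.
    by apply/bigmax_leqP => j nIj; apply: topI.
  exact: (leq_bigmax_cond (F := fun i : 'I_s => d i) (Ordinal ilts)).
have E (K : nat -> bool) : (\sum_(i < s) K i * (v + (d i - v)) = v * isize s K + \sum_(i < s) K
  i * (d i - v))%N.
  rewrite big_distrr -big_split /=; apply: eq_bigr => i _.
  by rewrite mulnDr [(v * _)%N]mulnC.
have -> : isum s I d = (\sum_(i < s) I i * (v + (d i - v)))%N.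
  apply: eq_bigr => i _; case Ii: (I i) => //=.
  by rewrite subnKC // v1.
apply: (@leq_trans (\sum_(i < s) J i * (v + (d i - v)))%N).
  by apply: leq_sum => i _; rewrite leq_mul2l; apply/orP; right; lia.
rewrite !E leq_add ?leq_mul2l ?sIJ ?orbT //; apply: leq_sum => i _.
case Ii: (I i); first by case: (J i); rewrite ?mul0n.
by have := v2 i (ltn_ord i); rewrite Ii => /(_ isT) di; rewrite (eqnP di) muln0.
Qed.

Lemma flag_le s G i : flag s G -> (i < s)%N -> (\rank (G i) <= \rank (G i.+1))%N.
Proof. by move=> [_ fG] /fG[/mxrankS]. Qed.

Lemma flagS s G : flag s.+1 G -> flag s G.
Proof. by move=> [G0 fG]; split=> // i ilts; apply: fG; apply: ltnW. Qed.

Lemma mxrank_expS (A B : 'M[F]_n) k : (A *m e <= B)%MS ->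
  (\rank (A *m e ^+ k.+1) <= \rank (B *m e ^+ k))%N.
Proof. by move=> AB; rewrite exprS [_ *m (_ * _)]mulmxA mxrankS // submxMr. Qed.

(** Equivalently, the kernel of [e ^+ isize s I] on [G s] is at least as large as the sum of the
    chosen gaps. A step left out can only enlarge this kernel; a chosen step uses up one factor [e],
    which carries [G s.+1] into [G s]. *)
Lemma flag_rank_bound s G I : flag s G ->
  (isum s I (gap G) + \rank (G s *m e ^+ isize s I) <= \rank (G s))%N.
Proof.
elim: s => [|s IH] fG; first by rewrite /isum big_ord0 mxrankM_maxl.
have fGs := flagS fG; have := IH fGs; have le := flag_le fG (ltnSn s).
have gE : gap G s = (\rank (G s.+1) - \rank (G s))%N by [].
have [_ /(_ s (ltnSn s))[GG Ge]] := fG.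
rewrite /isum /isize !big_ord_recr /= -/(isize s I) -/(isum s I _).
case: (I s) => /=; last first.
  rewrite mul0n !addn0 => h.
  have := mxrank_mul_ker (G s.+1) (e ^+ isize s I).
  have := mxrank_mul_ker (G s) (e ^+ isize s I).
  have : (\rank (G s :&: kermx (e ^+ isize s I)) <= \rank (G s.+1 :&: kermx (e ^+ isize s I)))%N.
    by apply: mxrankS; apply: capmxS.
  by lia.
rewrite mul1n addn1 => h; have := mxrank_expS (isize s I) Ge.
by lia.
Qed.

(** Equality in [flag_rank_bound], required only for sets of largest gaps, which give the strongest
    bound for their size. *)
Definition flag_tight s G := forall I, top_set s I (gap G) ->
  (\rank (G s) <= isum s I (gap G) + \rank (G s *m e ^+ isize s I))%N.

(** Let [I] consist of the gaps exceeding the last one. Tightness for [I] puts the kernel of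
    [e ^+ b] on [G s.+1] inside [G s]; tightness for [I] with the last step added shows that this
    kernel and the image of [G s.+1] under [e] have enough dimension together to fill [G s]. *)
Lemma flag_tight_step s G : flag s.+1 G -> flag_tight s.+1 G ->
  flag_tight s G /\
  let b := isize s (fun i => gap G s < gap G i)%N in
  (G s :=: G s.+1 *m e + (G s.+1 :&: kermx (e ^+ b)))%MS.
Proof.
move=> fG tG; have fGs := flagS fG; have le := flag_le fG (ltnSn s).
have gE : gap G s = (\rank (G s.+1) - \rank (G s))%N by [].
have [_ /(_ s (ltnSn s))[GG Ge]] := fG.
have ext I c i : (i < s)%N -> (if i == s then c else I i) = I i.
  by move=> ilts; rewrite ltn_eqF.
have sizeE I c : isize s.+1 (fun i => if i == s then c else I i) = (isize s I + c)%N.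
  rewrite /isize big_ord_recr /= eqxx; congr (_ + _)%N.
  by apply: eq_bigr => i _; rewrite ext.
have sumE I c : isum s.+1 (fun i => if i == s then c else I i) (gap G) = (isum s I (gap G) + c *
  gap G s)%N.
  rewrite /isum big_ord_recr /= eqxx; congr (_ + _)%N.
  by apply: eq_bigr => i _; rewrite ext.
have T1 I : (forall i, (i < s)%N -> ~~ I i -> (gap G i <= gap G s)%N) -> top_set s I (gap G) ->
    (\rank (G s.+1) <= isum s I (gap G) + gap G s + \rank (G s.+1 *m e ^+ (isize s I).+1))%N.
  move=> hI tI; have := tG (fun i => if i == s then true else I i).
  rewrite sizeE sumE mul1n addn1; apply=> i j.
  rewrite !ltnS (leq_eqVlt i) (leq_eqVlt j).
  case: eqP => [->|_] /= ilts; case: eqP => [->|_] //= jlts; first by move=> _; apply: hI.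
  exact: tI.
have T0 I : (forall i, (i < s)%N -> I i -> (gap G s <= gap G i)%N) -> top_set s I (gap G) ->
    (\rank (G s.+1) <= isum s I (gap G) + \rank (G s.+1 *m e ^+ isize s I))%N.
  move=> hI tI; have := tG (fun i => if i == s then false else I i).
  rewrite sizeE sumE mul0n !addn0; apply=> i j.
  rewrite !ltnS (leq_eqVlt i) (leq_eqVlt j).
  case: eqP => [->|_] //= ilts; case: eqP => [->|_] //= jlts Ii; first by move=> _; apply: hI.
  exact: tI.
split=> [I tI|b].
  (* If no gap left out exceeds the last one, adding the last step to [I] keeps it a set of largest
     gaps. Otherwise all gaps in [I] are at least the last one, and [I] is such a set for the longer
     flag as well. *)
  have [hI|/existsNP[j /not_implyP[jlts /not_implyP[Ij]]]] :=
      pselect (forall i, (i < s)%N -> ~~ I i -> (gap G i <= gap G s)%N).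
    have := T1 I hI tI; have := mxrank_expS (isize s I) Ge; by lia.
  move/negP; rewrite -ltnNge => dj.
  have := T0 I; have h : forall i, (i < s)%N -> I i -> (gap G s <= gap G i)%N.
    by move=> i ilts Ii; apply: leq_trans (ltnW dj) (tI _ _ ilts jlts Ii Ij).
  move=> /(_ h tI) h1.
  have := mxrank_mul_ker (G s.+1) (e ^+ isize s I).
  have := mxrank_mul_ker (G s) (e ^+ isize s I).
  have : (\rank (G s :&: kermx (e ^+ isize s I)) <= \rank (G s.+1 :&: kermx (e ^+ isize s I)))%N.
    by apply: mxrankS; apply: capmxS.
  by lia.
pose I i := (gap G s < gap G i)%N.
have hT1 i : (i < s)%N -> ~~ I i -> (gap G i <= gap G s)%N by rewrite -leqNgt.
have hT0 i : (i < s)%N -> I i -> (gap G s <= gap G i)%N by move=> _ /ltnW.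
have tI : top_set s I (gap G).
  by move=> i j _ _ Ii; rewrite -leqNgt => Ij; apply: leq_trans Ij (ltnW Ii).
have t1 := T1 I hT1 tI; have t0 := T0 I hT0 tI.
rewrite -[isize s I]/b in t1 t0.
have rk := flag_rank_bound I fGs; rewrite -[isize s I]/b in rk.
set K := kermx (e ^+ b) in t1 t0 *.
have k0 := mxrank_mul_ker (G s) (e ^+ b).
have k1 := mxrank_mul_ker (G s.+1) (e ^+ b).
have capS : (G s :&: K <= G s.+1 :&: K)%MS by apply: capmxS.
have capE : (G s.+1 :&: K <= G s)%MS.
  apply: submx_trans (capmxSl (G s) K).
  have [rle] := mxrank_leqif_sup capS => <-.
  by rewrite eqn_leq rle /=; rewrite -/K in k0 k1; lia.
set X := (G s.+1 *m e + _)%MS.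
have XG : (X <= G s)%MS by rewrite addsmx_sub Ge.
apply/eqmxP; rewrite XG andbT.
have [rle] := mxrank_leqif_sup XG => <-.
rewrite eqn_leq rle /=.
have kX := mxrank_mul_ker X (e ^+ b); rewrite -/K in kX k0 k1.
have c1 : (\rank (G s.+1 :&: K) <= \rank (X :&: K))%N.
  by apply: mxrankS; rewrite sub_capmx addsmxSr capmxSr.
have c2 : (\rank (G s.+1 *m e ^+ b.+1) <= \rank (X *m e ^+ b))%N.
  by apply: mxrank_expS; apply: addsmxSl.
by have := mxrankS capS; lia.
Qed.

(* By [flag_tight_step], each term of a tight flag is determined by the next one
   and by the gaps. *)
Lemma flag_unique s G G' : flag s G -> flag s G' -> flag_tight s G ->
  (forall i, (i <= s)%N -> \rank (G i) = \rank (G' i)) -> (G s :=: G' s)%MS ->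
  forall i, (i <= s)%N -> (G i :=: G' i)%MS.
Proof.
elim: s => [|s IH] fG fG' tG rk Gs i; first by rewrite leqn0 => /eqP ->.
have gapE j : (j < s.+1)%N -> gap G j = gap G' j by move=> js; rewrite /gap !rk // ltnW.
have tG' : flag_tight s.+1 G'.
  move=> I tI; rewrite -rk //.
  have sE : isum s.+1 I (gap G') = isum s.+1 I (gap G).
    by apply: eq_bigr => j _; rewrite gapE.
  rewrite sE -(eqmxMr _ Gs); apply: tG => a b al bl Ia Ib.
  by rewrite !gapE //; apply: tI.
have [tGs /= GsE] := flag_tight_step fG tG.
have [tGs' /= GsE'] := flag_tight_step fG' tG'.
have Gs' : (G s :=: G' s)%MS.
  apply: (eqmx_trans GsE); apply: eqmx_sym; apply: (eqmx_trans GsE').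
  have -> : isize s (fun j => gap G' s < gap G' j)%N = isize s (fun j => gap G s < gap G j)%N.
    by apply: eq_bigr => j _; rewrite !gapE // ltnS ltnW.
  apply: adds_eqmx; first exact: eqmxMr (eqmx_sym Gs).
  by apply: cap_eqmx => //; apply: eqmx_sym.
rewrite leq_eqVlt => /orP[/eqP -> //|].
rewrite ltnS; apply: IH => //; try exact: flagS.
by move=> j js; apply: rk; apply: leq_trans js (leqnSn s).
Qed.

End Flags.

(** * Permutation matrices and reordering of blocks *)

Section PermutationConjugation.
Context (F : numClosedFieldType) (n : nat).
Implicit Types (A : 'M[F]_n) (s : 'S_n).

Lemma perm_mx_unit s : perm_mx s \in @unitmx F n.
Proof. exact: unitmx_perm. Qed.

Lemma mxconj_perm s A : mxconj (perm_mx s) A = \matrix_(i, j) A (s i) (s j).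
Proof.
apply/mxconj_eq; first exact: perm_mx_unit.
apply/matrixP => i j; rewrite -row_permE -[s in RHS](invgK s) -col_permE !mxE.
by rewrite invgK permKV.
Qed.

Lemma mxconj_perm_supported s (R : rel 'I_n) A :
  supported (fun i j => R (s i) (s j)) (mxconj (perm_mx s) A) <-> supported R A.
Proof.
rewrite mxconj_perm; split=> sA i j nR; last by rewrite mxE sA.
by have := sA ((s^-1)%g i) ((s^-1)%g j); rewrite !mxE !permKV => /(_ nR).
Qed.

Lemma blockP_perm s (be : 'I_n -> nat) :
  mxconj (perm_mx s) @` @blockP F n be = blockP (be \o s).
Proof.
have us := perm_mx_unit s.
apply/seteqP; split=> [_ [A [sA lA] <-]|A [sA lA]].
  by split; [exact: SLn_conj|exact: (proj2 (@mxconj_perm_supported s (lowR be) A) lA)].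
exists (mxconj (invmx (perm_mx s)) A); last by rewrite mxconjVK.
split; first by apply: SLn_conj; rewrite ?unitmx_inv.
by apply/(@mxconj_perm_supported s (lowR be)); rewrite mxconjVK.
Qed.

Lemma blockL_perm s (be : 'I_n -> nat) :
  mxconj (perm_mx s) @` @blockL F n be = blockL (be \o s).
Proof.
have us := perm_mx_unit s.
apply/seteqP; split=> [_ [A [sA lA] <-]|A [sA lA]].
  by split; [exact: SLn_conj|exact: (proj2 (@mxconj_perm_supported s (eqR be) A) lA)].
exists (mxconj (invmx (perm_mx s)) A); last by rewrite mxconjVK.
split; first by apply: SLn_conj; rewrite ?unitmx_inv.
by apply/(@mxconj_perm_supported s (eqR be)); rewrite mxconjVK.
Qed.

Lemma blockU_perm s (be : 'I_n -> nat) :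
  mxconj (perm_mx s) @` @blockU F n be = blockU (be \o s).
Proof.
have us := perm_mx_unit s.
apply/seteqP; split=> [_ [A UA <-] i j ij|A UA].
  by rewrite mxconj_perm mxE UA // inj_eq //; exact: perm_inj.
exists (mxconj (invmx (perm_mx s)) A); last by rewrite mxconjVK.
move=> i j ij; have := UA ((s^-1)%g i) ((s^-1)%g j); rewrite /= !permKV => /(_ ij).
rewrite -{1}(mxconjVK us A) mxconj_perm mxE !permKV => ->.
by rewrite inj_eq //; exact: perm_inj.
Qed.

End PermutationConjugation.

Section Coords.
Context (n : nat) (lam : nat -> nat) (row off : 'I_n -> nat).
Hypothesis C : coords lam row off.

Lemma coords_card i : #|[pred a | row a == i]| = lam i.
Proof.
have offlt (a : {a | row a == i}) : (off (val a) < lam i)%N.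
  by have := coords_lt C (val a); rewrite (eqP (valP a)).
rewrite -[RHS]card_ord -card_sig.
apply: (@bij_eq_card _ _ (fun a => Ordinal (offlt a))).
apply: inj_card_bij => [a b [ab]|].
  by apply: val_inj; apply: (coords_inj C) => //; rewrite (eqP (valP a)) (eqP (valP b)).
have P (r : 'I_(lam i)) : exists a : {a | row a == i}, off (val a) = r.
  have [a ra oa] := coords_surj C (ltn_ord r).
  by exists (exist (fun a => row a == i) a (introT eqP ra)).
pose g r := projT1 (cid (P r)).
apply: (@leq_card _ _ g) => r r' gr.
apply: val_inj; rewrite /= -(projT2 (cid (P r))) -(projT2 (cid (P r'))).
by rewrite -/(g r) -/(g r') gr.
Qed.

Lemma coords_card_lt k : #|[pred a | (row a < k)%N]| = (\sum_(i < k) lam i)%N.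
Proof.
elim: k => [|k IH]; first by rewrite big_ord0 eq_card0.
rewrite big_ord_recr /= -IH -(coords_card k) -cardUI [X in (_ + X)%N]eq_card0 ?addn0.
  by apply: eq_card => a; rewrite !inE ltnS leq_eqVlt orbC.
by move=> a; rewrite !inE; case: ltngtP.
Qed.

End Coords.

Section Relabel.
Local Open Scope nat_scope.

Lemma perm_of_counts n (U : eqType) (f g : 'I_n -> U) :
  (forall u, #|[pred x | f x == u]| = #|[pred y | g y == u]|) ->
  exists s : 'S_n, forall x, g (s x) = f x.
Proof.
move=> cfg.
have cnt (k : 'I_n -> U) u : count_mem u [tuple k i | i < n] = #|[pred x | k x == u]|.
  rewrite count_map cardE /enum_mem -enumT size_filter.
  by apply: eq_count => x; rewrite /= inE.
have /tuple_permP[s sE] : perm_eq [tuple f i | i < n] [tuple g i | i < n].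
  by apply/allP => u _ /=; rewrite !cnt cfg.
exists s => x; have := congr1 (fun t => nth (f x) t x) sE.
by rewrite -!tnth_nth !tnth_mktuple => ->.
Qed.

(** The labels are sorted by decreasing class size, which separates the partition [sh] of block
    sizes from the order [tau] in which the blocks occur. *)
Lemma relabel n (be : 'I_n -> nat) : exists sh (tau : nat -> nat) (s : 'S_n),
  [/\ sorted geq sh, 0 \notin sh, sumn sh = n,
      {in gtn (size sh) &, injective tau} &
      forall a, be a = tau (reshape_index sh (s a))].
Proof.
pose sz u := #|[pred a | be a == u]|.
pose vals := sort (fun u v => sz v <= sz u) (undup [seq be a | a <- enum 'I_n]).
have uv : uniq vals by rewrite sort_uniq undup_uniq.
have mv a : be a \in vals by rewrite mem_sort mem_undup map_f ?mem_enum.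
have sumE : sumn [seq sz u | u <- vals] = n.
  rewrite sumnE big_map (eq_bigr (fun u => \sum_a (be a == u))).
    rewrite exchange_big /= -[RHS]card_ord -sum1_card; apply: eq_bigr => a _.
    transitivity (count_mem (be a) vals).
      rewrite -sum1_count [RHS]big_mkcond; apply: eq_bigr => u _ /=.
      by rewrite eq_sym; case: eqP.
    by rewrite count_uniq_mem ?mv.
  by move=> u _; rewrite /sz -sum1_card big_mkcond; apply: eq_bigr => a _; rewrite inE; case: eqP.
pose sh := [seq sz u | u <- vals].
have C := coords_reshape sumE.
have ssh : size sh = size vals by rewrite size_map.
have ri (a : 'I_n) : reshape_index sh a < size vals.
  by rewrite -ssh; apply: reshape_indexP; rewrite sumE.
have [u|s sE] := @perm_of_counts n _ be (fun a => nth 0 vals (reshape_index sh a)).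
  have [uvals|uvals] := boolP (u \in vals); last first.
    rewrite !eq_card0 // => a; rewrite !inE; apply: contraNF uvals => /eqP <-.
      by rewrite mem_nth.
    exact: mv.
  have iu : index u vals < size vals by rewrite index_mem.
  have := coords_card C (index u vals); rewrite (nth_map 0) // nth_index // /sz => <-.
  apply: eq_card => a; rewrite !inE; apply/eqP/eqP => [->|<-]; first by rewrite nth_index.
  by rewrite index_uniq.
exists sh, (nth 0 vals), s; split=> //.
- rewrite sorted_map; apply: sort_sorted => x y /=; exact: leq_total.
- apply/negP => /mapP[u]; rewrite mem_sort mem_undup => /mapP[a _ ->].
  by rewrite /sz (cardD1 a) inE eqxx.
by move=> i j; rewrite !inE ssh => ilts jlts /eqP; rewrite nth_uniq // => /eqP.
Qed.

End Relabel.

Section TwistedChain.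
Context (F : numClosedFieldType) (n : nat).
Context (lam : nat -> nat) (row off : 'I_n -> nat) (tau : nat -> nat).
Hypothesis C : coords lam row off.
Hypothesis lam_noninc : forall i j, (i <= j)%N -> (lam j <= lam i)%N.
Hypothesis tau_inj : forall a b, tau (row a) = tau (row b) -> row a = row b.

(** The new row of the box [a]: its position, in the order given by [tau], among the boxes of the
    same offset. *)
Let rk a := #|[pred c | (off c == off a) && (tau (row c) < tau (row a))%N]|.

(** Otherwise all boxes with the offset of [a] would have a row below [rk a], so there would be at
    most [rk a] of them; but [rk a] of them precede [a] itself. *)
Let rk_lt a : (off a < lam (rk a))%N.
Proof.
rewrite ltnNge; apply/negP => le.
have bnd c : off c = off a -> (row c < rk a)%N.
  move=> oc; rewrite ltnNge; apply/negP => rc.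
  have := coords_lt C c; rewrite oc ltnNge => /negP; apply.
  exact: leq_trans (lam_noninc rc) le.
have : (#|[pred c | off c == off a]| <= rk a)%N.
  rewrite -[leqRHS]card_ord -card_sig.
  have b' (c : {c | off c == off a}) : (row (val c) < rk a)%N by apply: bnd; apply/eqP/(valP c).
  apply: (@leq_card _ _ (fun c => Ordinal (b' c))) => c d [cd].
  by apply: val_inj; apply: (coords_inj C) => //; rewrite (eqP (valP c)) (eqP (valP d)).
rewrite leqNgt => /negP; apply.
apply: proper_card; apply/properP; split.
  by apply/fintype.subsetP => c; rewrite !inE => /andP[].
by exists a; rewrite !inE ?eqxx // ltnn.
Qed.

Let rk_mono a b : off a = off b -> (tau (row a) < tau (row b))%N -> (rk a < rk b)%N.
Proof.
move=> oab tab; apply: proper_card; apply/properP; split.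
  by apply/fintype.subsetP => c; rewrite !inE oab => /andP[-> /=] /ltn_trans; apply.
by exists a; rewrite !inE oab eqxx //= ltnn.
Qed.

(** With the blocks in the order [tau], the chain matrix may leave the nilradical; sorting each
    chain by [tau] brings a conjugate back. As [v] fixes offsets, diagonal matrices constant along
    chains commute with the new matrix too. *)
Lemma chain_twist : exists v : 'S_n, (forall a, off (v a) = off a) /\ ulie (tau \o row) (mxconj
  (perm_mx v) (chain_mx F row off)).
Proof.
have P a : exists b, row b = rk a /\ off b = off a.
  by have [b ? ?] := coords_surj C (rk_lt a); exists b.
pose v a := projT1 (cid (P a)).
have vr a : row (v a) = rk a by case: (projT2 (cid (P a))).
have vo a : off (v a) = off a by case: (projT2 (cid (P a))).
have v_inj : injective v.
  move=> a b vab.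
  have oab : off a = off b by rewrite -vo vab vo.
  have rab : rk a = rk b by rewrite -vr vab vr.
  apply: (coords_inj C) => //; apply: tau_inj.
  have [ab|ab|//] := ltngtP (tau (row a)) (tau (row b)).
    by have := rk_mono oab ab; rewrite rab ltnn.
  by have := rk_mono (esym oab) ab; rewrite rab ltnn.
exists (perm v_inj); split=> [a|a b /= ab]; first by rewrite permE.
rewrite mxconj_perm !mxE !permE !vr !vo.
case: eqP => //= rab; case: eqP => //= oab.
suff : (rk a <= rk b)%N by rewrite rab ltnn.
apply: subset_leq_card; apply/fintype.subsetP => c; rewrite !inE oab => /andP[-> /=].
by move=> h; apply: leq_trans h ab.
Qed.

End TwistedChain.

Lemma mxconj_perm_tr (F : numClosedFieldType) n (s : 'S_n) (A : 'M[F]_n) :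
  (mxconj (perm_mx s) A)^T = mxconj (perm_mx s) A^T.
Proof. by rewrite !mxconj_perm; apply/matrixP => i j; rewrite !mxE. Qed.

Lemma card_preim_perm n (s : 'S_n) (P : pred 'I_n) :
  #|[pred a | P (s a)]| = #|P|.
Proof. by rewrite -!sum1_card [RHS](reindex_inj (@perm_inj _ s)). Qed.

(** * Coordinate flags and their stabilizers *)

Section BlockFlags.
Context (F : numClosedFieldType) (n : nat).
Implicit Types (X : 'M[F]_n) (be : 'I_n -> nat).

Definition bflag be (i : nat) : 'M[F]_n := cmx (fun a => be a < i)%N.

Lemma bflag_rank be i : \rank (bflag be i) = #|[pred a | (be a < i)%N]|.
Proof. exact: cmx_rank. Qed.

Lemma bflagP be i (A : 'M[F]_n) :
  (A <= bflag be i)%MS <-> forall a b, (i <= be b)%N -> A a b = 0.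
Proof.
split=> [/submxP[B ->] a b ib|H].
  by rewrite mul_mx_diag mxE [(\row_ _ _) _ _]mxE ltnNge ib mulr0.
suff -> : A = A *m bflag be i by apply: submxMl.
apply/matrixP => a b; rewrite mul_mx_diag mxE [(\row_ _ _) _ _]mxE.
by case: ltnP => [_|/H ->]; rewrite ?mulr1 ?mul0r.
Qed.

Lemma bflag_mulE be i (A : 'M[F]_n) a b :
  (bflag be i *m A) a b = (be a < i)%N%:R * A a b.
Proof. by rewrite mul_diag_mx mxE [(\row_ _ _) _ _]mxE. Qed.

Lemma flag_bflag be X s : ulie be X -> flag X s (bflag be).
Proof.
move=> uX; split=> [|i _].
  by rewrite bflag_rank eq_card0 // => a; rewrite !inE.
split; apply/bflagP => a b ib.
  rewrite cmxE; case: eqP => [->|]; rewrite ?andbF ?andbT //.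
  by rewrite ltnNge (leq_trans (leqnSn i) ib).
rewrite bflag_mulE ltnS; have [ai|ai] := leqP (be a) i; last by rewrite mul0r.
by rewrite uX ?mulr0 // (leq_trans ai).
Qed.

Lemma bflag_gap be i : gap (bflag be) i = #|[pred a | be a == i]|.
Proof.
rewrite /gap !bflag_rank.
have -> : #|[pred a | (be a < i.+1)%N]| = (#|[pred a | (be a < i)%N]| + #|[pred a | be a ==
  i]|)%N.
  rewrite -cardUI [X in (_ + X)%N]eq_card0 ?addn0.
    by apply: eq_card => a; rewrite !inE ltnS leq_eqVlt orbC.
  by move=> a; rewrite !inE; case: ltngtP.
by rewrite addKn.
Qed.

Lemma isum_bflag be s (I : nat -> bool) : (forall a, be a < s)%N ->
  isum s I (gap (bflag be)) = #|[pred a | I (be a)]|.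
Proof.
move=> bs; rewrite /isum (eq_bigr (fun i : 'I_s => \sum_a (I i && (be a == i)))%N).
  rewrite exchange_big /= -sum1_card [RHS]big_mkcond; apply: eq_bigr => a _.
  rewrite (bigD1 (Ordinal (bs a))) //= eqxx andbT big1 ?addn0 ?inE; first by case: (I _).
  move=> i ia; case: eqP => [e|]; last by rewrite andbF.
  by case/eqP: ia; apply: val_inj.
move=> i _; rewrite bflag_gap -sum1_card big_distrr /= [LHS]big_mkcond; apply: eq_bigr => a _.
by rewrite inE muln1; case: eqP => _; rewrite ?andbT ?andbF.
Qed.

Lemma bflag_full be s : (forall a, be a < s)%N -> bflag be s = 1%:M.
Proof. by move=> bs; apply/matrixP => a b; rewrite cmxE bs mxE. Qed.

Lemma ord_bound be : forall a, (be a < (\sum_i be i).+1)%N.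
Proof. by move=> a; rewrite (bigD1 a) //= ltnS leq_addr. Qed.

(* An element of [ulie be] of this rank profile determines the flag. *)
Definition tight be X := forall I : nat -> bool,
  top_set (\sum_i be i).+1 I (gap (bflag be)) ->
  (n <= #|[pred a | I (be a)]| + \rank (X ^+ isize (\sum_i be i).+1 I))%N.

(** The coordinate flag and its translate by [u] are both lowered by [X] and have the same gaps, so
    they coincide by uniqueness, and [u] preserves the coordinate flag. *)
Lemma tight_stabilizer be X Y u : ulie be X -> ulie be Y -> tight be X ->
  u \in unitmx -> mxconj u X = Y -> supported (lowR be) u.
Proof.
move=> uX uY tX uu /(mxconj_eq _ _ uu) uXY a b; rewrite /lowR -ltnNge => ab.
set s := (\sum_i be i).+1.
have bs := ord_bound be; rewrite -/s in bs.
pose G' i := bflag be i *m u.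
have rG' i : \rank (G' i) = \rank (bflag be i) by rewrite mxrankMfree // row_free_unit.
have fG := flag_bflag s uX.
have fG' : flag X s G'.
  have [G0 fY] := flag_bflag s uY.
  split=> [|i ilts]; first by rewrite rG'.
  have [f1 f2] := fY i ilts; split; first exact: submxMr.
  by rewrite -mulmxA uXY mulmxA submxMr.
have tG : flag_tight X s (bflag be).
  move=> I tI; rewrite isum_bflag // bflag_full // mul1mx mxrank1; exact: tX.
have full : (bflag be s :=: G' s)%MS.
  rewrite /G' bflag_full // mul1mx; apply/eqmxP; rewrite submx1 andbT.
  by rewrite -[X in (X <= _)%MS](mulVmx uu) submxMl.
have := flag_unique fG fG' tG (fun i _ => esym (rG' i)) full (bs a) => /eqmxP/andP[_ /bflagP].
by move=> /(_ a b ab); rewrite /G' bflag_mulE ltnSn mul1r.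
Qed.

Lemma ulie_rank_bound be X (J : nat -> bool) b : ulie be X ->
  (isize (\sum_i be i).+1 J <= b)%N ->
  (#|[pred a | J (be a)]| + \rank (X ^+ b) <= n)%N.
Proof.
move=> uX Jb; set s := (\sum_i be i).+1 in Jb *.
have bs := ord_bound be; rewrite -/s in bs.
have := flag_rank_bound J (flag_bflag s uX).
rewrite isum_bflag // bflag_full // mul1mx mxrank1; apply: leq_trans.
rewrite leq_add2l -(subnKC Jb) exprD mxrankM_maxl //.
Qed.

End BlockFlags.

Section Twist.
Context (F : numClosedFieldType) (n : nat).
Context (lam : nat -> nat) (row off : 'I_n -> nat) (tau : nat -> nat).
Hypothesis C : coords lam row off.
Hypothesis lam_noninc : forall i j, (i <= j)%N -> (lam j <= lam i)%N.
Hypothesis tau_inj : forall a b, tau (row a) = tau (row b) -> row a = row b.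
Local Notation be := (tau \o row).
Local Notation s := (\sum_i be i).+1.

(** The labels of the [b] largest blocks. There may be fewer than [b] nonempty blocks, so that the
    size of this set is only bounded by [b]. *)
Let J b v := [exists a, (be a == v) && (row a < b)%N].

Let JE b a : J b (be a) = (row a < b)%N.
Proof.
apply/existsP/idP => [[c /andP[/eqP/tau_inj -> //]]|h].
by exists a; rewrite eqxx.
Qed.

Let J_size b : (isize s (J b) <= b)%N.
Proof.
rewrite /isize -(big_mkord xpredT (fun i => J b i : nat)) /=.
have -> : (\sum_(0 <= i < s) J b i)%N = size [seq i <- index_iota 0 s | J b i].
  by rewrite size_filter -sum1_count [RHS]big_mkcond; apply: eq_bigr => i _; case: (J b i).
rewrite -[leqRHS](size_iota 0) -(size_map tau).
apply: uniq_leq_size; first by rewrite filter_uniq ?iota_uniq.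
move=> i; rewrite mem_filter => /andP[/existsP[a /andP[/eqP <- ab]] _].
by apply: map_f; rewrite mem_iota.
Qed.

Lemma twist_rank_bound (X : 'M[F]_n) b : ulie be X ->
  (#|[pred a | (row a < b)%N]| + \rank (X ^+ b) <= n)%N.
Proof.
move=> uX; have := ulie_rank_bound uX (J_size b).
by rewrite (eq_card (B := [pred a | (row a < b)%N])) // => a; rewrite !inE JE.
Qed.

Lemma card_row_split b :
  (#|[pred a | (row a < b)%N]| + #|[pred a | (b <= row a)%N]| = n)%N.
Proof.
rewrite -[RHS]card_ord -(cardC [pred a | (row a < b)%N]); congr (_ + _)%N.
by apply: eq_card => a; rewrite !inE -leqNgt.
Qed.

(** The hypothesis is equality for the labels of the largest blocks. A set of largest gaps of the
    same size covers at least as many coordinates. *)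
Lemma twist_tight (X : 'M[F]_n) :
  (forall b, \rank (X ^+ b) = #|[pred a | (b <= row a)%N]|) -> tight be X.
Proof.
move=> rX I tI; rewrite rX -[leqLHS](card_row_split (isize s I)) leq_add2r.
have := top_set_max tI (J_size (isize s I)).
rewrite !isum_bflag; try exact: ord_bound.
by rewrite (eq_card (B := [pred a | (row a < isize s I)%N])) // => a; rewrite !inE JE.
Qed.

End Twist.

(** * The base nilpotent and its parabolic *)

Section Partition.
Context (F : numClosedFieldType) (n : nat) (p : seq nat).
Hypothesis hp : is_partition n p.
Local Notation lam := (nth 0%N (transpose_part p)).
Local Notation row := (fun a : 'I_n => reshape_index (transpose_part p) a).
Local Notation off := (fun a : 'I_n => reshape_offset (transpose_part p) a).
Local Notation e := (base_nilpotent F n p).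

Lemma part_sorted : sorted geq p. Proof. by case/and3P: hp. Qed.
Lemma part_sumn : sumn p = n. Proof. by case/and3P: hp => _ _ /eqP. Qed.
Lemma part_coords : coords lam row off.
Proof. by apply: coords_reshape; rewrite sumn_transpose ?part_sumn ?part_sorted. Qed.

Lemma sorted_nth_noninc sh : sorted geq sh ->
  forall i j, (i <= j)%N -> (nth 0%N sh j <= nth 0%N sh i)%N.
Proof.
move=> ss i j ij; have [js|js] := ltnP j (size sh); last by rewrite nth_default.
have := @sorted_leq_nth _ geq _ _ 0%N sh ss; apply=> //.
- by move=> x y z /= h1 h2; apply: leq_trans h2 h1.
- by move=> x /=.
by rewrite inE (leq_ltn_trans ij).
Qed.

Lemma part_noninc : forall i j, (i <= j)%N -> (lam j <= lam i)%N.
Proof. exact/sorted_nth_noninc/transpose_sorted. Qed.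

Lemma base_chain : e = chain_mx F row off. Proof. by []. Qed.

Lemma base_orbit : nilpotent_orbit p e.
Proof.
have C := part_coords.
(* The ones of [jordan_nilpotent] lie above the diagonal and those of [base_nilpotent] below it, so
   positions in a Jordan block are counted backwards along the chain. *)
pose h (a : 'I_n) := (nth 0%N p (off a) - (row a).+1)%N.
have ra (a : 'I_n) : (row a < nth 0%N p (off a))%N.
  by rewrite -transpose_gt ?part_sorted //; exact: (coords_lt C).
have ha (a : 'I_n) : (h a < nth 0%N p (off a))%N by have := ra a; rewrite /h; lia.
have un (a : 'I_n) : (flatten_index p (off a) (h a) < n)%N.
  by have := flatten_indexP (ha a); rewrite part_sumn.
pose u a := Ordinal (un a).
have ui a : reshape_index p (u a) = off a by apply: flatten_indexKl.
have uo a : reshape_offset p (u a) = h a by apply: flatten_indexKr.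
have u_inj : injective u.
  move=> a b uab; have oab : off a = off b by rewrite -ui uab ui.
  apply: (coords_inj C) => //=.
  have : h a = h b by rewrite -uo uab uo.
  by have := ra a; have := ra b; rewrite /h oab; lia.
exists (perm_mx (perm u_inj)); first exact: perm_mx_unit.
rewrite mxconj_perm; apply/matrixP => a b; rewrite !mxE !permE !ui andbC.
case: eqP => //= oab; congr (_%:R); congr nat_of_bool.
rewrite /flatten_index oab -addnS eqn_add2l.
have := ra a; have := ra b; rewrite /h oab => h1 h2.
by apply/eqP/eqP; lia.
Qed.

Lemma orbit_rank (X : 'M[F]_n) b : nilpotent_orbit p X ->
  \rank (X ^+ b) = #|[pred a | (b <= row a)%N]| :> nat.
Proof.
move=> [g ug ->]; have [h uh eE] := base_orbit.
have rc k (A : 'M[F]_n) : k \in unitmx -> \rank (mxconj k A) = \rank A.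
  move=> uk; rewrite /mxconj mxrankMfree ?row_free_unit ?unitmx_inv //.
  by rewrite -mxrank_tr trmx_mul mxrankMfree ?mxrank_tr // row_free_unit unitmx_tr.
rewrite -(chain_mx_rank F part_coords part_noninc) -base_chain eE.
by rewrite -!mxconj_exp // !rc.
Qed.

(* Lower semicontinuity of the rank, through one determinant. *)
Lemma richardson_shape sh (tau : nat -> nat) :
  sorted geq sh -> 0%N \notin sh -> sumn sh = n ->
  {in gtn (size sh) &, injective tau} ->
  (@ulie F n (fun a => tau (reshape_index sh a)) `<=`
     closure (nilpotent_orbit p `&` ulie (fun a => tau (reshape_index sh a))
              : set (zariski F n))) ->
  sh = transpose_part p.
Proof.
move=> ssh sh0 sumsh tinj dense.
have C := coords_reshape sumsh; have noninc := sorted_nth_noninc ssh.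
set r := fun a : 'I_n => reshape_index sh a in C.
have ti a b : tau (r a) = tau (r b) -> r a = r b.
  by apply: tinj; rewrite inE; apply: reshape_indexP; rewrite sumsh.
have [v [vo uv]] := chain_twist F C noninc ti.
set E := mxconj _ _ in uv.
have cardE k : #|[pred a | (r a < k)%N]| = #|[pred a : 'I_n | (row a < k)%N]|.
  (* [D] fills the coordinates where the projector attached to [E ^+ k] vanishes, so [f E] is 1.
     Conversely, [f X != 0] bounds the rank of [X ^+ k] below by the number of boxes in rows from
     [k] on. *)
  pose D := cmx (fun a => r (v a) < k)%N : 'M[F]_n.
  pose f (X : 'M[F]_n) := \det (X ^+ k *m (E ^+ k)^T + D).
  have [f' f'E] : regular f.
    apply: (fa_det (regular_alg F n)); apply: (fa_addmx (regular_alg F n)).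
      apply: (fa_mulmx (regular_alg F n)); last exact: (fa_cst (regular_alg F n)).
      by apply: (fa_expmx (regular_alg F n)); exact: regular_id.
    exact: (fa_cst (regular_alg F n)).
  have fE : f E = 1.
    rewrite /f -[RHS](det1 F n); congr (\det _).
    rewrite /E -mxconj_exp ?perm_mx_unit // mxconj_perm_tr -mxconjM ?perm_mx_unit //.
    rewrite (chain_mx_expT F C noninc) mxconj_perm; apply/matrixP => a b.
    rewrite mxE [X in X + _]mxE !cmxE [RHS]mxE (inj_eq (@perm_inj _ v)) leqNgt.
    by case: (r (v a) < k)%N; rewrite ?add0r ?addr0.
  have [X [[OX uX] fX]] : exists X, (nilpotent_orbit p `&` ulie (tau \o r)) X /\ f X != 0.
    apply: contrapT => nE; have /zclosureP/(_ f') := dense E uv.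
    rewrite -f'E fE => H; have := oner_neq0 F; rewrite H ?eqxx // => A OA.
    by apply/eqP/negPn/negP; rewrite -f'E => fA; apply: nE; exists A.
  have := twist_rank_bound ti k uX; have := @card_row_split n row k.
  rewrite (orbit_rank _ OX).
  have : (n <= \rank (X ^+ k) + #|[pred a | (r a < k)%N]|)%N.
    have /mxrank_unit rk : X ^+ k *m (E ^+ k)^T + D \in unitmx by rewrite unitmxE unitfE.
    rewrite -[leqLHS]rk; apply: leq_trans (mxrank_add _ _) _; apply: leq_add;
      first exact: mxrankM_maxl.
    rewrite cmx_rank -[leqRHS](card_preim_perm v).
    by apply: subset_leq_card; apply/fintype.subsetP => a; rewrite !inE.
  by rewrite (orbit_rank _ OX); lia.
have nthE i : nth 0%N sh i = lam i.
  have := cardE i.+1; rewrite (coords_card_lt C) (coords_card_lt part_coords) !big_ord_recr /=.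
  by rewrite -(coords_card_lt C) -(coords_card_lt part_coords) cardE => /addnI.
have pos (t t' : seq nat) : 0%N \notin t -> (forall i, nth 0%N t i = nth 0%N t' i) ->
    (size t <= size t')%N.
  move=> t0 tt'; rewrite leqNgt; apply/negP => st; move/negP: t0; apply.
  by have := mem_nth 0%N st; rewrite tt' nth_default.
apply: (@eq_from_nth _ 0%N) => [|i _]; last exact: nthE.
apply/eqP; rewrite eqn_leq !pos //; first exact/transpose_notin0/part_sorted.
Qed.

End Partition.

(** * Normal form of Richardson parabolics *)

Section NormalForm.
Context (F : numClosedFieldType) (n : nat) (p : seq nat).
Hypothesis hp : is_partition n p.
Local Notation lam := (nth 0%N (transpose_part p)).
Local Notation row := (fun a : 'I_n => reshape_index (transpose_part p) a).
Local Notation off := (fun a : 'I_n => reshape_offset (transpose_part p) a).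
Local Notation e := (base_nilpotent F n p).

Lemma eq_blockL (be be' : 'I_n -> nat) : (forall a b, (be a == be b) = (be' a == be' b)) ->
  @blockL F n be = blockL be'.
Proof.
move=> E; apply/seteqP; split=> A [sA lA]; split=> // i j; rewrite /eqR.
  by rewrite -E; apply: lA.
by rewrite E; apply: lA.
Qed.

(** The permutation sorting the blocks is absorbed into a conjugator of determinant 1, and density
    forces the sorted sizes to be the transpose of [p]. Only the order [tau] of the blocks remains
    free. *)
Lemma richardson_normal_form (P L U : set 'M[F]_n) : richardson p P L U ->
  exists (tau : nat -> nat) g,
  [/\ SLn g, forall a b, tau (row a) = tau (row b) -> row a = row b,
      P = mxconj g @` blockP (tau \o row),
      L = mxconj g @` block_levi p
    & U = mxconj g @` blockU (tau \o row)].
Proof.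
move=> rPLU; have [be [g [sg PE LE UE]]] := richardson_form rPLU.
have [sh [tau [s [ssh sh0 sumsh tinj beE]]]] := relabel be.
pose r := fun a : 'I_n => reshape_index sh a.
have beE' : be = (tau \o r) \o s by apply/funext.
have ug := SLn_unit sg; have us := perm_mx_unit F s.
have [h sh' hE] : exists2 h, SLn h & mxconj h = mxconj (g *m perm_mx s).
  by apply: unit_SLn_conj; rewrite unitmx_mul ug.
have uh := SLn_unit sh'.
rewrite beE' -blockP_perm -blockL_perm -blockU_perm !image_mxconj_comp // in PE LE UE.
rewrite -hE in PE LE UE.
have := richardson_conj (SLnV sh') rPLU.
rewrite PE LE UE !image_mxconjK // => -[_ _]; rewrite lie_algebra_U => dense.
have shE := richardson_shape hp ssh sh0 sumsh tinj dense.
have ti a b : tau (r a) = tau (r b) -> r a = r b.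
  by apply: tinj; rewrite inE; apply: reshape_indexP; rewrite sumsh.
rewrite -shE; exists tau, h; split=> //.
congr image; rewrite /block_levi -shE -[RHS]/(blockL r).
apply: eq_blockL => a b /=; apply/eqP/eqP => [/ti //|-> //].
Qed.

End NormalForm.

(** * Density of the orbit in the nilradical *)

Section Density.
Context (F : numClosedFieldType) (n : nat) (p : seq nat).
Hypothesis hp : is_partition n p.
Local Notation lam := (nth 0%N (transpose_part p)).
Local Notation row := (fun a : 'I_n => reshape_index (transpose_part p) a).
Local Notation off := (fun a : 'I_n => reshape_offset (transpose_part p) a).
Local Notation e := (base_nilpotent F n p).
Implicit Types (A N X Y : 'M[F]_n).

Let T := (\sum_(a : 'I_n) row a).+1.
(** The projector onto the last boxes of the chains, which [e] kills. *)
Let c : 'M[F]_n := 1%:M - e^T *m e.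

Let ulie_e : ulie row e.
Proof. exact: chain_mx_ulie. Qed.

Let eT : e ^+ T = 0.
Proof. exact: ulie_nilpotent ulie_e. Qed.

Let eeT : e *m e^T = cmx (fun a => 0 < row a)%N.
Proof. by have := chain_mx_expT F (part_coords hp) (part_noninc p) 1; rewrite expr1. Qed.

Let cmx_ulie A : ulie row A -> cmx (fun a => 0 < row a)%N *m A = A.
Proof.
move=> uA; rewrite mul_diag_mx; apply/matrixP => a b; rewrite mxE [(\row_ _ _) _ _]mxE.
by case: ltnP => [_|]; rewrite ?mul1r // leqn0 => /eqP ra; rewrite uA ?mulr0 // ra.
Qed.

Let ec : e *m c = 0.
Proof. by rewrite mulmxBr mulmx1 mulmxA eeT cmx_ulie ?subrr. Qed.

(** Block triangularity up to [m] block diagonals on the wrong side. In each term of the intertwiner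
    the powers of the transpose of [e] cost [m] and [e ^+ m] gains them back. *)
Let shift m A := forall i j, (row i + m < row j)%N -> A i j = 0.

Let shiftM m k A B : shift m A -> shift k B -> shift (m + k) (A *m B).
Proof.
move=> sA sB i j ij; rewrite mxE big1 // => l _.
have [il|il] := ltnP (row i + m) (row l); first by rewrite sA ?mul0r.
by rewrite sB ?mulr0 //; apply: leq_ltn_trans ij; rewrite addnA leq_add2r.
Qed.

Let shift_low A : supported (lowR row) A <-> shift 0 A.
Proof.
split=> sA i j ij; apply: sA; rewrite /lowR -?ltnNge; first by rewrite addn0 in ij.
by rewrite addn0 ltnNge.
Qed.

Let shift_exp m A k : shift m A -> shift (m * k) (A ^+ k).
Proof.
move=> sA; elim: k => [|k IH]; last by rewrite exprS mulnS; apply: shiftM.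
by rewrite muln0; apply/shift_low; apply: supported_scalar; exact: lowR_refl.
Qed.

Let shift_eT : shift 1 e^T.
Proof.
move=> i j ij; rewrite !mxE; case: eqP => // rj; move: ij; rewrite rj addn1 ltnn //.
Qed.

Let shift_e_exp m A k : shift (m + k) A -> shift m (A *m e ^+ k).
Proof.
move=> sA i j ij; rewrite mxE big1 // => l _.
rewrite (chain_mx_exp F (part_coords hp) (part_noninc p)).
case: eqP => [rl|]; last by rewrite mulr0.
by rewrite sA ?mul0r // rl addnA ltn_add2r.
Qed.

Let low_eTe N : ulie row N -> supported (lowR row) (e^T *m N).
Proof.
move=> uN; apply/shift_low => i j ij; rewrite mxE big1 // => l _.
rewrite !mxE; case: eqP => [rl|]; last by rewrite mul0r.
by rewrite uN ?mulr0 // rl; move: ij; rewrite addn0.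
Qed.

Let low_c : supported (lowR row) c.
Proof.
move=> i j nR; rewrite mxE (supported_scalar 1 (lowR_refl row)) // add0r mxE low_eTe ?oppr0 //.
Qed.

(* Solves [(e + N) a = a e] with [a] block triangular, starting from
   [a = 1 + e^T (a e - N a)] up to the correction [c]. *)
Let intertwiner M : 'M[F]_n := \sum_(m < T) (M *m e^T) ^+ m *m M *m c *m e ^+ m.

Let intertwinerP N : ulie row N -> 1%:M + e^T *m N \in unitmx ->
  let a := intertwiner (invmx (1%:M + e^T *m N)) in (e + N) *m a = a *m e.
Proof.
move=> uN uB; set B := 1%:M + _ in uB *; set M := invmx B => /=; set a := intertwiner M.
have lB : supported (lowR row) B.
  by apply: supportedD; [exact: (supported_scalar 1 (lowR_refl row))|exact: low_eTe].
have lM : supported (lowR row) M.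
  by apply: supportedV => //; [exact: lowR_refl|exact: lowR_trans].
have la : supported (lowR row) a.
  apply/shift_low => i j ij; rewrite summxE big1 // => m _.
  apply: (@shift_e_exp 0) ij; rewrite add0n.
  rewrite -[X in shift X](addn0 m) -[X in shift (X + 0)](addn0 m).
  apply: shiftM; last exact/shift_low.
  apply: shiftM; last exact/shift_low.
  rewrite -[X in shift X]mul1n; apply: shift_exp.
  by rewrite -[X in shift X]add0n; apply: shiftM => //; exact/shift_low.
(* The defining series solves this fixed-point equation; the term beyond the range of summation
   contains [e ^+ T], which is zero. *)
have aE : a = M *m e^T *m a *m e + M *m c.
  have -> : M *m e^T *m a *m e = \sum_(m < T) (M *m e^T) ^+ m.+1 *m M *m c *m e ^+ m.+1.
    rewrite /a /intertwiner mulmx_sumr mulmx_suml; apply: eq_bigr => m _.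
    by rewrite exprS exprSr !mulmxA.
  rewrite /a /intertwiner /T big_ord_recl [X in _ + _ = X + _]big_ord_recr /= eT mulmx0 addr0.
  by rewrite !expr0 mulmx1 mul1mx addrC.
have BE : B *m a = e^T *m a *m e + c.
  by rewrite {1}aE mulmxDr !mulmxA mulmxV // !mul1mx.
(* Multiplication by [e] removes the correction [c], and the projector obtained from [e] and its
   transpose acts as the identity on [N] and on [a *m e], both in [ulie]. *)
have := congr1 (mulmx e) BE; rewrite mulmxDr ec addr0 !mulmxA eeT.
rewrite -[cmx _ *m a *m e]mulmxA cmx_ulie; last exact: ulie_mull.
move=> <-; rewrite mulmxDr mulmx1 mulmxA eeT cmx_ulie //.
Qed.

Let intertwiner1 : intertwiner 1%:M = 1%:M.
Proof.
rewrite /intertwiner.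
rewrite (eq_bigr (fun m : 'I_T => e^T ^+ m *m e ^+ m - e^T ^+ m.+1 *m e ^+ m.+1)); last first.
  move=> m _; rewrite !mul1mx mulmx1 mulmxBr mulmx1 mulmxBl; congr (_ - _).
  by rewrite exprSr exprS !mulmxA.
rewrite -(big_mkord xpredT (fun m => e^T ^+ m *m e ^+ m - e^T ^+ m.+1 *m e ^+ m.+1)).
pose g m := - (e^T ^+ m *m e ^+ m).
rewrite (eq_bigr (fun m => g m.+1 - g m)); last by move=> m _; rewrite /g opprK addrC.
by rewrite telescope_sumr // /g eT mulmx0 oppr0 add0r opprK !expr0 mulmx1.
Qed.

(** On the line from [e] to [X], a point is conjugate to [e] whenever the intertwiner exists and is
    invertible. At [e] itself the intertwiner is the identity, so this holds at generic points, and
    a polynomial vanishing there vanishes at [X]. *)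
Lemma base_dense : ulie row `<=`
  closure (nilpotent_orbit p `&` ulie row : set (zariski F n)).
Proof.
move=> X uX; apply/zclosureP => f fO; pose Y := X - e.
have uY : ulie row Y by move=> i j ij; rewrite mxE [(- e) i j]mxE (ulie_e ij) uX ?subrr.
pose B t := 1%:M + t *: (e^T *m Y).
(* The intertwiner with denominators cleared, hence polynomial in [t]: its term [m] contains [m.+1]
   inverses of [B t], so the remaining power of the determinant is [T - m.+1]. *)
pose ah t : 'M[F]_n := \sum_(m < T) (\det (B t)) ^+ (T - m.+1) *:
   ((\adj (B t) *m e^T) ^+ m *m \adj (B t) *m c *m e ^+ m).
have pB : fa_mx (@polyfun F) B.
  apply: (fa_addmx (polyfun_alg F)); first exact: (fa_cst (polyfun_alg F)).
  apply: (fa_scalemx (polyfun_alg F)); first exact: polyfun_id.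
  exact: (fa_cst (polyfun_alg F)).
have pdB : polyfun (fun t => \det (B t)) by apply: (fa_det (polyfun_alg F)).
have pah : fa_mx (@polyfun F) ah.
  move=> i j; rewrite /ah.
  have -> : (fun x => (\sum_(m < T) (\det (B x)) ^+ (T - m.+1) *:
     ((\adj (B x) *m e^T) ^+ m *m \adj (B x) *m c *m e ^+ m)) i j) =
     (fun x => \sum_(m < T) (\det (B x) ^+ (T - m.+1) *:
     ((\adj (B x) *m e^T) ^+ m *m \adj (B x) *m c *m e ^+ m)) i j).
    by apply/funext => x; rewrite summxE.
  apply: (fa_sum (polyfun_alg F)) => m _.
  have padj := fa_adj (polyfun_alg F) pB.
  apply: (fa_scalemx (polyfun_alg F)); first exact: (fa_exp (polyfun_alg F)).
  do 2 (apply: (fa_mulmx (polyfun_alg F)); last exact: (fa_cst (polyfun_alg F))).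
  apply: (fa_mulmx (polyfun_alg F)) => //; apply: (fa_expmx (polyfun_alg F)).
  by apply: (fa_mulmx (polyfun_alg F)) => //; exact: (fa_cst (polyfun_alg F)).
have ahE t : \det (B t) != 0 -> ah t = (\det (B t)) ^+ T *: intertwiner (invmx (B t)).
  move=> dB; have uB : B t \in unitmx by rewrite unitmxE unitfE.
  have adjE : \adj (B t) = \det (B t) *: invmx (B t).
    by rewrite /invmx uB scalerA mulfV // scale1r.
  rewrite /ah /intertwiner scaler_sumr; apply: eq_bigr => m _.
  have expZ k (A : 'M[F]_n) l : (k *: A) ^+ l = k ^+ l *: A ^+ l.
    elim: l => [|l IH]; first by rewrite !expr0 scale1r.
    by rewrite !exprS IH -[_ * _]/(_ *m _) -scalemxAl -scalemxAr scalerA.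
  rewrite adjE -[(_ *: _) *m e^T]scalemxAl expZ -!scalemxAl -!scalemxAr -!scalemxAl !scalerA.
  congr (_ *: _).
  by rewrite -!exprD -exprSr; congr (_ ^+ _); have := ltn_ord m; lia.
have pdet : polyfun (fun t => \det (B t) * \det (ah t)).
  by apply: (fa_mul (polyfun_alg F)) => //; apply: (fa_det (polyfun_alg F)).
have B0 : B 0 = 1%:M by rewrite /B scale0r addr0.
have h0 : \det (B 0) * \det (ah 0) != 0.
  rewrite ahE B0 ?invmx1 ?intertwiner1 !det1 ?oner_neq0 //.
  by rewrite expr1n scale1r det1 mulr1 oner_neq0.
have XE : X = e + 1 *: Y by rewrite scale1r addrC subrK.
apply/eqP/negPn/negP; rewrite XE => fX.
have [t [/eqP ft]] := polyfun_nz (polyfun_line f e Y) pdet fX h0.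
rewrite mulf_eq0 negb_or => /andP[dB da]; apply: ft; apply: fO.
have uN : ulie row (t *: Y) by move=> i j ij; rewrite mxE uY ?mulr0.
split; last by move=> i j ij; rewrite mxE (ulie_e ij) uN ?addr0.
have BE : B t = 1%:M + e^T *m (t *: Y) by rewrite /B -scalemxAr.
have := intertwinerP uN; rewrite -BE unitmxE unitfE dB => /(_ isT) /=.
set a := intertwiner _ => aE.
have ua : a \in unitmx.
  by move: da; rewrite ahE // detZ mulf_eq0 negb_or unitmxE unitfE => /andP[].
have -> : e + t *: Y = mxconj a e by rewrite /mxconj -aE mulmxK.
by apply: nilpotent_orbit_conj => //; exact: base_orbit.
Qed.

Lemma borel_blockP : @borel F n `<=` blockP row.
Proof.
move=> A [sA tA]; split=> // i j; rewrite /lowR -ltnNge => ij.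
apply: (elimT is_trig_mxP tA); rewrite ltnNge; apply/negP => ji.
have := reshape_leq (transpose_part p) j i; rewrite ji => /esym/orP[].
  by move=> ji'; move: (ltn_trans ij ji'); rewrite ltnn.
by case/andP => /eqP e'; rewrite e' ltnn in ij.
Qed.

Lemma parabolic_row : @parabolic F n (blockP row).
Proof.
split; first exact: closed_subgroup_P.
exists 1%:M; first exact: SLn1.
by move=> _ [A BA <-]; rewrite mxconj1; apply: borel_blockP.
Qed.

Lemma richardson_row : @richardson F n p (blockP row) (block_levi p) (blockU row).
Proof.
split; [exact: parabolic_row|exact: levi_decomposition_P|].
rewrite lie_algebra_U; exact: base_dense.
Qed.

Lemma standard_block_levi : @standard_levi F n (block_levi p).
Proof.
split.
  move=> A [sA dA]; split=> // i j ij; apply: (is_diag_mxP dA).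
  by apply: contraNneq ij => /val_inj ->.
exists (blockP row), (blockU row); split.
- exact: parabolic_row.
- exact: borel_blockP.
- exact: levi_decomposition_P.
Qed.

End Density.

(** * Characters and the centralizer of the base nilpotent *)

Section TorusCharacters.
Context (F : numClosedFieldType) (n : nat) (R : rel 'I_n).
Hypotheses (rR : reflexive R) (tR : transitive R).
Local Notation GR := [set A : 'M[F]_n | SLn A /\ supported R A].
Implicit Types (A B : 'M[F]_n) (f g : 'M[F]_n -> F).

Definition multiplicative_on (S : set 'M[F]_n) f :=
  (forall A, S A -> f A != 0) /\ forall A B, S A -> S B -> f (A *m B) = f A * f B.

Lemma diag_mx_torus (t : 'I_n -> F) : \prod_a t a = 1 -> torus (diag_mx (\row_a t a)).
Proof.
move=> t1; split; last exact: diag_mx_is_diag.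
by rewrite /SLn /= det_diag -[RHS]t1; apply: eq_bigr => a _; rewrite mxE.
Qed.

Lemma torus_diag A : torus A -> A = diag_mx (\row_a A a a).
Proof.
move=> [_ /is_diag_mxP dA]; apply/matrixP => i j; rewrite !mxE.
by have [->|ij] := eqVneq i j; rewrite ?mulr1n // mulr0n dA.
Qed.

Lemma torus_prod A : torus A -> \prod_a A a a = 1.
Proof.
move=> tA; have := proj1 tA; rewrite {1}(torus_diag tA) /SLn /= det_diag => h; rewrite -[RHS]h.
by apply: eq_bigr => a _; rewrite mxE.
Qed.

Lemma torus_GR A : torus A -> GR A.
Proof. by move=> [sA dA]; split=> //; apply: supported_diag. Qed.

(** Conjugation by the diagonal matrix with entries 2 at [c] and 1/2 at [d] multiplies the parameter
    by 4 without changing the value of [f]. Hence [f] is 1 at parameters of the form 3y, that is, at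
    all of them. *)
Lemma multiplicative_elem f c d x : multiplicative_on GR f -> c != d -> R c d ->
  f (elem_mx c d x) = 1.
Proof.
move=> [f0 fM] cd Rcd.
pose t (a : 'I_n) : F := if a == c then 2%:R else if a == d then 2%:R^-1 else 1.
have two0 : 2%:R != 0 :> F by rewrite pnatr_eq0.
have tt : torus (diag_mx (\row_a t a)).
  apply: diag_mx_torus; rewrite (bigD1 c) //= (bigD1 d) 1?eq_sym //= big1 => [|a].
    by rewrite /t eqxx eq_sym (negbTE cd) eqxx mulr1 mulfV.
  by rewrite /t => /andP[/negbTE -> /negbTE ->].
set D := diag_mx _ in tt.
have GE y : GR (elem_mx c d y) by split; [exact: det_elem_mx|exact: elem_mx_supp].
have H y : D *m elem_mx c d y = elem_mx c d (4%:R * y) *m D.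
  rewrite mul_diag_mx mul_mx_diag; apply/matrixP => i j.
  rewrite mxE [RHS]mxE !elem_mxE ![(\row_ _ _) _ _]mxE.
  have [/andP[/eqP -> /eqP ->]|_] := boolP ((i == c) && (j == d)).
    by rewrite /t (negbTE cd) eqxx eq_sym (negbTE cd) eqxx; rewrite !add0r !mulr1; field.
  by rewrite !mulr0 !addr0; have [->|ij] := eqVneq i j; [rewrite mulrC|rewrite mulr0 mul0r].
have f4 y : f (elem_mx c d (4%:R * y)) = f (elem_mx c d y).
  have := congr1 f (H y); rewrite !fM //; try exact: torus_GR.
  by rewrite mulrC => /(mulIf (f0 _ (torus_GR tt))).
have f3 y : f (elem_mx c d (3%:R * y)) = 1.
  apply: (mulIf (f0 _ (GE y))); rewrite mul1r -fM // elem_mxM // -[RHS]f4.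
  by congr f; congr elem_mx; ring.
by rewrite -(f3 (x / 3%:R)); congr f; congr elem_mx; field.
Qed.

Lemma multiplicative_eq f g : multiplicative_on GR f -> multiplicative_on GR g ->
  (forall A, torus A -> f A = g A) -> forall A, GR A -> f A = g A.
Proof.
move=> mf mg fg A [sA lA].
suff [] : f A = g A /\ GR A by [].
apply: (elimination (G := fun A => f A = g A /\ GR A) rR tR _ _ _ sA lA).
- move=> B C [eB gB] [eC gC]; split.
    by rewrite (proj2 mf) // (proj2 mg) // eB eC.
  by split; [apply: SLnM; [case: gB|case: gC]|apply: supportedM => //; [case: gB|case: gC]].
- by move=> B tB; split; [exact: fg|exact: torus_GR].
move=> c d x cd Rcd; split; first by rewrite !multiplicative_elem.
by split; [exact: det_elem_mx|exact: elem_mx_supp].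
Qed.

End TorusCharacters.

(** * Determinants of the diagonal blocks *)

Section BlockDet.
Context (F : numClosedFieldType) (n : nat) (p : seq nat).
Local Notation row := (fun a : 'I_n => reshape_index (transpose_part p) a).
Implicit Types (A B : 'M[F]_n).

(** Two enumerations of one index set differ by a permutation, which acts on rows and columns at
    once, so the signs cancel. *)
Lemma det_mxsub_inj m m' (f : 'I_m -> 'I_n) (g : 'I_m' -> 'I_n) A :
  injective f -> injective g -> (forall a, (exists u, f u = a) <-> (exists u, g u = a)) ->
  \det (mxsub f f A) = \det (mxsub g g A).
Proof.
move=> fi gi fg.
have E k (h : 'I_k -> 'I_n) : injective h -> #|[pred a | `[< exists u, h u = a >]]| = k.
  move=> hi; rewrite -[RHS]card_ord -(card_codom hi); apply: eq_card => a.
  rewrite !inE; apply/asboolP/codomP => [[u <-]|[u ->]]; by exists u.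
have mm' : m = m'.
  rewrite -(E _ _ fi) -(E _ _ gi); apply: eq_card => a; rewrite !inE.
  by apply: asbool_equiv_eq; exact: fg.
subst m'.
have P u : exists v, f v = g u by apply/fg; exists u.
pose s u := projT1 (cid (P u)).
have sE u : f (s u) = g u by exact: (projT2 (cid (P u))).
have si : injective s by move=> u v suv; apply: gi; rewrite -!sE suv.
have -> : mxsub g g A = row_perm (perm si) (col_perm (perm si) (mxsub f f A)).
  by apply/matrixP => u v; rewrite !mxE !permE !sE.
rewrite row_permE col_permE !det_mulmx !det_perm odd_permV mulrCA.
by rewrite -signr_addb addbb mulr1.
Qed.

Lemma block_det_bd i A : block_det p i (bd row A) = block_det p i A.
Proof.
congr (\det _); apply/matrixP => u v; rewrite !mxE.
have := enum_valP u; have := enum_valP v; rewrite !inE => /eqP -> /eqP ->.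
by rewrite eqxx.
Qed.

Lemma block_det1 i : block_det p i (1%:M : 'M[F]_n) = 1.
Proof.
rewrite -[RHS](det1 F #|block n p i|); congr (\det _); apply/matrixP => u v; rewrite !mxE.
by rewrite (inj_eq enum_val_inj).
Qed.

Lemma block_detM i A B : supported (eqR row) A ->
  block_det p i (A *m B) = block_det p i A * block_det p i B.
Proof.
move=> sA; rewrite /block_det -det_mulmx; congr (\det _); apply/matrixP => u v.
transitivity (\sum_(c in block n p i) A (enum_val u) c * B c (enum_val v)).
  rewrite mxE mxE [LHS](bigID (mem (block n p i))) /=.
  rewrite [X in _ + X]big1 ?addr0 // => c.
  rewrite inE => ci; rewrite sA ?mul0r // /eqR.
  by have := enum_valP u; rewrite inE => /eqP ->; rewrite eq_sym.
rewrite (big_enum_val (fun c => A (enum_val u) c * B c (enum_val v))) [RHS]mxE.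
by apply: eq_bigr => k _; rewrite !mxE.
Qed.

Lemma block_detM_low i A B : supported (lowR row) A -> supported (lowR row) B ->
  block_det p i (A *m B) = block_det p i A * block_det p i B.
Proof.
move=> sA sB; rewrite -block_det_bd bdM // block_detM; last exact: bd_supp.
by rewrite !block_det_bd.
Qed.

Lemma block_det_neq0 i A : A \in unitmx -> supported (lowR row) A -> block_det p i A != 0.
Proof.
move=> uA sA; apply/eqP => d0; have := block_det1 i; rewrite -(mulmxV uA).
rewrite block_detM_low // ?d0 ?mul0r => [/esym/eqP|]; first by rewrite oner_eq0.
by apply: supportedV => //; [exact: lowR_refl|exact: lowR_trans].
Qed.

Lemma block_det_diag i (t : 'I_n -> F) :
  block_det p i (diag_mx (\row_a t a)) = \prod_(a | row a == i) t a.
Proof.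
rewrite /block_det.
have -> : mxsub (enum_val (A := mem (block n p i))) (enum_val (A := mem (block n p i)))
    (diag_mx (\row_a t a)) = diag_mx (\row_u t (enum_val u)).
  by apply/matrixP => u v; rewrite !mxE (inj_eq enum_val_inj).
rewrite det_diag (eq_bigr (fun u => t (enum_val u))) => [|u _]; last by rewrite mxE.
rewrite -(big_enum_val t); apply: eq_bigl => a; by rewrite inE.
Qed.

Lemma regular_block_det i : regular (fun A : 'M[F]_n => block_det p i A).
Proof.
apply: (fa_det (regular_alg F n)) => u v.
have := @regular_coord F n (enum_val u) (enum_val v); apply: fa_ext => A; by rewrite mxE.
Qed.

End BlockDet.

(** * The centralizer of the base nilpotent and its characters *)

Section Centralizer.
Context (F : numClosedFieldType) (n : nat) (p : seq nat).
Hypothesis hp : is_partition n p.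
Local Notation p' := (transpose_part p).
Local Notation lam := (nth 0%N (transpose_part p)).
Local Notation row := (fun a : 'I_n => reshape_index (transpose_part p) a).
Local Notation off := (fun a : 'I_n => reshape_offset (transpose_part p) a).
Local Notation e := (base_nilpotent F n p).
Local Notation Ge := (centralizer (@SLn F n) e).
Implicit Types (A B : 'M[F]_n) (y : nat -> nat).

Definition blockchar y A : F := \prod_(i < size p') block_det p i A ^+ y i.

Lemma multiplicative_block_det i : multiplicative_on (block_levi p) (fun A : 'M[F]_n =>
  block_det p i A).
Proof.
split=> [A [sA lA]|A B [sA lA] [sB lB]]; last by rewrite block_detM.
by apply: block_det_neq0; [exact: SLn_unit|exact: eqR_low].
Qed.

Lemma row_lt (a : 'I_n) : (row a < size p')%N.
Proof. by apply: reshape_indexP; rewrite sumn_transpose ?(part_sumn hp) ?(part_sorted hp). Qed.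

Lemma prod_rows (t : 'I_n -> F) :
  \prod_(i < size p') \prod_(a | row a == i) t a = \prod_a t a.
Proof.
rewrite [RHS](partition_big (fun a => Ordinal (row_lt a)) xpredT) //=. 
Qed.

(** Both sides are multiplicative on the Levi subgroup, so they need only be compared on the torus,
    where the product is the determinant. *)
Lemma prod_block_det A : block_levi p A -> \prod_(i < size p') block_det p i A = 1.
Proof.
move=> LA; pose f B := \prod_(i < size p') block_det p i (B : 'M[F]_n).
have m1 : multiplicative_on (block_levi p) (fun _ : 'M[F]_n => 1 : F).
  by split=> *; rewrite ?oner_neq0 ?mulr1.
have mf : multiplicative_on (block_levi p) f.
  split=> [B LB|B C LB LC].
    by rewrite prodf_seq_neq0; apply/allP => i _; apply: (proj1 (multiplicative_block_det i)).
  by rewrite /f -big_split; apply: eq_bigr => i _; apply: (proj2 (multiplicative_block_det i)).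
apply: (multiplicative_eq (@eqR_refl n row) (@eqR_trans n row) mf m1) LA => B tB.
rewrite /f (torus_diag tB) -[RHS](torus_prod tB) -prod_rows.
by apply: eq_bigr => i _; rewrite block_det_diag.
Qed.

(** The case of [tight_stabilizer] in which both nilpotent matrices are [e]. *)
Lemma centralizer_low A : Ge A -> supported (lowR row) A.
Proof.
move=> [sA cA]; have uA := SLn_unit sA.
have ue : ulie row e by exact: chain_mx_ulie.
have te : tight (id \o row) e.
  apply: (@twist_tight F n row id) => // b;
    exact: (chain_mx_rank F (part_coords hp) (part_noninc p)).
by apply: (tight_stabilizer ue ue te uA); apply/mxconj_eq.
Qed.

(** [e] raises the block index by exactly one, so multiplying the block diagonal part by [e]
    extracts the same entries from both products. *)
Lemma bd_commute A : A *m e = e *m A -> bd row A *m e = e *m bd row A.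
Proof.
move=> cA; apply/matrixP => a b.
have H1 : (bd row A *m e) a b = (row a == (row b).+1)%:R * (A *m e) a b.
  rewrite !mxE mulr_sumr; apply: eq_bigr => c _; rewrite !mxE.
  by case: (row c =P (row b).+1) => [->|_] /=; rewrite ?mulr0 //; case: eqP;
    rewrite ?mul1r ?mul0r.
have H2 : (e *m bd row A) a b = (row a == (row b).+1)%:R * (e *m A) a b.
  rewrite !mxE mulr_sumr; apply: eq_bigr => c _; rewrite !mxE.
  case: (row a =P (row c).+1) => [->|_] /=; rewrite ?mul0r ?mulr0 // eqSS.
  by case: (reshape_index _ c =P _) => _; case: (_ == _); rewrite ?mul1r ?mulr0 ?mul0r.
by rewrite H1 H2 cA.
Qed.

Lemma bd_centralizer A : Ge A -> centralizer (block_levi p) e (bd row A).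
Proof.
move=> GA; have lA := centralizer_low GA; case: GA => sA cA; split.
  by split; [rewrite /SLn /= det_bd|exact: bd_supp].
exact: bd_commute.
Qed.

(** The unipotent factor commutes with [e], hence so does the whole line joining it to the
    identity. *)
Lemma centralizer_decomp A : Ge A -> identity_component Ge (invmx (bd row A) *m A).
Proof.
move=> GA; have lA := centralizer_low GA; have [sA cA] := GA.
have [[sb lb] cb] := bd_centralizer GA; have ub := SLn_unit sb.
have [_ UA] := blockLU (conj sA lA : blockP row A).
set u := invmx _ *m A in UA *.
have cu : u *m e = e *m u.
  have bu : bd row A *m u = A by rewrite mulKVmx.
  by apply: (can_inj (mulKmx ub)); rewrite [LHS]mulmxA [RHS]mulmxA cb -[RHS]mulmxA bu.
have -> : u = 1%:M + (u - 1%:M) by rewrite addrC subrK.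
apply: identity_component_line => t; split.
  by apply/blockU_SLn/(@blockU_line _ _ row); apply/blockU_ulie.
rewrite mulmxDl mulmxDr mul1mx mulmx1 -scalemxAl -scalemxAr mulmxBl mulmxBr.
by rewrite mul1mx mulmx1 cu.
Qed.

(** Between consecutive blocks of equal size [e] is an identity matrix in the coordinates [off], so
    a matrix commuting with it has the same entries in both blocks. *)
Lemma block_det_step i B : B *m e = e *m B -> lam i = lam i.+1 ->
  block_det p i B = block_det p i.+1 B.
Proof.
move=> cB ll; have C := part_coords hp.
have X k (h : lam k = lam i) (r : 'I_(lam i)) : exists a : 'I_n, row a = k /\ off a = r.
  by have [|a ? ?] := @coords_surj _ _ _ _ C k r; [rewrite h|exists a].
pose f k h r := projT1 (cid (@X k h r)).
have fr k h r : row (f k h r) = k by case: (projT2 (cid (@X k h r))).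
have fo k h r : off (f k h r) = r by case: (projT2 (cid (@X k h r))).
have fi k h : injective (f k h).
  by move=> r r' rr'; apply: val_inj; rewrite /= -(fo k h r) -(fo k h r') rr'.
have fD k h : block_det p k B = \det (mxsub (f k h) (f k h) B).
  apply: det_mxsub_inj; [exact: enum_val_inj|exact: fi|move=> a; split=> [[u <-]|[u <-]]].
    have := enum_valP u; rewrite inE => /eqP ru.
    have ou : (off (enum_val u) < lam i)%N.
      by have := coords_lt C (enum_val u); rewrite /= ru h.
    by exists (Ordinal ou); apply: (coords_inj C); rewrite /= ?fr ?fo.
  have bu : f k h u \in block n p k by rewrite inE fr.
  by exists (enum_rank_in bu (f k h u)); rewrite enum_rankK_in.
rewrite (fD i erefl) (fD i.+1 (esym ll)); congr (\det _); apply/matrixP => u v; rewrite !mxE.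
set g := f i erefl; set g' := f i.+1 (esym ll).
have := congr1 (fun M : 'M[F]_n => M (g' u) (g v)) cB; rewrite /= !mxE.
rewrite (bigD1 (g' v)) //= [X in _ + X]big1 => [|c cv].
  rewrite [RHS](bigD1 (g u)) //= [X in _ = _ + X]big1 => [|c cu].
    by rewrite !mxE !fr !fo !eqxx mulr1 mul1r !addr0 => ->.
  rewrite mxE fr eqSS fo; case: eqP => [rc|]; last by rewrite mul0r.
  case: eqP => [oc|]; last by rewrite mul0r.
  by case/eqP: cu; apply: (coords_inj C); rewrite /= ?fr ?fo.
rewrite mxE fr fo; case: eqP => [rc|]; last by rewrite mulr0.
case: eqP => [oc|]; last by rewrite mulr0.
by case/eqP: cv; apply: (coords_inj C); rewrite /= ?fr ?fo.
Qed.

Lemma block_det_class i i' B : B *m e = e *m B -> lam i = lam i' ->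
  block_det p i B = block_det p i' B.
Proof.
move=> cB; wlog: i i' / (i <= i')%N => [H|].
  by have [ii'|/ltnW ii'] := leqP i i' => ll; [exact: H|apply/esym/H].
move=> /subnKC <-; elim: (i' - i)%N => [|d IH]; first by rewrite addn0.
move=> ll; have le1 := part_noninc p (leq_addr d i).
have le2 := part_noninc p (leq_addr 1 (i + d)); rewrite addn1 in le2.
rewrite addnS in ll.
have e1 : lam i = lam (i + d)%N by apply/eqP; rewrite eqn_leq le1 {1}ll le2.
by rewrite IH // addnS block_det_step // -e1.
Qed.

Definition class_sum y a := (\sum_(i < size p' | lam i == a) y i)%N.

Lemma blockchar_class y y' B : B *m e = e *m B ->
  (forall a, class_sum y a = class_sum y' a) -> blockchar y B = blockchar y' B.
Proof.
move=> cB yy'.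
pose N := (\max_(i < size p') lam i).+1.
have lN (i : 'I_(size p')) : (lam i < N)%N by rewrite ltnS;
  apply: (leq_bigmax (F := fun i : 'I__ => lam i)).
pose del a := block_det p (index a p') B.
have delE (i : 'I_(size p')) : block_det p i B = del (lam i).
  by apply: block_det_class => //; rewrite nth_index // mem_nth.
suff E z : blockchar z B = \prod_(a < N) del a ^+ class_sum z a.
  by rewrite !E; apply: eq_bigr => a _; rewrite yy'.
rewrite /blockchar (partition_big (fun i => Ordinal (lN i)) xpredT) //=.
apply: eq_bigr => a _; rewrite /class_sum -prodrXr; apply: eq_big => [i|i].
  by rewrite -val_eqE.
by move=> /eqP ia; rewrite delE -ia.
Qed.

Lemma blockchar_bd y A : blockchar y (bd row A) = blockchar y A.
Proof. by apply: eq_bigr => i _; rewrite block_det_bd. Qed.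

Lemma blockcharM y A B : supported (lowR row) A -> supported (lowR row) B ->
  blockchar y (A *m B) = blockchar y A * blockchar y B.
Proof.
move=> sA sB; rewrite /blockchar -big_split; apply: eq_bigr => i _.
by rewrite block_detM_low // exprMn.
Qed.

Lemma blockchar1 y : blockchar y (1%:M : 'M[F]_n) = 1.
Proof. by rewrite /blockchar big1 // => i _; rewrite block_det1 expr1n. Qed.

Lemma regular_blockchar y : regular (blockchar y).
Proof.
apply: (fa_prod (regular_alg F n)) => i _; apply: (fa_exp (regular_alg F n)).
exact: regular_block_det.
Qed.

Lemma multiplicative_blockchar y : multiplicative_on (block_levi p) (blockchar y).
Proof.
split=> [A LA|A B [sA lA] [sB lB]].
  rewrite prodf_seq_neq0; apply/allP => i _; rewrite /= expf_neq0 //.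
  exact: (proj1 (multiplicative_block_det i)).
by apply: blockcharM; exact: eqR_low.
Qed.

Section Torsion.
Context (j : nat) (y : nat -> nat).
Hypothesis k_gt0 : (0 < gcd_parts p)%N.
Hypothesis hy : forall a, a \in p' -> (gcd_parts p * class_sum y a = j * count_mem a p')%N.

Lemma class_sum_count a : class_sum (fun=> 1%N) a = count_mem a p'.
Proof.
rewrite /class_sum -sum1_count (big_nth 0%N) big_mkord.
by apply: eq_bigl => i; rewrite /= .
Qed.

(** The k-th power has the class sums of the constant exponent [j]. On the centralizer it is
    therefore the j-th power of the product of all block determinants. *)
Lemma blockchar_torsion A : Ge A -> blockchar y A ^+ gcd_parts p = 1.
Proof.
move=> GA; have [LB cB] := bd_centralizer GA; rewrite -blockchar_bd.
have -> : blockchar y (bd row A) ^+ gcd_parts p = blockchar (fun i =>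
  (gcd_parts p * y i)%N) (bd row A).
  by rewrite /blockchar -prodrXl; apply: eq_bigr => i _; rewrite mulnC exprM.
rewrite (@blockchar_class _ (fun=> j)) //.
  by have := prod_block_det LB => /(congr1 (fun z => z ^+ j)); rewrite expr1n -prodrXl.
move=> a; rewrite /class_sum -big_distrr /= -/(class_sum y a).
have -> : (\sum_(i < size p' | lam i == a) j = j * class_sum (fun=> 1%N) a)%N.
  by rewrite /class_sum big_distrr; apply: eq_bigr => i _; rewrite /= muln1.
rewrite class_sum_count; have [ap|ap] := boolP (a \in p'); first exact: hy.
rewrite (count_memPn ap) muln0 /class_sum big_pred0 ?muln0 // => i.
by apply: contraNF ap => /eqP <-; apply: mem_nth.
Qed.

Lemma blockchar_identity_component S A : S `<=` Ge ->
  identity_component S A -> blockchar y A = 1.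
Proof.
move=> SG; apply: (identity_component_torsion k_gt0 (regular_blockchar y)) => [|B SB].
  exact: blockchar1.
by apply: blockchar_torsion; apply: SG.
Qed.

(** [chi] evaluates [emu] at some Levi component of [A], chosen up to the identity component; the
    block character is 1 there, so the choice has no effect. *)
Lemma chiE A : (forall B, block_levi p B -> emu p j B = blockchar y B) ->
  Ge A -> chi p j A = blockchar y A.
Proof.
move=> emuE GA; rewrite /chi /extend.
set Q := [set l | _]; have Ql : Q (xget 1%:M Q).
  apply: (@xgetI _ _ _ (bd row A)); split; first exact: bd_centralizer.
  exact: centralizer_decomp.
move: (xget _ _) Ql => l [[Ll cl] Il]; rewrite emuE //.
have [sl ll] := Ll; have ul := SLn_unit sl.
have Gu := identity_component_sub Il.
rewrite -[A in RHS](mulKVmx ul) blockcharM; last first.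
  - exact: centralizer_low.
  - exact: eqR_low.
by rewrite (blockchar_identity_component _ Il) ?mulr1.
Qed.

End Torsion.

End Centralizer.

(** * Characters of the Levi subgroup as Laurent monomials *)

Section Laurent.
Context (F : numClosedFieldType).

Definition laurent (g : F -> F) :=
  exists N (G : {poly F}), forall x, x != 0 -> x ^+ N * g x = G.[x].

Lemma laurent_alg : funalg laurent.
Proof.
split=> [c|f g [N [G fG]] [M [H gH]]|f g [N [G fG]] [M [H gH]]].
- by exists 0%N, c%:P => x _; rewrite mul1r hornerC.
- exists (N + M)%N, ('X^M * G + 'X^N * H) => x x0.
  by rewrite hornerD !hornerM !hornerXn -fG // -gH // exprD; ring.
- exists (N + M)%N, (G * H) => x x0.
  by rewrite hornerM -fG // -gH // exprD; ring.
Qed.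

Lemma laurent_id : laurent id.
Proof. by exists 0%N, 'X => x _; rewrite mul1r hornerX. Qed.

Lemma laurent_inv : laurent (fun x => x^-1).
Proof. by exists 1%N, 1 => x x0; rewrite expr1 mulfV // hornerC. Qed.

(** Clearing the denominator turns [g] into a multiplicative polynomial [G]. The leading
    coefficients in [G(xy) = G(x) G(y)] show that [G] is the monomial of its degree. *)
Lemma laurent_character (g : F -> F) : laurent g ->
  (forall x, x != 0 -> g x != 0) ->
  (forall x y, x != 0 -> y != 0 -> g (x * y) = g x * g y) ->
  exists v : int, forall x, x != 0 -> g x = x ^ v.
Proof.
move=> [N [G gG]] g0 gM.
have GM x y : x != 0 -> y != 0 -> G.[x * y] = G.[x] * G.[y].
  by move=> x0 y0; rewrite -!gG ?mulf_neq0 // gM // exprMn; ring.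
have G1 : G != 0.
  apply: contraNneq (g0 1 (oner_neq0 F)) => G0; have := gG 1 (oner_neq0 F).
  by rewrite G0 horner0 expr1n mul1r => ->.
exists ((size G).-1%:Z - N%:Z) => y y0.
have yN : y ^+ N != 0 by rewrite expf_neq0.
apply: (mulfI yN); rewrite gG // expfzDr // -exprnN mulrCA mulfV // mulr1 -exprnP.
pose Q := \poly_(i < size G) (G`_i * y ^+ i).
have QE : Q = G.[y] *: G.
  (* Multiplicativity is known only at nonzero points; the factor ['X] makes the identity hold at 0
     as well. *)
  have X0 : 'X != 0 :> {poly F} by rewrite polyX_eq0.
  apply: (mulfI X0); apply: poly_ext => x; rewrite !hornerM hornerX hornerZ.
  have [->|x0] := eqVneq x 0; first by rewrite !mul0r.
  rewrite -GM // [y * x]mulrC /Q horner_poly (horner_coef G (x * y)).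
  congr (_ * _); apply: eq_bigr => i _; rewrite exprMn; ring.
have := congr1 (fun P : {poly F} => P`_(size G).-1) QE.
rewrite coef_poly coefZ prednK ?lt0n ?size_poly_eq0 // leqnn mulrC => /mulIf -> //.
by rewrite -lead_coefE lead_coef_eq0.
Qed.

End Laurent.

Section LeviCharacters.
Context (F : numClosedFieldType) (n : nat) (p : seq nat).
Hypothesis hp : is_partition n p.
Local Notation p' := (transpose_part p).
Local Notation row := (fun a : 'I_n => reshape_index (transpose_part p) a).
Implicit Types (A B : 'M[F]_n) (chi : 'M[F]_n -> F).

Definition xi (m : nat -> int) A : F := \prod_(i < size p') block_det p i A ^ m i.

Lemma multiplicative_xi m : multiplicative_on (block_levi p) (xi m).
Proof.
split=> [A LA|A B LA LB].
  rewrite prodf_seq_neq0; apply/allP => i _; rewrite /= expfz_neq0 //.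
  exact: (proj1 (multiplicative_block_det F n p i) A LA).
rewrite /xi -big_split; apply: eq_bigr => i _.
by rewrite (proj2 (multiplicative_block_det F n p i)) // expfzMl.
Qed.

Lemma xi_diag m (t : 'I_n -> F) :
  xi m (diag_mx (\row_a t a)) = \prod_a t a ^ m (row a).
Proof.
rewrite -(prod_rows hp); apply: eq_bigr => i _; rewrite block_det_diag.
rewrite (big_morph (fun z => z ^ m i) (id1 := 1) (op1 := *%R)); last first.
  - by rewrite exp1rz.
  - by move=> x y; rewrite expfzMl.
by apply: eq_bigr => a /eqP ->.
Qed.

(** A diagonal matrix of determinant 1 is a product of matrices [l a (t a)], with [t a] at [a] and
    its inverse at [ord0]. The exponents are normalized to be 0 at [ord0]. *)
Lemma torus_character (S : set 'M[F]_n) chi : @torus F n `<=` S -> rational_character S chi ->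
  exists v : 'I_n -> int, forall t : 'I_n -> F, \prod_a t a = 1 ->
    chi (diag_mx (\row_a t a)) = \prod_a t a ^ v a.
Proof.
move=> TS [[f fE] chi0 chiM].
have chi1 : chi 1%:M = 1.
  have S1 : S 1%:M by apply: TS; split; [exact: det1|exact: scalar_mx_is_diag].
  by apply: (mulfI (chi0 _ S1)); rewrite -chiM // !mulmx1 mulr1.
case: n S TS chi f fE chi0 chiM chi1 => [|n'] S TS chi f fE chi0 chiM chi1.
  by exists (fun=> 0) => t _; rewrite big_ord0 -[RHS]chi1; congr chi;
    rewrite [LHS]flatmx0 [RHS]flatmx0.
pose lt (a : 'I_n'.+1) (x : F) (b : 'I_n'.+1) : F :=
  if b == a then x else if b == ord0 then x^-1 else 1.
pose l a x := diag_mx (\row_b lt a x b).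
have prod_lt a x : a != ord0 -> x != 0 -> \prod_b lt a x b = 1.
  move=> a0 x0; rewrite (bigD1 a) //= (bigD1 ord0) 1?eq_sym //= big1 => [|b].
    by rewrite /lt eqxx eq_sym (negbTE a0) eqxx mulr1 mulfV.
  by rewrite /lt => /andP[/negbTE -> /negbTE ->].
have Tl a x : a != ord0 -> x != 0 -> torus (l a x).
  by move=> a0 x0; apply: diag_mx_torus; apply: prod_lt.
have ex a : a != ord0 -> exists v : int, forall x, x != 0 -> chi (l a x) = x ^ v.
  move=> a0; apply: laurent_character => [|x x0|x y x0 y0].
  - have [N [G GE]] : laurent (fun x => mxeval f (l a x)).
      apply: (@fa_mxeval F n'.+1 F (@laurent F) (laurent_alg F) f (l a)) => i j.
      apply: (@fa_ext _ _ _ (fun x => lt a x i * (i == j)%:R)) => [x|].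
        by rewrite !mxE; case: eqP => [->|]; rewrite ?mulr1n ?mulr1 // mulr0n mulr0.
      apply: (fa_mul (laurent_alg F)); last exact: (fa_const (laurent_alg F)).
      rewrite /lt; case: eqP => _; first exact: (laurent_id F).
      case: eqP => _; first exact: (laurent_inv F).
      exact: (fa_const (laurent_alg F)).
    by exists N, G => x x0; rewrite fE ?GE //; apply/TS/Tl.
  - by apply/chi0/TS/Tl.
  rewrite -chiM; try exact/TS/Tl.
  congr chi; rewrite mulmx_diag; congr diag_mx; apply/rowP => b; rewrite !mxE /lt.
  by case: eqP => // _; case: eqP => // _; rewrite ?mulr1 // invfM.
pose v a := if pselect (a != ord0) is left h then projT1 (cid (ex a h)) else 0.
have vE a x : a != ord0 -> x != 0 -> chi (l a x) = x ^ v a.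
  by rewrite /v; case: pselect => // h _; apply: (projT2 (cid (ex a h))).
exists v => t t1.
have t0 a : t a != 0.
  apply/eqP => ta; move/eqP: t1; rewrite (bigD1 a) //= ta mul0r eq_sym.
  by rewrite oner_eq0.
pose tt (s : seq 'I_n'.+1) (b : 'I_n'.+1) := \prod_(a <- s | a != ord0) lt a (t a) b.
have tt1 s : \prod_b tt s b = 1.
  rewrite /tt exchange_big /= big1 // => a a0; exact: prod_lt.
have chis s : chi (diag_mx (\row_b tt s b)) = \prod_(a <- s | a != ord0) t a ^ v a.
  elim: s => [|a s IH].
    rewrite big_nil -[RHS]chi1 -diag_const_mx; congr (chi (diag_mx _)).
    by apply/rowP => b; rewrite !mxE /tt big_nil.
  rewrite big_cons; case: ifP => a0; last first.
    by rewrite -IH; congr (chi (diag_mx _)); apply/rowP => b; rewrite !mxE /tt big_cons a0.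
  rewrite -IH -vE // -chiM; [|exact/TS/Tl|exact/TS/diag_mx_torus].
  congr chi; rewrite mulmx_diag; congr diag_mx; apply/rowP => b; rewrite !mxE /tt.
  by rewrite big_cons a0.
have ttE b : tt (index_enum 'I_n'.+1) b = t b.
  have hb c : c != ord0 -> tt (index_enum 'I_n'.+1) c = t c.
    move=> c0; rewrite /tt (bigD1 c) //= big1 => [|a /andP[_ ac]]; rewrite /lt ?eqxx ?mulr1 //.
    by rewrite eq_sym (negbTE ac) (negbTE c0).
  have [->|] := eqVneq b ord0; last exact: hb.
  have := etrans (tt1 (index_enum 'I_n'.+1)) (esym t1);
    rewrite (bigD1 ord0) //= [RHS](bigD1 ord0) //=.
  rewrite [X in _ * X = _](eq_bigr t); last by move=> c c0; exact: hb.
  have nz : \prod_(a < n'.+1 | a != ord0) t a != 0.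
    by rewrite prodf_seq_neq0; apply/allP => a _; rewrite t0 implybT.
  exact: (mulIf nz).
have := chis (index_enum 'I_n'.+1); rewrite (_ : \row_b _ = \row_b t b); last first.
  by apply/rowP => b; rewrite !mxE ttE.
move=> ->; rewrite [RHS](bigD1 ord0) //= {2}/v; case: pselect => [h|_];
  last by rewrite expr0z mul1r.
by exfalso; move: h; rewrite eqxx.
Qed.

Lemma two_exp_inj (u w : int) : (2%:R : F) ^ u = 2%:R ^ w -> u = w.
Proof.
have two : (1 : F) < 2%:R by rewrite ltr1n.
have two0 : 2%:R != 0 :> F by rewrite pnatr_eq0.
have two1 : 2%:R != 1 :> F by rewrite gt_eqF.
have inj k : (2%:R : F) ^+ k = 1 -> k = 0%N.
  by rewrite -(expr0 2%:R) => /(ieexprIn (lt_trans ltr01 two) two1).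
move=> uw; apply/eqP; rewrite -subr_eq0; apply/eqP.
have : (2%:R : F) ^ (u - w) = 1 by rewrite expfzDr // uw -expfzDr // subrr expr0z.
case: (u - w) => k; first by rewrite -exprnP => /inj ->.
rewrite NegzE -exprnN => /(congr1 (fun z => z^-1)); rewrite invrK invr1 => /inj //.
Qed.

Lemma levi_character chi : rational_character (block_levi p) chi ->
  exists m, forall A, block_levi p A -> chi A = xi m A.
Proof.
move=> rchi; have TL : @torus F n `<=` block_levi p.
  by move=> A tA; apply: (torus_GR (@eqR_refl n row) tA).
have [v vE] := torus_character TL rchi; case: rchi => [_ chi0 chiM].
have vrow a b : row a = row b -> v a = v b.
  move=> rab; have [->//|ab] := eqVneq a b.
  pose t (c : 'I_n) : F := if c == a then 2%:R else if c == b then 2%:R^-1 else 1.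
  pose s c := t (tperm a b c).
  have two0 : 2%:R != 0 :> F by rewrite pnatr_eq0.
  have t1 : \prod_c t c = 1.
    rewrite (bigD1 a) //= (bigD1 b) 1?eq_sym //= big1 => [|c].
      by rewrite /t eqxx eq_sym (negbTE ab) eqxx mulr1 mulfV.
    by rewrite /t => /andP[/negbTE -> /negbTE ->].
  have s1 : \prod_c s c = 1 by rewrite -[RHS]t1 [RHS](reindex_inj (@perm_inj _ (tperm a b))).
  (* The sign gives the transposition determinant 1. It lies in the Levi subgroup because [a] and
     [b] share a block, and conjugation by it exchanges the entries 2 and 1/2 of [t]. *)
  pose D : 'M[F]_n := diag_mx (\row_c (if c == a then -1 else 1)).
  pose g := D *m perm_mx (tperm a b).
  have gE i j : g i j = (if i == a then -1 else 1) * (tperm a b i == j)%:R.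
    by rewrite /g mul_diag_mx !mxE.
  have Lg : block_levi p g.
    split.
      rewrite /SLn /= det_mulmx det_diag det_perm odd_tperm ab expr1.
      rewrite (bigD1 a) //= mxE eqxx big1 => [|c ca]; first by rewrite mulr1 mulrNN mulr1.
      by rewrite mxE (negbTE ca).
    move=> i j ij; rewrite gE.
    suff -> : tperm a b i == j = false by rewrite mulr0.
    apply: contraNF ij => /eqP <-; case: tpermP => [->|->|] //; by rewrite rab.
  have E : g *m diag_mx (\row_c t c) = diag_mx (\row_c s c) *m g.
    rewrite mul_mx_diag mul_diag_mx; apply/matrixP => i j; rewrite mxE [RHS]mxE.
    rewrite gE.
    rewrite ![(\row__ _) _ _]mxE /s; case: (_ =P j) => [->|_]; first by rewrite mulr1 mulrC.
    by rewrite !(mulr0, mul0r).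
  have Lt := TL _ (diag_mx_torus t1); have Ls := TL _ (diag_mx_torus s1).
  have E2 : chi (diag_mx (\row_c t c)) * chi g = chi (diag_mx (\row_c s c)) * chi g.
    by rewrite mulrC -(chiM _ _ Lg Lt) E chiM.
  have := mulIf (chi0 _ Lg) E2; rewrite !vE //.
  rewrite (bigD1 a) //= (bigD1 b) 1?eq_sym //= big1 => [|c /andP[ca cb]]; last first.
    by rewrite /t (negbTE ca) (negbTE cb) exp1rz.
  rewrite [RHS](bigD1 a) //= (bigD1 b) 1?eq_sym //= big1 => [|c /andP[ca cb]]; last first.
    by rewrite /s tpermD 1?eq_sym // /t (negbTE ca) (negbTE cb) exp1rz.
  rewrite /s tpermL tpermR /t !eqxx eq_sym (negbTE ab) !mulr1 !exprz_inv -!expfzDr //.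
  by move/two_exp_inj; lia.
pose m i := if [pick a : 'I_n | row a == i] is Some a then v a else 0.
exists m; apply: (multiplicative_eq (@eqR_refl n row) (@eqR_trans n row)) => //.
  exact: multiplicative_xi.
move=> A tA; rewrite (torus_diag tA) xi_diag vE ?torus_prod //.
apply: eq_bigr => a _; congr (_ ^ _); rewrite /m; case: pickP => [b /eqP rb|/(_ a)].
  by apply: vrow.
by rewrite eqxx.
Qed.

End LeviCharacters.

(** * The weights mu_j *)

Section Mubar.
Context (k : nat).

Lemma root_sumE (K : pzRingType) (B : nat -> K) (r : 'I_k) : B 0%N = 0 -> B k = 0 ->
  (\sum_(i < k.-1) B i.+1 *: simple_root k K i) 0 r = B r.+1 - B r.
Proof.
move=> B0 Bk; rewrite summxE.
rewrite (eq_bigr (fun i : 'I_k.-1 => B i.+1 * (r == i :> nat)%:R - B i.+1 * (r == i.+1 :>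
  nat)%:R)); last first.
  by move=> i _; rewrite !mxE mulrBr.
rewrite sumrB; congr (_ - _).
  have [rk|rk] := ltnP r k.-1.
    rewrite (bigD1 (Ordinal rk)) //= eqxx mulr1 big1 ?addr0 // => i ir.
    by rewrite (_ : (r == i :> nat) = false) ?mulr0 //; apply: contraNF ir => /eqP ri;
      apply/eqP/val_inj.
  have -> : r.+1 = k :> nat by have := ltn_ord r; lia.
  rewrite Bk big1 // => i _; rewrite (_ : (r == i :> nat) = false) ?mulr0 //.
  by apply/negP => /eqP ri; have := ltn_ord i; lia.
case: (posnP r) => [r0|r0].
  by rewrite r0 B0 big1 // => i _; rewrite mulr0.
have rk : (r.-1 < k.-1)%N by have := ltn_ord r; lia.
rewrite (bigD1 (Ordinal rk)) //= prednK // eqxx mulr1 big1 ?addr0 // => i ir.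
rewrite (_ : (r == i.+1 :> nat) = false) ?mulr0 //; apply: contraNF ir => /eqP ri.
by apply/eqP/val_inj; rewrite /= ri.
Qed.

Definition root_coef (K : pzRingType) (c : 'I_k.-1 -> K) (t : nat) : K :=
  if t is t'.+1 then oapp c 0 (insub t') else 0.

Lemma root_coef_ge (K : pzRingType) (c : 'I_k.-1 -> K) t : (k <= t)%N -> root_coef c t = 0.
Proof. by case: t => [//|t] kt; rewrite /root_coef insubF //; apply/negbTE; rewrite -leqNgt;
  lia. Qed.

Lemma root_coefE (K : pzRingType) (c : 'I_k.-1 -> K) (r : 'I_k) :
  (\sum_(i < k.-1) c i *: simple_root k K i) 0 r = root_coef c r.+1 - root_coef c r.
Proof.
rewrite -root_sumE ?(root_coef_ge _ (leqnn k)) //.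
by congr ((_ : 'rV_k) _ _); apply: eq_bigr => i _; rewrite /root_coef valK.
Qed.

Lemma root_coef_sum (K : pzRingType) (c : 'I_k.-1 -> K) :
  \sum_(r < k) (root_coef c r.+1 - root_coef c r) = 0.
Proof.
rewrite -(big_mkord xpredT (fun r => root_coef c r.+1 - root_coef c r)) telescope_sumr //.
by rewrite root_coef_ge // subrr.
Qed.

Context (j : nat).
Hypothesis jk : (j < k)%N.

(** The coefficients on simple roots are the fractional parts of [(k - j) t / k], and the
    coordinates are the differences of successive integer parts. *)
Lemma is_mubar_exists : exists m, @is_mubar k j m.
Proof.
have k0 : (0 < k)%N by apply: leq_ltn_trans jk.
pose Q t := ((k - j) * t %/ k)%N.
have Q0 : Q 0%N = 0%N by rewrite /Q muln0 div0n.
have Qk : Q k = (k - j)%N by rewrite /Q mulnK.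
exists (\row_r (Q r)%:Z - \row_r (Q r.+1)%:Z); split.
  pose B t : int := t%:Z - (minn t j)%:Z - (Q t)%:Z.
  have B0 : B 0%N = 0 by rewrite /B Q0 min0n.
  have Bk : B k = 0 by rewrite /B Qk; lia.
  exists (fun i => B i.+1), (-1); apply/rowP => r.
  rewrite !mxE root_sumE // /B natz.
  by case: (ltnP r j) => rj /=; lia.
pose B t : rat := (((k - j) * t) %% k)%N%:R / k%:R.
have kr : k%:R != 0 :> rat by rewrite pnatr_eq0 -lt0n.
have B0 : B 0%N = 0 by rewrite /B muln0 mod0n mul0r.
have Bk : B k = 0 by rewrite /B modnMl mul0r.
exists (fun i => B i.+1), (- ((k - j)%N%:R / k%:R)); split.
  apply/rowP => r; rewrite !mxE root_sumE //.
  have E t : ((Q t)%:Z%:~R : rat) = ((k - j) * t)%N%:R / k%:R - B t.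
    by rewrite /B -mulrBl {1}(divn_eq ((k - j) * t) k) natrD addrK natrM mulfK.
  by rewrite rmorphB /= !E mulnS natrD; field.
move=> i; rewrite /B divr_ge0 ?ler0n //= ltr_pdivrMr ?ltr0n // mul1r ltr_nat.
by rewrite ltn_mod.
Qed.

(** Coefficients in [0, 1) make any two coordinates differ by less than 2, so, relative to the least
    one, all are 0 or 1. Their sum is less than [k], as the least one counts 0, and congruent to [j]
    modulo [k], hence equal to [j]. *)
Lemma mubarP : exists (z : int) (S : nat -> nat),
  [/\ forall r : 'I_k, mubar k j 0 r = z + (S r)%:Z,
      forall t, (S t <= 1)%N & (\sum_(r < k) S r)%N = j].
Proof.
have k0 : (0 < k)%N by apply: leq_ltn_trans jk.
have : is_mubar j (mubar k j) by have [m hm] := is_mubar_exists; apply: xgetI hm.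
move: (mubar k j) => m [[b [z1 mE]] [c [z2 [mE' c01]]]].
have c01' t : 0 <= root_coef c t < 1.
  by case: t => [|t] /=; rewrite ?ltr01 ?lexx //; case: insub => [i|] //=; rewrite ltr01 lexx.
have mr (r : 'I_k) : (m 0 r)%:~R = root_coef c r.+1 - root_coef c r + z2 :> rat.
  by have := congr1 (fun v : 'rV_k => v 0 r) mE'; rewrite !mxE root_coefE.
have mlt (r s : 'I_k) : m 0 r < m 0 s + 2.
  have /andP[? ?] := c01' r; have /andP[? ?] := c01' r.+1.
  have /andP[? ?] := c01' s; have /andP[? ?] := c01' s.+1.
  have e2 : (2 : int)%:~R = 2 :> rat by [].
  by rewrite -(ltr_int rat) rmorphD /= !mr e2; lra.
have msum : \sum_(r < k) m 0 r = j%:Z + k%:Z * z1.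
  rewrite (eq_bigr (fun r : 'I_k => ((r < j)%N%:R : int) + (root_coef b r.+1 - root_coef b r) +
    z1)); last first.
    by move=> r _; rewrite mE !mxE root_coefE.
  rewrite big_split /= sumr_const card_ord big_split /= root_coef_sum addr0 -natr_sum.
  congr (_ + _); last by rewrite -mulr_natl natz.
  rewrite natz; congr Posz; rewrite -(big_mkord xpredT (fun r => (r < j)%N : nat)).
  rewrite (@big_cat_nat _ _ _ j) ?(ltnW jk) //= [X in (_ + X)%N]big_nat_cond [X in (_ + X)%N]big1.
    rewrite addn0 (eq_big_nat _ _ (F2 := fun=> 1%N)) => [|i /andP[_ ->] //].
    by rewrite sum_nat_const_nat subn0 muln1.
  by move=> i /andP[/andP[ji _] _]; rewrite ltnNge ji.
pose r0 := [arg min_(r < Ordinal k0) m 0 r]%O.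
have rmin (r : 'I_k) : m 0 r0 <= m 0 r by rewrite /r0; case: arg_minP => // i _; apply.
pose df (r : 'I_k) : int := m 0 r - m 0 r0.
pose S t := if insub t is Some r then absz (df r) else 0%N.
have SE (r : 'I_k) : (S r)%:Z = m 0 r - m 0 r0.
  by rewrite /S valK gez0_abs // subr_ge0.
exists (m 0 r0), S; split.
- by move=> r; rewrite SE addrC subrK.
- move=> t; rewrite /S; case: insubP => [r _ _|//].
  by rewrite /df; have := mlt r r0; have := rmin r; lia.
have Ssum : ((\sum_(r < k) S r)%N)%:Z = j%:Z + k%:Z * (z1 - m 0 r0).
  rewrite -[LHS]natz natr_sum (eq_bigr (fun r => m 0 r - m 0 r0)) => [|r _];
    last by rewrite natz SE.
  by rewrite sumrB msum sumr_const card_ord -mulr_natl natz; ring.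
have Slt : (\sum_(r < k) S r < k)%N.
  rewrite (bigD1 r0) //=; have -> : S r0 = 0%N by apply/eqP; rewrite -eqz_nat SE subrr.
  rewrite add0n -[X in (_ < X)%N]card_ord (cardD1 r0) inE /= add1n ltnS -sum1_card.
  rewrite [leqLHS]big_mkcond [leqRHS]big_mkcond; apply: leq_sum => r _.
  rewrite !inE; case: eqP => //= _; rewrite -lez_nat SE.
  by have := mlt r r0; lia.
set d := z1 - _ in Ssum; have : absz d = 0%N \/ (0 < absz d)%N by case: posnP; [left|right].
case=> [h|h].
  by apply/eqP; rewrite -eqz_nat Ssum; move: h => /eqP; rewrite absz_eq0 => /eqP ->;
    rewrite mulr0 addr0.
exfalso; move: Ssum Slt; move: (\sum_(r < k) S r)%N => T.
by nia.
Qed.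

End Mubar.

Section Emu.
Context (F : numClosedFieldType) (n : nat) (p : seq nat).
Hypothesis hp : is_partition n p.
Local Notation p' := (transpose_part p).
Local Notation lam := (nth 0%N (transpose_part p)).
Local Notation k := (gcd_parts p).

Lemma gcd_parts_dvd r : (k %| nth 0%N p r)%N.
Proof.
have [rp|rp] := ltnP r (size p); last by rewrite nth_default // dvdn0.
rewrite /gcd_parts (big_nth 0%N) big_mkord (bigD1 (Ordinal rp)) //=.
exact: dvdn_gcdl.
Qed.

Lemma level_sum (V : nmodType) (y : nat -> V) r :
  \sum_(i < size p' | (r < lam i)%N) y i = \sum_(i < nth 0%N p r) y i.
Proof.
have sp := part_sorted hp.
have le : (nth 0%N p r <= size p')%N by rewrite size_mkseq; exact: sorted_head.
rewrite (big_ord_widen _ _ le).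
by apply: eq_bigl => i; rewrite transpose_gt.
Qed.

(** The blocks of one size form a difference of two initial segments of the list of blocks, and the
    lengths of these segments are parts of [p]. *)
Lemma class_sum_level (V : nmodType) (y : nat -> V) a :
  \sum_(i < nth 0%N p a) y i = \sum_(i < size p' | lam i == a.+1) y i + \sum_(i < nth 0%N p
    a.+1) y i.
Proof.
rewrite -!level_sum [LHS](bigID (fun i : 'I__ => lam i == a.+1)) /=; congr (_ + _).
  by apply: eq_bigl => i; case: eqP => [->|_]; rewrite ?andbF // ltnSn.
by apply: eq_bigl => i; rewrite [RHS]ltn_neqAle andbC eq_sym.
Qed.

(** The exponents are periodic modulo [k], up to a constant that the product of all block
    determinants absorbs. Every part of [p] is a multiple of [k], so initial segments of these
    lengths consist of whole periods, each of sum [j]. *)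
Lemma emu_blockchar j : (j < k)%N -> exists s : nat -> nat,
  [/\ forall i, (s i <= 1)%N,
      forall A : 'M[F]_n, block_levi p A -> emu p j A = blockchar p s A &
      forall a, a \in p' -> (k * class_sum p s a = j * count_mem a p')%N].
Proof.
move=> jk; have k0 : (0 < k)%N by apply: leq_ltn_trans jk.
have [z [S [mE S1 Ssum]]] := mubarP jk.
exists (fun i => S (i %% k)%N); split => // [A LA|a ap].
  have D0 i : block_det p i A != 0 by apply: (proj1 (multiplicative_block_det F n p i)).
  rewrite /emu /weight_char.
  rewrite (eq_bigr (fun r : 'I_k => \prod_(i < size p' | (i %% k)%N == r) (block_det p i A ^ z *
    block_det p i A ^+ S (i %% k)%N))); last first.
    move=> r _; rewrite mE !mxE eqxx mulr1n.
    rewrite (big_morph (fun x => x ^ (z + (S r)%:Z)) (id1 := 1) (op1 := *%R)); last first.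
    - by rewrite exp1rz.
    - by move=> x y; rewrite expfzMl.
    by apply: eq_bigr => i /eqP ->; rewrite expfzDr.
  have mk (i : 'I_(size p')) : (i %% k < k)%N by rewrite ltn_mod.
  transitivity (\prod_(i < size p') (block_det p i A ^ z * block_det p i A ^+ S (i %% k)%N)).
    rewrite [RHS](partition_big (fun i => Ordinal (mk i)) xpredT) //=.
  rewrite big_split /= -[RHS]mul1r; congr (_ * _).
  have := prod_block_det hp LA => /(congr1 (fun x => x ^ z)); rewrite exp1rz.
  rewrite (big_morph (fun x => x ^ z) (id1 := 1) (op1 := *%R)) //; last by rewrite exp1rz.
  by move=> x y; rewrite expfzMl.
have blk q : (\sum_(i < q * k) S (i %% k) = q * j)%N.
  elim: q => [|q IH]; first by rewrite mul0n big_ord0.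
  rewrite mulSn -(big_mkord xpredT (fun i => S (i %% k)%N)) (@big_cat_nat _ _ _ k) ?leq_addr //=.
  rewrite mulSn; congr (_ + _)%N.
    rewrite big_mkord -Ssum; apply: eq_bigr => i _; by rewrite modn_small.
  rewrite -{1}[k]add0n big_addn addKn big_mkord -IH; apply: eq_bigr => i _.
  by rewrite modnDr.
have lev r : (k * (\sum_(i < nth 0 p r) S (i %% k)) = j * nth 0 p r)%N.
  have /dvdnP[q ->] := gcd_parts_dvd r; rewrite blk; lia.
case: a ap => [|a] ap; first by move: (transpose_notin0 (part_sorted hp)); rewrite ap.
have h1 := class_sum_level (fun i => S (i %% k)%N) a.
have h2 := class_sum_level (fun=> 1%N) a.
rewrite -/(class_sum p (fun i => S (i %% k)%N) a.+1) in h1.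
rewrite -/(class_sum p (fun=> 1%N) a.+1) in h2.
have := lev a; have := lev a.+1; rewrite -class_sum_count.
move: h1 h2; rewrite !sum1_card !card_ord.
move: (class_sum _ _ _) (class_sum _ _ _) (\sum_(i < _) _)%N (\sum_(i < _) _)%N => x y u v.
rewrite -[(x + _)%R]/(x + _)%N -[(y + _)%R]/(y + _)%N => -> ->; rewrite !mulnDr; lia.
Qed.

End Emu.

(** * Lifts to Levi subgroups *)

Section Lifts.
Context (F : numClosedFieldType) (n : nat) (p : seq nat).
Hypothesis hp : is_partition n p.
Local Notation p' := (transpose_part p).
Local Notation lam := (nth 0%N (transpose_part p)).
Local Notation row := (fun a : 'I_n => reshape_index (transpose_part p) a).
Local Notation off := (fun a : 'I_n => reshape_offset (transpose_part p) a).
Local Notation e := (base_nilpotent F n p).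
Local Notation k := (gcd_parts p).
Implicit Types (A B g h u l : 'M[F]_n) (P L U : set 'M[F]_n) (nu theta : 'M[F]_n -> F).

Lemma extendE P L U nu l u : levi_decomposition P L U -> L l -> U u ->
  extend L U nu (l *m u) = nu l.
Proof.
move=> [[[[US _ _ UM UV] _ _ _ _] _] [LS _ _ LM LV] LU _] Ll Uu.
rewrite /extend; set Q := [set l' | _].
have Ql : Q l by split=> //; rewrite mulKmx // SLn_unit //; apply: LS.
have [Ll' Ul'] : Q (xget 1%:M Q) by apply: xgetI Ql.
move: (xget _ _) Ll' Ul' => l' Ll' Ul'; congr nu.
have ul := SLn_unit (LS _ Ll); have ul' := SLn_unit (LS _ Ll'); have uu := SLn_unit (US _ Uu).
have E : (L `&` U) (invmx l' *m l).
  split; first by apply/LM => //; apply: LV.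
  have -> : invmx l' *m l = (invmx l' *m (l *m u)) *m invmx u by rewrite mulmxA mulmxK.
  by apply/UM => //; apply: UV.
rewrite LU in E; have := congr1 (mulmx l') E; rewrite mulKVmx // mulmx1 => ->.
by [].
Qed.

Lemma centralizer_conj g P (X : 'M[F]_n) : g \in unitmx ->
  centralizer (mxconj g @` P) (mxconj g X) = mxconj g @` centralizer P X.
Proof.
move=> ug; apply/seteqP; split=> [_ [[A PA <-] cA]|_ [A [PA cA] <-]].
  exists A => //; split=> //; rewrite -!mxconjM // in cA.
  exact: (can_inj (mxconjK ug) cA).
by split; [exists A|rewrite -!mxconjM // cA].
Qed.

Lemma lifts_conj theta g L nu nu2 : SLn g -> lifts p theta L nu ->
  (forall A, (mxconj g @` L) A -> nu2 A = nu (mxconj (invmx g) A)) ->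
  lifts p theta (mxconj g @` L) nu2.
Proof.
move=> sg [[[f fE] nu0 nuM] [P [U [e1 [rPLU Oe1 Le1 nuI [h [sh e1E nuth]]]]]]] nuE.
have ug := SLn_unit sg; have uh := SLn_unit sh.
have nuE' A : L A -> nu2 (mxconj g A) = nu A.
  by move=> LA; rewrite nuE ?mxconjK //; exists A.
split.
  split.
  - have [f' f'E] := regular_comp (regular_mxeval f) (@regular_mxconj F n (invmx g)).
    by exists f' => A LA; rewrite nuE // -f'E /= fE //; move: LA; rewrite image_mxconj.
  - by move=> _ [A LA <-]; rewrite nuE' //; apply: nu0.
  - move=> _ _ [A LA <-] [B LB <-]; have [_ [_ [_ _ _ LM _] _ _] _] := rPLU.
    by rewrite -mxconjM // !nuE' //; [exact: nuM|exact: LM].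
have [_ dP _] := rPLU.
have rP2 := richardson_conj sg rPLU; have [_ dP2 _] := rP2.
have extE A : P A -> extend (mxconj g @` L) (mxconj g @` U) nu2 (mxconj g A) = extend L U nu A.
  have [_ _ _ PE] := dP; rewrite PE => -[l Ll [u Uu <-]].
  by rewrite mxconjM // (extendE _ dP2) ?(extendE _ dP) ?nuE' //.
exists (mxconj g @` P), (mxconj g @` U), (mxconj g e1); split=> //.
- exact: nilpotent_orbit_conj.
- exact: lie_algebra_mxconj.
- move=> A; rewrite centralizer_conj // => /(identity_component_conj ug) IA.
  rewrite -[A](mxconjVK ug) extE; first exact: nuI.
  by have [] := identity_component_sub IA.
exists (g *m h); split; [exact: SLnM|by rewrite e1E mxconj_comp|].
rewrite centralizer_conj // => _ [A [PA cA] <-].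
rewrite extE // nuth //; congr theta.
by rewrite mxconj_comp ?unitmx_inv ?unitmx_mul ?ug // invmxM // mulmxKV.
Qed.

Lemma levi_rational_blockchar (y : nat -> nat) nu :
  (forall A, block_levi p A -> nu A = blockchar p y A) ->
  rational_character (block_levi p) nu.
Proof.
move=> nuE; have [f fE] := @regular_blockchar F n p y.
have [y0 yM] := @multiplicative_blockchar F n p y.
have [_ _ _ LM _] := @closed_subgroup_L F n row.
split; first by exists f => A LA; rewrite nuE // fE.
  by move=> A LA; rewrite nuE // y0.
by move=> A B LA LB; rewrite !nuE // ?yM //; exact: LM.
Qed.

(** For the parabolic [blockP row] the nilpotent matrix can be [e] itself, and on its centralizer a
    block character depends only on its class sums. *)
Lemma blockchar_lift j (s y : nat -> nat) nu : (0 < k)%N ->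
  (forall A : 'M[F]_n, block_levi p A -> emu p j A = blockchar p s A) ->
  (forall a, a \in p' -> (k * class_sum p s a = j * count_mem a p')%N) ->
  (forall a, a \in p' -> (k * class_sum p y a = j * count_mem a p')%N) ->
  (forall A, block_levi p A -> nu A = blockchar p y A) ->
  lifts p (chi p j) (block_levi p) nu.
Proof.
move=> k0 emuE hs hy nuE; split; first exact: levi_rational_blockchar nuE.
have rr := @richardson_row F n p hp; have [_ dP _] := rr.
have extE A : blockP row A -> extend (block_levi p) (blockU row) nu A = blockchar p y A.
  move=> PA; have [LA UA] := blockLU PA.
  rewrite -[A](mulKVmx (SLn_unit (proj1 LA))) (extendE _ dP) //.
  by rewrite nuE // mulKVmx ?SLn_unit ?blockchar_bd //; case: LA.
have sub : centralizer (blockP row) e `<=` centralizer (@SLn F n) e.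
  by move=> A [[sA _] cA].
have ysE a : class_sum p y a = class_sum p s a.
  have [ap|ap] := boolP (a \in p').
    by apply/eqP; rewrite -(eqn_pmul2l k0) hy // hs.
  by rewrite /class_sum !big_pred0 // => i; apply: contraNF ap => /eqP <-; apply: mem_nth.
exists (blockP row), (blockU row), e; split=> //.
- exact: base_orbit.
- by rewrite lie_algebra_U; exact: chain_mx_ulie.
- move=> A IA; have [PA _] := identity_component_sub IA; rewrite extE //.
  exact: (blockchar_identity_component hp k0 hy sub IA).
exists 1%:M; split; [exact: SLn1|by rewrite mxconj1|move=> A CA].
rewrite invmx1 mxconj1 extE; last by case: CA.
have GA := sub _ CA; rewrite (chiE hp k0 hs emuE GA).
have [_ cB] := bd_centralizer hp GA.
by rewrite -blockchar_bd -[RHS]blockchar_bd; apply: blockchar_class.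
Qed.

Lemma blockchar_diag (s : nat -> nat) (t : 'I_n -> F) :
  blockchar p s (diag_mx (\row_a t a)) = \prod_a t a ^+ s (row a).
Proof.
rewrite -(prod_rows hp); apply: eq_bigr => i _; rewrite block_det_diag -prodrXl.
by apply: eq_bigr => a /eqP ->.
Qed.

(** The lift is evaluated at diagonal matrices constant along the chains. They centralize [e], and
    transporting them into the given parabolic leaves their block determinants unchanged. *)
Lemma lift_relation j (s : nat -> nat) L nu : (0 < k)%N ->
  (forall A : 'M[F]_n, block_levi p A -> emu p j A = blockchar p s A) ->
  (forall a, a \in p' -> (k * class_sum p s a = j * count_mem a p')%N) ->
  lifts p (chi p j) L nu ->
  exists g (m : nat -> int), [/\ SLn g, L = mxconj g @` block_levi p,
    forall A, block_levi p A -> nu (mxconj g A) = xi p m A &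
    forall x : nat -> F, \prod_(a < n) x (off a) = 1 ->
      \prod_(a < n) x (off a) ^ m (row a) = \prod_(a < n) x (off a) ^+ s (row a)].
Proof.
move=> k0 emuE hs [rnu [P [U [e1 [rPLU Oe1 Le1 _ [h [sh e1E nuth]]]]]]].
have [tau [g [sg ti PE LE UE]]] := richardson_normal_form hp rPLU.
have ug := SLn_unit sg; have uh := SLn_unit sh.
have [_ dP _] := rPLU.
have rchi : rational_character (block_levi p) (nu \o mxconj g).
  have [[f fE] nu0 nuM] := rnu; split.
  - have [f' f'E] := regular_comp (regular_mxeval f) (@regular_mxconj F n g).
    by exists f' => A LA; rewrite /= fE ?LE; [exact: f'E|exists A].
  - by move=> A LA; apply: nu0; rewrite LE; exists A.
  - by move=> A B LA LB; rewrite /= mxconjM // nuM // LE; [exists A|exists B].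
have [m mE] := levi_character hp rchi.
exists g, m; split=> // x x1.
have [v [vo uv]] := chain_twist F (part_coords hp) (part_noninc p) ti.
set E := mxconj _ _ in uv.
have uperm := perm_mx_unit F v.
pose u := invmx g *m h *m invmx (perm_mx v).
have ugV : invmx g \in unitmx by rewrite unitmx_inv.
have upV : invmx (perm_mx v) \in @unitmx F n by rewrite unitmx_inv.
have uu : u \in unitmx by rewrite /u !unitmx_mul ugV uh.
have e1E' : mxconj u E = mxconj (invmx g) e1.
  rewrite /u /E -mxconj_comp ?unitmx_mul ?ugV // mxconjK //.
  by rewrite -mxconj_comp // -e1E.
have ue1 : ulie (tau \o row) (mxconj (invmx g) e1).
  move: Le1; rewrite UE lie_algebra_conjE // lie_algebra_U => -[X uX <-].
  by rewrite mxconjK.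
have tE : tight (tau \o row) E.
  apply: (@twist_tight F n row tau) => // b; rewrite (orbit_rank hp) //.
  by apply: nilpotent_orbit_conj => //; exact: base_orbit.
(* [E] and the transported [e1] lie in the same nilradical and in the same orbit, so the conjugator
   between them belongs to the block triangular group. *)
have lu := tight_stabilizer uv ue1 tE uu e1E'.
pose t := diag_mx (\row_a x (off a)).
have tt : torus t by apply: diag_mx_torus.
have te : t *m e = e *m t.
  rewrite mul_diag_mx mul_mx_diag; apply/matrixP => a b;
    rewrite mxE [RHS]mxE ![(\row__ _) _ _]mxE.
  rewrite [e a b]mxE; case: eqP => //= _; last by rewrite mulr0 mul0r.
  by case: eqP => [->|_]; rewrite ?mulr0 ?mul0r // mulrC.
have tv : mxconj (perm_mx v) t = t.
  by rewrite mxconj_perm; apply/matrixP => a b; rewrite !mxE vo (inj_eq (@perm_inj _ v)).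
have tE' : t *m E = E *m t by rewrite -[t]tv -!mxconjM // te.
pose B := mxconj u t.
have PB : blockP (tau \o row) B.
  split; first by apply: SLn_conj => //; case: tt.
  have lt : supported (lowR (tau \o row)) t.
    by apply: supported_diag; [exact: lowR_refl|case: tt].
  apply: supportedM; [exact: lowR_trans|apply: supportedM => //; exact: lowR_trans|].
  by apply: supportedV => //; [exact: lowR_refl|exact: lowR_trans].
have cB : centralizer P e1 (mxconj g B).
  split; first by rewrite PE; exists B.
  have -> : e1 = mxconj g (mxconj u E) by rewrite e1E' mxconjVK.
  by rewrite /B -!mxconjM // tE'.
have := nuth _ cB.
have -> : mxconj (invmx h) (mxconj g B) = t.
  rewrite /B !mxconj_comp ?unitmx_inv ?unitmx_mul ?unitmx_inv ?uh ?ug //.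
  have -> : invmx h *m g *m u = invmx (perm_mx v).
    by rewrite /u !mulmxA mulmxK // mulVmx // mul1mx.
  by rewrite -{1}tv mxconjK.
have Gt : centralizer (@SLn F n) e t by split=> //; case: tt.
rewrite (chiE hp k0 hs emuE Gt) blockchar_diag => <-.
clearbody u.
have [LB UB] := blockLU PB.
have ulb := SLn_unit (proj1 LB).
have LB' : block_levi p (bd (tau \o row) B).
  split; first by case: LB.
  move=> i j' ij; apply: (proj2 LB); rewrite /eqR /=; apply: contraNN ij => /eqP/ti ->.
  exact: eqxx.
rewrite -[X in mxconj g X](mulKVmx ulb) mxconjM // (extendE _ dP); last first.
- by rewrite UE; exists (invmx (bd (tau \o row) B) *m B).
- by rewrite LE; exists (bd (tau \o row) B).
(* The element to evaluate is the Levi part of a conjugate of [t] by the block triangular [u]; its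
   block determinants are those of [t]. *)
have /= -> := mE _ LB'; rewrite -(xi_diag hp m (fun a => x (off a))) /xi;
  apply: eq_bigr => i _; congr (_ ^ _).
have bdE (M : 'M[F]_n) : bd (tau \o row) M = bd row M.
  apply/matrixP => a b; rewrite !mxE /=; case: eqP => [/ti ->|ne]; first by rewrite eqxx.
  by case: eqP => // re; case: ne; rewrite re.
have lt : supported (lowR (tau \o row)) t.
  by apply: supported_diag; [exact: lowR_refl|case: tt].
have luV : supported (lowR (tau \o row)) (invmx u).
  by apply: supportedV => //; [exact: lowR_refl|exact: lowR_trans].
rewrite /B /mxconj !bdM //; last by apply: supportedM => //; exact: lowR_trans.
rewrite !bdE block_detM; last first.
  by apply: supportedM; [exact: eqR_trans|exact: bd_supp|exact: bd_supp].
rewrite block_detM; last exact: bd_supp.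
rewrite mulrAC -block_detM; last exact: bd_supp.
rewrite -!bdE -bdM // mulmxV // bdE bd1 block_det1 mul1r bdE block_det_bd.
by [].
Qed.

End Lifts.

(** * Class sums of the exponents of a lift *)

Section Relation.
Context (F : numClosedFieldType) (n : nat) (p : seq nat).
Hypothesis hp : is_partition n p.
Local Notation p' := (transpose_part p).
Local Notation lam := (nth 0%N (transpose_part p)).
Local Notation row := (fun a : 'I_n => reshape_index (transpose_part p) a).
Local Notation off := (fun a : 'I_n => reshape_offset (transpose_part p) a).
Local Notation k := (gcd_parts p).

Lemma prim_root_exists m : (0 < m)%N -> exists z : F, m.-primitive_root z.
Proof.
pose q : {poly F} := 'X^m - 1; have [r Dq] := closed_field_poly_normal q.
move=> m0; rewrite (monicP _) ?monicXnsubC // scale1r in Dq.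
have rn1: all m.-unity_root r by apply/allP=> z; rewrite -root_prod_XsubC -Dq.
have sz_r: (m < (size r).+1)%N by rewrite -(size_prod_XsubC r id) -Dq size_XnsubC.
have [|z] := hasP (has_prim_root m0 rn1 _ sz_r); last by exists z.
by rewrite -separable_prod_XsubC -Dq separable_Xn_sub_1 // pnatr_eq0 -lt0n.
Qed.

Lemma prim_expz_dvd m (z : F) (i : int) : m.-primitive_root z -> z ^ i = 1 -> (m %| i)%Z.
Proof.
move=> pz zi; rewrite dvdzE absz_nat (prim_order_dvd pz); apply/eqP.
case: i zi => i //; rewrite NegzE -exprnN abszN => /(congr1 (fun x => x^-1)).
by rewrite invrK invr1.
Qed.

Lemma gcd_bezout (t : seq nat) : exists a : nat -> int,
  \sum_(r < size t) a r * (nth 0%N t r)%:Z = (gcd_parts t)%:Z.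
Proof.
rewrite /gcd_parts; elim: t => [|x t [a aE]].
  by exists (fun=> 0); rewrite big_ord0 big_nil.
have [u [v uv]] := Bezoutz x%:Z (\big[gcdn/0%N]_(b <- t) b)%:Z.
exists (fun r => if r is r'.+1 then v * a r' else u).
rewrite big_ord_recl /= big_cons -[RHS]/(gcdz x%:Z (\big[gcdn/0%N]_(b <- t) b)%:Z) -uv -aE.
congr (_ + _); rewrite mulr_sumr; apply: eq_bigr => i _.
by rewrite mulrA.
Qed.

Lemma off_lt (a : 'I_n) : (off a < size p)%N.
Proof.
have ra : (row a < nth 0%N p (off a))%N.
  by rewrite -transpose_gt ?(part_sorted hp) //; exact: (coords_lt (part_coords hp)).
by rewrite ltnNge; apply/negP => h; move: ra; rewrite nth_default.
Qed.

Lemma sum_chain (V : zmodType) (y : nat -> V) r :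
  \sum_(a : 'I_n | off a == r) y (row a) = \sum_(i < nth 0%N p r) y i.
Proof.
rewrite -(level_sum hp) (partition_big (fun a => Ordinal (row_lt hp a)) (fun i : 'I__ =>
  (r < lam i)%N)) /=.
  apply: eq_bigr => i ri; have C := part_coords hp.
  have [a ra oa] := coords_surj C ri; rewrite (bigD1 a) /=; last first.
    by rewrite -val_eqE /= ra oa !eqxx.
  rewrite ra big1 ?addr0 // => b /andP[/andP[/eqP ob /eqP/(congr1 val) /= rb] ba].
  by case/eqP: ba; apply: (coords_inj C); rewrite /= ?rb ?ob ?ra ?oa.
by move=> a /eqP <-; exact: (coords_lt (part_coords hp)).
Qed.

Lemma prod_chain (x : nat -> F) (y : nat -> int) : (forall r, x r != 0) ->
  \prod_(a < n) x (off a) ^ y (row a) =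
  \prod_(r < size p) x r ^ (\sum_(i < nth 0%N p r) y i).
Proof.
move=> x0; rewrite (partition_big (fun a => Ordinal (off_lt a)) xpredT) //=.
apply: eq_bigr => r _; rewrite -sum_chain.
rewrite (big_morph (fun z : int => x r ^ z) (id1 := 1) (op1 := *%R)); last first.
- by rewrite expr0z.
- by move=> u v; rewrite expfzDr.
by apply: eq_big => [a|a]; rewrite -val_eqE // => /eqP /= ->.
Qed.

(* Entries that are powers of 2 make the excess of the exponents along the row
   [r] of the diagram of [p] proportional to [p_r]; powers of a primitive k-th
   root of unity, with Bezout coefficients of the parts as exponents, make the
   ratio an integer. *)
Lemma relation_class (s : nat -> nat) (m : nat -> int) : (0 < k)%N ->
  (forall x : nat -> F, \prod_(a < n) x (off a) = 1 ->
      \prod_(a < n) x (off a) ^ m (row a) = \prod_(a < n) x (off a) ^+ s (row a)) ->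
  exists c : int, forall a, \sum_(i < size p' | lam i == a) (m i - c) =
    \sum_(i < size p' | lam i == a) (s i)%:Z.
Proof.
move=> k0 H; pose y i := m i - (s i)%:Z; pose Y r := \sum_(i < nth 0%N p r) y i.
have rel (x : nat -> F) : (forall r, x r != 0) -> \prod_(r < size p) x r ^ (nth 0%N p r)%:Z = 1 ->
    \prod_(r < size p) x r ^ Y r = 1.
  move=> x0 x1; rewrite -prod_chain //.
  have xp : \prod_(a < n) x (off a) = 1.
    have := prod_chain (fun=> 1) x0; under eq_bigr => a _ do rewrite expr1z.
    move=> ->; rewrite -[RHS]x1; apply: eq_bigr => r _.
    by rewrite sumr_const card_ord -mulr_natl mulr1 natz.
  rewrite (eq_bigr (fun a : 'I_n => x (off a) ^ m (row a) / x (off a) ^+ s (row a))).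
    rewrite big_split /= prodfV H // mulfV // prodf_seq_neq0.
    by apply/allP => a _; rewrite /= expf_neq0.
  by move=> a _; rewrite /y expfzDr // exprnN.
have two0 : 2%:R != 0 :> F by rewrite pnatr_eq0.
have prop (r q : 'I_(size p)) : Y r * (nth 0%N p q)%:Z = Y q * (nth 0%N p r)%:Z.
  have [->//|rq] := eqVneq r q.
  pose x (i : nat) : F := if i == r then 2%:R ^ (nth 0%N p q)%:Z else if i == q then 2%:R ^ (-
    (nth 0%N p r)%:Z) else 1.
  have x0 i : x i != 0.
    rewrite /x; case: (i == r :> nat); first exact: expfz_neq0.
    by case: (i == q :> nat); [exact: expfz_neq0|exact: oner_neq0].
  have xE (z : nat -> int) : \prod_(i < size p) x i ^ z i =
      2%:R ^ ((nth 0%N p q)%:Z * z r - (nth 0%N p r)%:Z * z q).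
    rewrite (bigD1 r) //= (bigD1 q) 1?eq_sym //= big1 => [|i /andP[ir iq]]; last first.
      by rewrite /x !val_eqE (negbTE ir) (negbTE iq) exp1rz.
    rewrite /x eqxx val_eqE eq_sym (negbTE rq) eqxx mulr1 !exprz_exp -expfzDr //.
    by rewrite mulNr.
  have := rel x x0; rewrite (xE (fun i => (nth 0%N p i)%:Z)) (xE Y) /= [(nth 0%N p q)%:Z * (nth
    _ _ _)%:Z]mulrC subrr expr0z => /(_ erefl).
  rewrite -(expr0z 2%:R) => /two_exp_inj; lia.
have [a aE] := gcd_bezout p; pose Ys := \sum_(r < size p) a r * Y r.
have YsE (q : 'I_(size p)) : k%:Z * Y q = (nth 0%N p q)%:Z * Ys.
  rewrite -aE mulr_suml mulr_sumr; apply: eq_bigr => r _.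
  by rewrite -mulrA [_ * Y q]mulrC -prop; ring.
have [zeta pz] := prim_root_exists k0.
have z0 : zeta != 0.
  apply/eqP => z0; have := prim_expr_order pz; rewrite z0 expr0n.
  by rewrite eqn0Ngt k0 /= => /esym/eqP; rewrite oner_eq0.
have kYs : (k%:Z %| Ys)%Z.
  apply: (prim_expz_dvd pz).
  have := rel (fun r => zeta ^ a r) (fun r => expfz_neq0 _ z0).
  have zE (z : nat -> int) : \prod_(r < size p) (zeta ^ a r) ^ z r = zeta ^ (\sum_(r < size p) a
    r * z r).
    rewrite (big_morph (fun z : int => zeta ^ z) (id1 := 1) (op1 := *%R)); last first.
    - by rewrite expr0z.
    - by move=> u v; rewrite expfzDr.
    by apply: eq_bigr => r _; rewrite exprz_exp.
  rewrite (zE (fun r => (nth 0%N p r)%:Z)) (zE Y) aE -exprnP (prim_expr_order pz); exact.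
have [c cE] := dvdzP kYs; exists c => b.
have YE r : Y r = (nth 0%N p r)%:Z * c.
  have [rp|rp] := ltnP r (size p); last by rewrite /Y nth_default // big_ord0 mul0r.
  have kz : k%:Z != 0 by rewrite eqz_nat -lt0n.
  apply: (mulfI kz); rewrite (YsE (Ordinal rp)) cE /=; ring.
apply/eqP; rewrite -subr_eq0 -sumrB; apply/eqP.
case: b => [|b].
  rewrite big1 // => i /eqP li; exfalso.
  have := transpose_notin0 (part_sorted hp); rewrite -li mem_nth //.
(* The excess on the blocks of size [b.+1] is the difference of two successive values of [Y], both
   multiples of [c]; it is [c] times the number of these blocks. *)
have h1 := class_sum_level hp y b; rewrite -/(Y b) -/(Y b.+1) !YE in h1.
have h2 := class_sum_level hp (fun=> c) b.
have cE' t : c *+ t = t%:Z * c by rewrite -mulr_natl natz.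
rewrite !sumr_const !card_ord !cE' in h2.
rewrite (eq_bigr (fun i : 'I__ => y i - c)); last by move=> i _; rewrite /y; ring.
rewrite sumrB; move: h1; rewrite h2 => /addIr <-.
by rewrite sumr_const cE' subrr.
Qed.

End Relation.

(** * Conjugates of the Levi subgroup containing the diagonal torus *)

Section TorusPair.
Context (F : numClosedFieldType) (n : nat) (p : seq nat).
Hypothesis hp : is_partition n p.
Local Notation p' := (transpose_part p).
Local Notation row := (fun a : 'I_n => reshape_index (transpose_part p) a).

(** Being carried into block diagonal form by a conjugation is a linear condition, and each diagonal
    matrix unit is a linear combination of torus elements and the identity. *)
Lemma torus_diag_supported (g : 'M[F]_n) : g \in unitmx ->
  @torus F n `<=` mxconj g @` block_levi p ->
  forall a, supported (eqR row) (mxconj (invmx g) (delta_mx a a)).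
Proof.
move=> ug TL a.
pose Q (A : 'M[F]_n) := supported (eqR row) (mxconj (invmx g) A).
have QD A B : Q A -> Q B -> Q (A + B).
  by move=> QA QB; rewrite /Q mxconjD; apply: supportedD.
have QZ c A : Q A -> Q (c *: A).
  by move=> QA i j ij; rewrite mxconjZ mxE QA ?mulr0.
have Q1 : Q 1%:M.
  by rewrite /Q mxconj_id ?unitmx_inv //; apply: supported_scalar; exact: eqR_refl.
have QT t : torus t -> Q t.
  by move=> /TL; rewrite image_mxconj // => -[].
have [[b ba]|nb] := pselect (exists b, b != a); last first.
  move=> i j; rewrite /eqR; have -> : i = j; last by rewrite eqxx.
  have ia c : c = a by apply/eqP/negPn/negP => ca; apply: nb; exists c.
  by rewrite (ia i) (ia j).
pose t (x : F) (c : 'I_n) := if c == a then x else if c == b then x^-1 else 1.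
have Tt x : x != 0 -> Q (diag_mx (\row_c t x c)).
  move=> x0; apply/QT/diag_mx_torus; rewrite (bigD1 a) //= (bigD1 b) //= big1 => [|c].
    by rewrite /t eqxx (negbTE ba) eqxx mulr1 mulfV.
  by rewrite /t => /andP[/negbTE -> /negbTE ->].
(* The coefficients are chosen to give 1 at [a], where the two torus elements are 3 and 2, and 0 at
   [b], where they are 1/3 and 1/2, and at the other places, where both are 1. *)
have E : delta_mx a a = (3%:R / 2%:R) *: (diag_mx (\row_c t 3%:R c) + (- (4%:R / 3%:R)) *:
  diag_mx (\row_c t 2%:R c) + (3%:R^-1) *: 1%:M) :> 'M[F]_n.
  apply/matrixP => i j; rewrite !mxE; have [->|ij] := eqVneq i j; last first.
    have -> : (i == a) && (j == a) = false.
      by apply: contraNF ij => /andP[/eqP -> /eqP ->].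
    by rewrite !mulr0n !mulr0 !addr0 mulr0.
  have tE : true%:R = 1 :> F by [].
  have fE : false%:R = 0 :> F by [].
  rewrite !mulr1n andbb /t; case: eqP => _; rewrite ?tE ?fE; first by field.
  by case: eqP => _; field.
rewrite E; apply/QZ/QD; last exact: QZ.
apply: (QD); first by apply: Tt; rewrite pnatr_eq0.
by apply/QZ/Tt; rewrite pnatr_eq0.
Qed.

(* A conjugator carrying the diagonal torus into a block Levi subgroup is
   monomial up to that Levi subgroup. *)
Lemma torus_pair (g : 'M[F]_n) (nu : 'M[F]_n -> F) (m : nat -> int) : SLn g ->
  @torus F n `<=` mxconj g @` block_levi p ->
  (forall A, block_levi p A -> nu (mxconj g A) = xi p m A) ->
  exists s : 'S_n, forall t, torus t -> nu t = \prod_a t a a ^ m (row (s a)).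
Proof.
move=> sg TL nuE; have ug := SLn_unit sg; have Q := torus_diag_supported ug TL.
have [s hs] : exists s : 'S_n, forall i, g i (s i) != 0.
  by apply: det_neq0_perm; rewrite sg oner_neq0.
have QE a r r' : mxconj (invmx g) (delta_mx a a) r r' = invmx g r a * g a r'.
  rewrite /mxconj invmxK mxE (bigD1 a) //= big1 ?addr0 => [|c ca]; last first.
    rewrite mxE (bigD1 a) //= big1 => [|d da]; last by rewrite mxE (negbTE da) mulr0.
    by rewrite mxE (negbTE ca) andbF mulr0 addr0 mul0r.
  congr (_ * _); rewrite mxE (bigD1 a) //= big1 => [|d da]; last by rewrite mxE (negbTE da) mulr0.
  by rewrite mxE eqxx mulr1 addr0.
(* The conjugated matrix unit is a column of the inverse of [g] times row [a] of [g]. As it is block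
   diagonal, that row meets only one block. *)
have supp a r r' : g a r != 0 -> g a r' != 0 -> row r = row r'.
  have [q gq] : exists q, invmx g q a != 0.
    apply: contrapT => nE; have : (g *m invmx g) a a = 1 by rewrite mulmxV // mxE eqxx.
    rewrite mxE big1 => [/eqP|q _]; first by rewrite eq_sym oner_eq0.
    by apply/eqP; rewrite mulf_eq0; apply/orP; right; apply/negPn/negP => gq; apply: nE; exists q.
  have H c : g a c != 0 -> row q = row c.
    move=> gc; apply/eqP/negPn/negP => /(Q a q c)/eqP.
    by rewrite QE mulf_eq0 (negbTE gq) (negbTE gc).
  by move=> /H <- /H.
have us := perm_mx_unit F s.
pose l := invmx (perm_mx s) *m g.
have gE : g = perm_mx s *m l by rewrite mulKVmx.
have ul : l \in unitmx by rewrite unitmx_mul unitmx_inv us.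
have ll : supported (eqR row) l.
  move=> i j ij; have := congr1 (fun M : 'M[F]_n => M ((s^-1)%g i) j) gE.
  rewrite -row_permE mxE permKV => <-; apply/eqP/negPn/negP => gj.
  move: ij; rewrite /eqR (supp _ _ _ gj (hs _)) permKV eqxx //.
exists s => t tt.
have [A LA tE] := TL _ tt; rewrite -{1}tE nuE //.
pose t' := diag_mx (\row_a t ((s^-1)%g a) ((s^-1)%g a)).
have AE : A = mxconj (invmx l) t'.
  rewrite -(mxconjK ug A) tE {1}gE invmxM // -mxconj_comp ?unitmx_inv //; congr mxconj.
  rewrite -[RHS](mxconjK us); congr mxconj; rewrite mxconj_perm.
  rewrite {1}(torus_diag tt); apply/matrixP => i j; rewrite !mxE permK.
  by rewrite (inj_eq (@perm_inj _ s)).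
have lV : supported (eqR row) (invmx l).
  by apply: supportedV => //; [exact: eqR_refl|exact: eqR_trans].
have lt' : supported (eqR row) t'.
  by apply: supported_diag; [exact: eqR_refl|exact: diag_mx_is_diag].
transitivity (xi p m t').
  apply: eq_bigr => i _; congr (_ ^ _); rewrite AE /mxconj invmxK.
  rewrite block_detM; last by apply: supportedM => //; exact: eqR_trans.
  rewrite block_detM // mulrAC -block_detM // mulVmx // block_det1 mul1r //.
rewrite (xi_diag hp) (reindex_inj (@perm_inj _ s)) /=.
by apply: eq_bigr => a _; rewrite permK.
Qed.

End TorusPair.

Lemma weight_unique (F : numClosedFieldType) n (v w : 'I_n -> int) :
  (forall t : 'M[F]_n, torus t -> \prod_a t a a ^ v a = \prod_a t a a ^ w a) ->
  exists z, forall a, v a = w a + z.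
Proof.
move=> H; case: n v w H => [|n'] v w H; first by exists 0; case.
exists (v ord0 - w ord0) => a.
have [->|a0] := eqVneq a ord0; first by rewrite addrC subrK.
have two0 : 2%:R != 0 :> F by rewrite pnatr_eq0.
pose t (c : 'I_n'.+1) : F := if c == a then 2%:R else if c == ord0 then 2%:R^-1 else 1.
have Tt : torus (diag_mx (\row_c t c)).
  apply/diag_mx_torus; rewrite (bigD1 a) //= (bigD1 ord0) 1?eq_sym //= big1 => [|c].
    by rewrite /t eqxx eq_sym (negbTE a0) eqxx mulr1 mulfV.
  by rewrite /t => /andP[/negbTE -> /negbTE ->].
have E (u : 'I_n'.+1 -> int) : \prod_c (diag_mx (\row_c t c)) c c ^ u c = 2%:R ^ (u a - u ord0).
  rewrite (bigD1 a) //= (bigD1 ord0) 1?eq_sym //= big1 => [|c /andP[ca c0]]; last first.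
    by rewrite !mxE eqxx mulr1n /t (negbTE ca) (negbTE c0) exp1rz.
  rewrite !mxE !eqxx !mulr1n /t eqxx eq_sym (negbTE a0) mulr1.
  by rewrite exprz_inv -expfzDr.
by have := H _ Tt; rewrite !E => /two_exp_inj; lia.
Qed.

(** * Lengths of weights and minimal lifts *)

Section WeylInnerProduct.
Context (R : realType) (n : nat) (ip : 'rV[R]_n -> 'rV[R]_n -> R).
Hypothesis hip : weyl_inner_product ip.
Implicit Types (u v w : 'rV[R]_n).
Let de (a : 'I_n) : 'rV[R]_n := delta_mx 0 a.

Lemma ip0 w : ip 0 w = 0.
Proof.
have := ip_linear hip 1 0 0 w; rewrite scale1r addr0 mul1r => /eqP.
by rewrite eq_sym -subr_eq0 addrK => /eqP.
Qed.

Lemma ip_sumZ (c : 'I_n -> R) (f : 'I_n -> 'rV[R]_n) w :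
  ip (\sum_a c a *: f a) w = \sum_a c a * ip (f a) w.
Proof.
elim/big_rec2: _ => [|a x y _ <-]; first exact: ip0.
by rewrite (ip_linear hip).
Qed.

Lemma ip_addc c v : ip (v + const_mx c) (v + const_mx c) = ip v v.
Proof.
have E w : ip (v + const_mx c) w = ip v w.
  by rewrite -[v]scale1r (ip_linear hip) (ip_const hip) addr0 mul1r scale1r.
by rewrite E (ip_sym hip) E.
Qed.

Lemma ip_ge0 v : 0 <= ip v v.
Proof.
have [[c ->]|nc] := pselect (exists c, v = const_mx c); first by rewrite (ip_const hip).
by apply/ltW/(ip_pos hip) => c; apply/eqP => vc; apply: nc; exists c.
Qed.

(** Invariance under permutations leaves two parameters: the product of a basis vector with itself
    and with another one. Their difference [al] is half the squared length of a root, hence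
    positive. *)
Lemma ip_formula : (1 < n)%N -> exists2 al : R, 0 < al & exists be : R,
  forall v, ip v v = al * (\sum_a v 0 a ^+ 2) + be * (\sum_a v 0 a) ^+ 2.
Proof.
move=> n1.
have dperm (s : 'S_n) a : col_perm s (de a) = de ((s^-1)%g a).
  apply/rowP => b; rewrite !mxE; congr (_%:R); congr nat_of_bool.
  by rewrite -(inj_eq (@perm_inj _ s) b) permKV.
have diag a b : ip (de a) (de a) = ip (de b) (de b).
  by rewrite -(ip_weyl hip (tperm a b)) dperm tpermV tpermL.
have offd a b c : a != b -> a != c -> ip (de a) (de b) = ip (de a) (de c).
  move=> ab ac; rewrite -(ip_weyl hip (tperm b c)) !dperm tpermV tpermL.
  by rewrite tpermD // eq_sym.
pose a0 : 'I_n := Ordinal (ltnW n1); pose a1 : 'I_n := Ordinal n1.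
have a01 : a0 != a1 by [].
pose be := ip (de a0) (de a1).
have n10 : (n.-1)%:R != 0 :> R by rewrite pnatr_eq0; lia.
(* Transpositions compare pairs with a common first vector. The vanishing product with the constant
   vector ties the off-diagonal value to the diagonal one, which is the same for all vectors. *)
have offall a b : a != b -> ip (de a) (de b) = be.
  have rel x y : x != y -> ip (de x) (de y) *+ n.-1 = - ip (de x) (de x).
    move=> xy; have : ip (const_mx 1) (de x) = 0 by exact: (ip_const hip).
    have -> : const_mx 1 = \sum_b 1 *: de b.
      apply/rowP => b'; rewrite summxE mxE (bigD1 b') //= big1 => [|c cb].
        by rewrite !mxE !eqxx mulr1 addr0.
      by rewrite !mxE eq_sym (negbTE cb) andbF mulr0.
    rewrite ip_sumZ (bigD1 x) //= mul1r (eq_bigr (fun=> ip (de x) (de y))).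
      rewrite sumr_const => /eqP; rewrite addrC addr_eq0 => /eqP <-; congr (_ *+ _).
      by rewrite -[n in LHS]card_ord -(cardC1 x) .
    by move=> c cx; rewrite mul1r (ip_sym hip); apply: offd => //; rewrite eq_sym.
  move=> ab; apply: (mulIf n10); rewrite !mulr_natr rel // rel //.
  by congr (- _); exact: diag.
pose al := ip (de a0) (de a0) - be.
have E a b : ip (de a) (de b) = be + al * (a == b)%:R.
  have [->|ab] := eqVneq a b; first by rewrite mulr1 /al addrC subrK; exact: diag.
  by rewrite mulr0 addr0 offall.
exists al; last first.
  exists be => v; have -> : v = \sum_a v 0 a *: de a by rewrite -row_sum_delta.
  set w := \sum_a _; have wE a : w 0 a = v 0 a by rewrite /w -row_sum_delta.
  rewrite {1}/w ip_sumZ.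
  rewrite (eq_bigr (fun a => v 0 a * (be * (\sum_b v 0 b) + al * v 0 a))); last first.
    move=> a _; congr (_ * _); rewrite (ip_sym hip) /w ip_sumZ mulr_sumr.
    rewrite (eq_bigr (fun b => be * v 0 b + al * ((b == a)%:R * v 0 b))).
      rewrite big_split /= -mulr_sumr -mulr_sumr; congr (_ + _ * _).
      rewrite (bigD1 a) //= eqxx mul1r big1 ?addr0 // => b ba.
      by rewrite (negbTE ba) mul0r.
    by move=> b _; rewrite E; ring.
  under [X in _ = al * X + _]eq_bigr => a _ do rewrite wE.
  under [X in _ = _ + _ * X ^+ 2]eq_bigr => a _ do rewrite wE.
  under eq_bigr => a _ do rewrite mulrDr.
  rewrite big_split /= -mulr_suml addrC; congr (_ + _); last by rewrite expr2; ring.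
  by rewrite mulr_sumr; apply: eq_bigr => a _; rewrite expr2; ring.
have : 0 < ip (de a0 - de a1) (de a0 - de a1).
  apply: (ip_pos hip) => c; apply/eqP => /rowP h.
  have := h a0; have := h a1; rewrite !mxE !eqxx /= => <-; rewrite sub0r subr0.
  by move=> /eqP; rewrite -subr_eq0 opprK -natrD pnatr_eq0.
have -> : de a0 - de a1 = (-1) *: de a1 + de a0 by rewrite scaleN1r addrC.
rewrite !(ip_linear hip) !(ip_sym hip _ ((-1) *: _ + _)) !(ip_linear hip) !E !eqxx.
rewrite [a1 == a0]eq_sym (negbTE a01) => h.
have tE : true%:R = 1 :> R by [].
have fE : false%:R = 0 :> R by [].
by move: h; rewrite tE fE; lra.
Qed.

(** With equal coordinate sums the second term of [ip_formula] is common to both sides. For [n <= 1]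
    equal sums already mean equal vectors. *)
Lemma ip_cmp v w : \sum_a v 0 a = \sum_a w 0 a ->
  (ip v v <= ip w w) = (\sum_a v 0 a ^+ 2 <= \sum_a w 0 a ^+ 2).
Proof.
move=> vw; have [n1|n1] := ltnP 1 n.
  have [al al0 [be E]] := ip_formula n1.
  by rewrite !E vw lerD2r ler_pM2l.
suff -> : v = w by rewrite !lexx.
apply/rowP => a; move: vw; rewrite (bigD1 a) //= [RHS](bigD1 a) //= !big1 ?addr0 //.
  by move=> b ba; case/eqP: ba; apply: val_inj => /=; have := ltn_ord a; have := ltn_ord b; lia.
by move=> b ba; case/eqP: ba; apply: val_inj => /=; have := ltn_ord a; have := ltn_ord b; lia.
Qed.

(** Weights are vectors modulo constants; their lengths can be compared on representatives shifted
    to have the same coordinate sum. *)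
Lemma weight_length_cmp (v w : 'rV[int]_n) (zv zw : int) (v' w' : 'I_n -> int) :
  (forall a, v 0 a = v' a + zv) -> (forall a, w 0 a = w' a + zw) ->
  \sum_a v' a = \sum_a w' a ->
  (weight_length ip v <= weight_length ip w) = (\sum_a v' a ^+ 2 <= \sum_a w' a ^+ 2).
Proof.
move=> vE wE vw; rewrite /weight_length ler_sqrt ?ip_ge0 //.
have E (x : 'rV[int]_n) (x' : 'I_n -> int) z : (forall a, x 0 a = x' a + z) ->
    map_mx intr x = \row_a (x' a)%:~R + const_mx z%:~R :> 'rV[R]_n.
  by move=> xE; apply/rowP => a; rewrite !mxE xE rmorphD.
rewrite (E _ _ _ vE) (E _ _ _ wE) !ip_addc ip_cmp.
  rewrite -(ler_int R) !rmorph_sum /=.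
  by congr (_ <= _); apply: eq_bigr => a _; rewrite mxE rmorphXn.
have := congr1 (fun z : int => z%:~R : R) vw; rewrite /= !rmorph_sum /= => h.
by under eq_bigr do rewrite mxE; under [RHS]eq_bigr do rewrite mxE.
Qed.

End WeylInnerProduct.

(** * Permutations of blocks of equal size *)

Section ClassPermutation.
Context (p : seq nat).
Local Notation p' := (transpose_part p).
Local Notation lam := (nth 0%N (transpose_part p)).

(** Exponents 0 or 1 with equal class sums take each of the two values equally often on the blocks
    of a given size. *)
Lemma class_perm (y s : nat -> nat) : (forall i, (y i <= 1)%N) -> (forall i, (s i <= 1)%N) ->
  (forall a, class_sum p y a = class_sum p s a) ->
  exists th : 'S_(size p'), (forall i, lam (th i) = lam i) /\ forall i, s (th i) = y i.
Proof.
move=> y1 s1 ys.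
have card1 (z : nat -> nat) a : (forall i, (z i <= 1)%N) ->
    #|[pred i : 'I_(size p') | (lam i, z i) == (a, 1%N)]| = class_sum p z a.
  move=> z1; rewrite /class_sum -sum1_card [LHS]big_mkcond [RHS]big_mkcond.
  apply: eq_bigr => i _; rewrite !inE xpair_eqE; case: (lam i == a) => //=.
  by have := z1 i; case: (z i) => [|[|]].
have card0 (z : nat -> nat) a : (forall i, (z i <= 1)%N) ->
    (#|[pred i : 'I_(size p') | (lam i, z i) == (a, 0%N)]| + class_sum p z a)%N = class_sum p
      (fun=> 1%N) a.
  move=> z1; rewrite /class_sum -sum1_card [X in (X + _)%N]big_mkcond [X in (_ + X)%N]big_mkcond
    [RHS]big_mkcond.
  rewrite -big_split; apply: eq_bigr => i _; rewrite !inE xpair_eqE; case: (lam i == a) => //=.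
  by have := z1 i; case: (z i) => [|[|]].
have [|th thE] := @perm_of_counts (size p') _ (fun i => (lam i, y i)) (fun i => (lam i, s i)).
  move=> [a [|[|b]]].
  - by apply/eqP; rewrite -(eqn_add2r (class_sum p y a)) card0 // ys card0.
  - by rewrite !card1.
  by rewrite !eq_card0 // => i; rewrite !inE xpair_eqE; apply/negP => /andP[_ /eqP];
     have := y1 i; have := s1 i; lia.
by exists th; split=> i; have [] := thE i.
Qed.

End ClassPermutation.

Section BlockPermutation.
Context (F : numClosedFieldType) (n : nat) (p : seq nat).
Hypothesis hp : is_partition n p.
Local Notation p' := (transpose_part p).
Local Notation lam := (nth 0%N (transpose_part p)).
Local Notation row := (fun a : 'I_n => reshape_index (transpose_part p) a).
Local Notation off := (fun a : 'I_n => reshape_offset (transpose_part p) a).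

(** The coordinates are permuted blockwise with offsets kept, which is possible because [th]
    preserves the sizes. *)
Lemma block_permutation (th : 'S_(size p')) : (forall i, lam (th i) = lam i) ->
  exists h : 'M[F]_n, [/\ SLn h, mxconj h @` block_levi p = block_levi p &
    forall (i : 'I_(size p')) A, block_det p i (mxconj h A) = block_det p (th i) A].
Proof.
move=> lth; have C := part_coords hp.
pose ri (a : 'I_n) : 'I_(size p') := Ordinal (row_lt hp a).
have P (a : 'I_n) : exists b : 'I_n, row b = th (ri a) /\ off b = off a.
  have [|b ? ?] := @coords_surj _ _ _ _ C (th (ri a)) (off a); last by exists b.
  by rewrite lth; exact: (coords_lt C).
pose q a := projT1 (cid (P a)).
have qr a : row (q a) = th (ri a) by case: (projT2 (cid (P a))).
have qo a : off (q a) = off a by case: (projT2 (cid (P a))).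
have rE a b : th (ri a) = th (ri b) -> row a = row b.
  by move=> /perm_inj/(congr1 val).
have q_inj : injective q.
  move=> a b qab; apply: (coords_inj C); last by rewrite -qo qab qo.
  by apply: rE; apply: val_inj; exact: etrans (esym (qr a)) (etrans (congr1 row qab) (qr b)).
have [h sh hE] := unit_SLn_conj (perm_mx_unit F (perm q_inj)).
exists h; split=> // [|i A]; rewrite hE.
  rewrite -[block_levi p]/(blockL row) blockL_perm; apply: eq_blockL => a b /=.
  rewrite !permE !qr val_eqE (inj_eq (@perm_inj _ th)) -val_eqE //.
rewrite mxconj_perm.
have -> : block_det p i (\matrix_(a, b) A (perm q_inj a) (perm q_inj b)) =
    let f u := perm q_inj (enum_val (A := mem (block n p i)) u) in \det (mxsub f f A).
  by congr (\det _); apply/matrixP => u v; rewrite !mxE.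
apply: det_mxsub_inj.
- by move=> u v /perm_inj/enum_val_inj.
- exact: enum_val_inj.
move=> a; split=> [[u <-]|[u <-]].
  have bu : perm q_inj (enum_val u) \in block n p (th i).
    have := enum_valP u; rewrite !inE permE => /eqP ru.
    rewrite qr; apply/eqP; congr (val (th _)); exact: val_inj.
  by exists (enum_rank_in bu (perm q_inj (enum_val u))); rewrite enum_rankK_in.
have ru : row (enum_val u) = th i.
  by have := enum_valP u; rewrite inE => /eqP.
pose b := ((perm q_inj)^-1)%g (enum_val u).
have qb : q b = enum_val u by rewrite -(permE q_inj) permKV.
have rb : ri b = i by apply: (@perm_inj _ th); apply: val_inj; apply: etrans (esym (qr b)) _;
  rewrite qb.
have bb : b \in block n p i by rewrite inE; apply/eqP; rewrite -[in RHS]rb.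
by exists (enum_rank_in bb b); rewrite enum_rankK_in // permKV.
Qed.

Lemma sum_row (V : zmodType) (f : nat -> V) (ga : 'S_n) :
  \sum_a f (row (ga a)) = \sum_(i < size p') f i *+ lam i.
Proof.
transitivity (\sum_a f (row a)); first by rewrite [RHS](reindex_inj (@perm_inj _ ga)).
rewrite (partition_big (fun a => Ordinal (row_lt hp a)) xpredT) //=.
apply: eq_bigr => i _; rewrite -(coords_card (part_coords hp) i) -sumr_const.
apply: eq_big => [a|a]; first by rewrite !inE -val_eqE.
by rewrite -val_eqE => /eqP /= ->.
Qed.

Lemma class_weighted (V : zmodType) (f g : nat -> V) :
  (forall a, \sum_(i < size p' | lam i == a) f i = \sum_(i < size p' | lam i == a) g i) ->
  \sum_(i < size p') f i *+ lam i = \sum_(i < size p') g i *+ lam i.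
Proof.
move=> fg.
have lN (i : 'I_(size p')) : (lam i < (\max_(i < size p') lam i).+1)%N.
  by rewrite ltnS; apply: (leq_bigmax (F := fun i : 'I__ => lam i)).
have E (h : nat -> V) : \sum_(i < size p') h i *+ lam i =
    \sum_(a < (\max_(i < size p') lam i).+1) (\sum_(i < size p' | lam i == a) h i) *+ a.
  rewrite (partition_big (fun i => Ordinal (lN i)) xpredT) //=.
  apply: eq_bigr => a _; rewrite -sumrMnl; apply: eq_big => [i|i].
    by rewrite -val_eqE.
  by rewrite -val_eqE => /eqP /= ->.
by rewrite !E; apply: eq_bigr => a _; rewrite fg.
Qed.

End BlockPermutation.

(** * Minimal lifts to a standard Levi subgroup *)

Section Minimal.
Context (R : realType) (n : nat) (p : seq nat).
Hypothesis hp : is_partition n p.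
Local Notation p' := (transpose_part p).
Local Notation lam := (nth 0%N (transpose_part p)).
Local Notation row := (fun a : 'I_n => reshape_index (transpose_part p) a).
Local Notation k := (gcd_parts p).
Context (j : nat) (hj : (j < k)%N).
Context (ip : 'rV[R]_n -> 'rV[R]_n -> R) (hip : weyl_inner_product ip).
Context (s : nat -> nat).
Hypothesis s1 : forall i, (s i <= 1)%N.
Hypothesis emuE : forall A : 'M[R[i]]_n, block_levi p A -> emu p j A = blockchar p s A.
Hypothesis hs : forall a, a \in p' -> (k * class_sum p s a = j * count_mem a p')%N.
Local Notation M := 'M[R[i]]_n.
Implicit Types (L : set M) (nu : M -> R[i]).

Let k0 : (0 < k)%N. Proof. exact: leq_ltn_trans hj. Qed.

Lemma xi_shift (m : nat -> int) c (A : M) : block_levi p A ->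
  xi p (fun i => m i - c) A = xi p m A.
Proof.
move=> LA.
have D0 i : block_det p i A != 0 by apply: (proj1 (multiplicative_block_det _ n p i)).
rewrite /xi (eq_bigr (fun i : 'I_(size p') =>
  block_det p i A ^ m i * block_det p i A ^ (- c))); last first.
  by move=> i _; rewrite expfzDr.
rewrite big_split /= -[RHS]mulr1; congr (_ * _).
transitivity ((\prod_(i < size p') block_det p i A) ^ (- c)).
  rewrite (big_morph (fun x => x ^ (- c)) (id1 := 1) (op1 := *%R)) ?exp1rz //.
  by move=> x y; rewrite expfzMl.
by rewrite (prod_block_det hp LA) exp1rz.
Qed.

Lemma xi_blockchar (y : nat -> nat) (A : M) : xi p (fun i => (y i)%:Z) A = blockchar p y A.
Proof. by apply: eq_bigr => i _. Qed.

(** The constant found by [relation_class] can be subtracted from all exponents without changing the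
    character, after which the class sums agree exactly. *)
Lemma lift_weight L nu : @torus _ n `<=` L -> lifts p (chi p j) L nu ->
  exists g (m : nat -> int) (ga : 'S_n), [/\ SLn g, L = mxconj g @` block_levi p,
    forall A, block_levi p A -> nu (mxconj g A) = xi p m A,
    forall a, \sum_(i < size p' | lam i == a) m i = \sum_(i < size p' | lam i == a) (s i)%:Z &
    forall t, torus t -> nu t = \prod_a t a a ^ m (row (ga a))].
Proof.
move=> TL /(lift_relation hp k0 emuE hs)[g [m [sg LE nuE rel]]].
have [c cE] := relation_class hp k0 rel.
have nuE' A : block_levi p A -> nu (mxconj g A) = xi p (fun i => m i - c) A.
  by move=> LA; rewrite nuE // xi_shift.
have TL' : @torus _ n `<=` mxconj g @` block_levi p by rewrite -LE.
have [ga gaE] := torus_pair hp sg TL' nuE'.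
by exists g, (fun i => m i - c), ga.
Qed.

Lemma weight_of_prod nu (w : 'rV[int]_n) (v : 'I_n -> int) : has_weight nu w ->
  (forall t, torus t -> nu t = \prod_a t a a ^ v a) -> exists z, forall a, w 0 a = v a + z.
Proof.
move=> hw hv; apply: (@weight_unique (R[i]) n (fun a => w 0 a) v) => t tt.
by rewrite -hv // hw.
Qed.

Let sq_le (m : nat -> int) (i : nat) : m i <= m i ^+ 2.
Proof. by case: (m i) => [[|x]|x]; nia. Qed.

(** An exponent is repeated on the torus as often as its block is large, so equal class sums give
    equal coordinate sums; squaring changes nothing for exponents 0 and 1. *)
Lemma class_le (m : nat -> int) (y : nat -> nat) (ga ga' : 'S_n) : (forall i, (y i <= 1)%N) ->
  (forall a, \sum_(i < size p' | lam i == a) m i = \sum_(i < size p' | lam i == a) (y i)%:Z) ->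
  \sum_a m (row (ga a)) = \sum_a (y (row (ga' a)))%:Z /\
  \sum_a ((y (row (ga' a)))%:Z) ^+ 2 <= \sum_a m (row (ga a)) ^+ 2.
Proof.
move=> y1 my; have E : \sum_a m (row (ga a)) = \sum_a (y (row (ga' a)))%:Z.
  by rewrite (sum_row hp m) (sum_row hp (fun i => (y i)%:Z));
    exact: (class_weighted (f := m) (g := fun i => (y i)%:Z) my).
split=> //; rewrite (eq_bigr (fun a => (y (row (ga' a)))%:Z)).
  by rewrite -E; apply: ler_sum => a _; exact: sq_le.
by move=> a _; have := y1 (row (ga' a)); case: (y _) => [|[|]].
Qed.

Lemma class_sumZ (y : nat -> nat) a :
  \sum_(i < size p' | lam i == a) (y i)%:Z = (class_sum p y a)%:Z.
Proof. by rewrite /class_sum -[RHS]natz natr_sum; apply: eq_bigr => i _; rewrite natz. Qed.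

Definition ind (S : {set 'I_(size p')}) (i : nat) : nat :=
  if insub i is Some i' then i' \in S else 0%N.

Lemma ind_le1 S i : (ind S i <= 1)%N.
Proof. by rewrite /ind; case: insub => [i'|] //; case: (_ \in _). Qed.

Lemma indE S (i : 'I_(size p')) : ind S i = (i \in S).
Proof. by rewrite /ind valK. Qed.

Lemma blockchar_ind S (A : M) : blockchar p (ind S) A = \prod_(i in S) block_det p i A.
Proof.
rewrite /blockchar [RHS]big_mkcond; apply: eq_bigr => i _; rewrite indE.
by case: (i \in S).
Qed.

Lemma class_sum_ind S a : class_sum p (ind S) a = #|[set i in S | lam i == a]|.
Proof.
rewrite /class_sum -sum1_card [LHS]big_mkcond [RHS]big_mkcond; apply: eq_bigr => i _.
by rewrite indE !inE; case: (i \in S); case: (_ == _).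
Qed.

Lemma class_eq (y : nat -> nat) :
  (forall a, a \in p' -> (k * class_sum p y a = j * count_mem a p')%N) ->
  forall a, class_sum p y a = class_sum p s a.
Proof.
move=> hy a; have [ap|ap] := boolP (a \in p').
  by apply/eqP; rewrite -(eqn_pmul2l k0) hy // hs.
by rewrite /class_sum !big_pred0 // => i; apply: contraNF ap => /eqP <-; apply: mem_nth.
Qed.

Lemma dist_lift (y : nat -> nat) g L nu :
  (forall a, a \in p' -> (k * class_sum p y a = j * count_mem a p')%N) ->
  SLn g -> L = mxconj g @` block_levi p ->
  (forall A, L A -> nu A = blockchar p y (mxconj (invmx g) A)) ->
  lifts p (chi p j) L nu.
Proof.
move=> hy sg LE nuE; rewrite LE; apply: (lifts_conj (nu := blockchar p y)) => //.
  exact: (blockchar_lift hp k0 emuE hs hy).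
by move=> A LA; apply: nuE; rewrite LE.
Qed.

Lemma dist_torus (y : nat -> nat) g L nu : SLn g -> L = mxconj g @` block_levi p ->
  @torus _ n `<=` L ->
  (forall A, L A -> nu A = blockchar p y (mxconj (invmx g) A)) ->
  exists ga : 'S_n, forall t, torus t -> nu t = \prod_a t a a ^ (y (row (ga a)))%:Z.
Proof.
move=> sg LE TL nuE; have ug := SLn_unit sg.
apply: (torus_pair hp (m := fun i => (y i)%:Z) sg); first by rewrite -LE.
move=> A LA; rewrite xi_blockchar nuE ?mxconjK // LE.
by exists A.
Qed.

Lemma dist_minimal S g L nu : equally_distributed j S ->
  SLn g -> L = mxconj g @` block_levi p ->
  (forall A, L A -> nu A = blockchar p (ind S) (mxconj (invmx g) A)) ->
  standard_levi L -> standard_minimal_lift ip p (chi p j) L nu.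
Proof.
move=> dS sg LE nuE sL; have [TL _] := sL.
have hy a : a \in p' -> (k * class_sum p (ind S) a = j * count_mem a p')%N.
  by move=> ap; rewrite class_sum_ind; apply: dS.
split=> //; first exact: (dist_lift hy sg LE nuE).
have [ga gaE] := dist_torus sg LE TL nuE.
exists (\row_a (ind S (row (ga a)))%:Z).
  by move=> t tt; rewrite gaE //; apply: eq_bigr => a _; rewrite mxE.
move=> mu w lmu hw.
have [g' [m [ga' [sg' LE' muE mcl muT]]]] := lift_weight TL lmu.
have [z zE] := weight_of_prod hw muT.
have mcl' a : \sum_(i < size p' | lam i == a) m i = \sum_(i < size p' | lam i == a) (ind S i)%:Z.
  by rewrite mcl !class_sumZ (class_eq hy).
have [sumE sqE] := class_le ga' ga (ind_le1 S) mcl'.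
rewrite (@weight_length_cmp R n ip hip _ _ 0 z (fun a => (ind S (row (ga a)))%:Z) (fun a =>
  m (row (ga' a)))) //.
by move=> a; rewrite mxE addr0.
Qed.

(** The competitor is [blockchar p s] transported to the same [L] by the same conjugator. Its
    exponents are 0 or 1, so minimality leaves no slack in the comparison of each exponent with its
    square. *)
Lemma minimal_dist L nu : standard_minimal_lift ip p (chi p j) L nu ->
  exists g (y : nat -> nat), [/\ SLn g, L = mxconj g @` block_levi p,
    forall A, L A -> nu A = blockchar p y (mxconj (invmx g) A),
    forall i, (y i <= 1)%N & forall a, class_sum p y a = class_sum p s a].
Proof.
move=> [[TL _] lnu [v hv vmin]].
have [g [m [ga [sg LE nuE mcl nuT]]]] := lift_weight TL lnu.
have ug := SLn_unit sg.
have [z zE] := weight_of_prod hv nuT.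
pose nu0 (A : M) := blockchar p s (mxconj (invmx g) A).
have l0 : lifts p (chi p j) L nu0 by apply: (dist_lift hs sg LE).
have [ga0 ga0E] := dist_torus sg LE TL (fun A _ => erefl (nu0 A)).
pose w0 : 'rV[int]_n := \row_a (s (row (ga0 a)))%:Z.
have hw0 : has_weight nu0 w0.
  by move=> t tt; rewrite ga0E //; apply: eq_bigr => a _; rewrite mxE.
have := vmin _ _ l0 hw0.
have [sumE sqE] := @class_le m s ga ga0 s1 mcl.
rewrite (@weight_length_cmp R n ip hip _ _ z 0 (fun a => m (row (ga a))) (fun a =>
  (s (row (ga0 a)))%:Z)) //; last first.
  by move=> a; rewrite mxE addr0.
move=> le.
have eqs : \sum_a (m (row (ga a)) ^+ 2 - m (row (ga a))) = 0.
  have s2 : \sum_a ((s (row (ga0 a)))%:Z) ^+ 2 = \sum_a (s (row (ga0 a)))%:Z.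
    by apply: eq_bigr => a _; have := s1 (row (ga0 a)); case: (s _) => [|[|]].
  apply/eqP; rewrite sumrB subr_eq0 eq_le; apply/andP; split.
    by rewrite sumE -s2; exact: le.
  by apply: ler_sum => a _; exact: sq_le.
(* No block is empty, so every exponent occurs among the coordinates of the weight. *)
have m01 (i : 'I_(size p')) : m i ^+ 2 = m i.
  have li : (0 < lam i)%N.
    by rewrite lt0n; apply: contraNneq (transpose_notin0 (part_sorted hp)) => <-; apply: mem_nth.
  have [a ra _] := coords_surj (part_coords hp) li.
  have ge0 b : true -> 0 <= m (row (ga b)) ^+ 2 - m (row (ga b)).
    by move=> _; rewrite subr_ge0; exact: sq_le.
  have /eqP := psumr_eq0P ge0 eqs (i := (ga^-1)%g a) isT.
  by rewrite permKV subr_eq0 => /eqP; rewrite ra.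
pose y i := if (i < size p')%N then `|m i|%N else 0%N.
have yE (i : 'I_(size p')) : (y i)%:Z = m i.
  rewrite /y ltn_ord gez0_abs // -m01; exact: sqr_ge0.
exists g, y; split=> //.
- move=> A; rewrite LE => -[B LB <-]; rewrite mxconjK // nuE // -xi_blockchar.
  by apply: eq_bigr => i _; rewrite yE.
- move=> i; rewrite /y; case: ifP => // ilt.
  by have := m01 (Ordinal ilt) => /=; nia.
move=> a; apply/eqP; rewrite -eqz_nat -!class_sumZ -mcl; apply/eqP.
by apply: eq_bigr => i _; rewrite yE.
Qed.

End Minimal.

(** * The equivalence of the three conditions *)

Section Equivalence.
Context (R : realType) (n : nat) (p : seq nat).
Hypothesis hp : is_partition n p.
Local Notation p' := (transpose_part p).
Local Notation k := (gcd_parts p).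
Context (j : nat) (hj : (j < k)%N).
Context (ip : 'rV[R]_n -> 'rV[R]_n -> R) (hip : weyl_inner_product ip).
Local Notation M := 'M[R[i]]_n.
Implicit Types (L : set M) (nu : M -> R[i]).

Lemma conjugate_pair_trans L3 nu3 L2 nu2 L1 nu1 :
  conjugate_pair L3 nu3 L2 nu2 -> conjugate_pair L2 nu2 L1 nu1 -> conjugate_pair L3 nu3 L1 nu1.
Proof.
move=> [g [sg L3E nu3E]] [h [sh L2E nu2E]]; have [ug uh] := (SLn_unit sg, SLn_unit sh).
exists (g *m h); split; first exact: SLnM.
  by rewrite L3E L2E image_mxconj_comp.
move=> A LA; rewrite nu3E // nu2E; first by rewrite invmxM // mxconj_comp ?unitmx_inv.
by move: LA; rewrite L3E => -[B LB <-]; rewrite mxconjK.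
Qed.

Lemma conjugate_emu_distributed L nu : conjugate_pair L nu (block_levi p) (emu p j) ->
  equally_distributed_weight p j L nu.
Proof.
move=> cE; exists (emu p j); split=> //; have [s [s1 emuE hs]] := emu_blockchar R[i] hp hj.
pose S := [set i : 'I_(size p') | s i == 1%N]%SET.
have sE (i : 'I_(size p')) : s i = ind S i.
  by rewrite indE inE; have := s1 i; case: (s i) => [|[|]].
exists S => [a ap|A LA].
  rewrite -class_sum_ind -hs //; congr (_ * _)%N.
  by apply: eq_bigr => i _; rewrite -sE.
by rewrite emuE // -blockchar_ind; apply: eq_bigr => i _; rewrite -sE.
Qed.

Lemma distributed_minimal L nu : equally_distributed_weight p j L nu ->
  minimal_lift ip p (chi p j) L nu.
Proof.
move=> [nu0 [[g [sg LE nuE]] [S dS nu0E]]]; have [s [s1 emuE hs]] := emu_blockchar R[i] hp hj.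
have ug := SLn_unit sg.
have hy a : a \in p' -> (k * class_sum p (ind S) a = j * count_mem a p')%N.
  by move=> ap; rewrite class_sum_ind; apply: dS.
have nuE' A : L A -> nu A = blockchar p (ind S) (mxconj (invmx g) A).
  move=> LA; rewrite nuE // nu0E ?blockchar_ind //.
  by move: LA; rewrite LE => -[B LB <-]; rewrite mxconjK.
split; first exact: (dist_lift hp hj emuE hs hy sg LE nuE').
have [sL|nsL] := pselect (standard_levi L); [left|right].
  exact: (dist_minimal hp hj hip emuE hs dS sg LE nuE' sL).
(* When [L] is not standard, the conjugate pair on [block_levi p] provides the standard one required
   by the definition. *)
split=> //; exists (block_levi p), nu0; split; first by exists g.
have sI : SLn (1%:M : M) by rewrite /SLn /= det1.
have LI : block_levi p = mxconj (1%:M : M) @` block_levi p.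
  by apply/seteqP; split=> [A LA|_ [A LA <-]]; [exists A|]; rewrite ?mxconj1.
apply: (dist_minimal hp hj hip emuE hs dS sI LI); last exact: standard_block_levi.
by move=> A LA; rewrite nu0E // invmx1 mxconj1 blockchar_ind.
Qed.

Lemma minimal_conjugate_emu L nu : minimal_lift ip p (chi p j) L nu ->
  conjugate_pair L nu (block_levi p) (emu p j).
Proof.
have [s [s1 emuE hs]] := emu_blockchar R[i] hp hj.
have std L1 nu1 : standard_minimal_lift ip p (chi p j) L1 nu1 ->
    conjugate_pair L1 nu1 (block_levi p) (emu p j).
  move=> /(minimal_dist hp hj hip s1 emuE hs)[g [y [sg LE nuE y1 ys]]].
  have [th [lth sth]] := class_perm y1 s1 ys.
  have [h [sh hL hD]] := block_permutation (R[i]) hp lth.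
  apply: (conjugate_pair_trans (L2 := block_levi p) (nu2 := blockchar p y)); first by exists g.
  exists h; split=> // A LA; rewrite emuE; last first.
    by move: LA; rewrite -{1}hL => -[B LB <-]; rewrite mxconjK // SLn_unit.
  rewrite -[A in LHS](mxconjVK (SLn_unit sh)) /blockchar [RHS](reindex_inj (@perm_inj _ th)).
  by apply: eq_bigr => i _; rewrite hD sth.
by move=> [_ [/std|[_ [L1 [nu1 [/conjugate_pair_trans tr /std/tr]]]]]].
Qed.

End Equivalence.

Theorem proposition6p10 (R : realType) (n : nat) (p : seq nat)
    (hp : is_partition n p) (j : nat) (hj : (j < gcd_parts p)%N)
    (ip : 'rV[R]_n -> 'rV[R]_n -> R) (hip : weyl_inner_product ip)
    (L' : set 'M[R[i]]_n) (hL' : richardson_levi p L')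
    (nu : 'M[R[i]]_n -> R[i]) (hnu : rational_character L' nu) :
  [<-> conjugate_pair L' nu (block_levi p) (emu p j);
       equally_distributed_weight p j L' nu;
       minimal_lift ip p (chi p j) L' nu].
Proof.
tfae.
- exact: (conjugate_emu_distributed hp hj).
- exact: (distributed_minimal hp hj hip).
- exact: (minimal_conjugate_emu hp hj hip).
Qed.
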